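(* Let $\Lambda$ be a weight function on $\mathbb{R}^{2n}$, $m\in\mathbb{R}$, $\rho\in(0,1]$, and let $(a_\epsilon)_\epsilon\in\overline{\mathcal{S}}^m_{\Lambda,\rho}$. For $(u_\epsilon)_\epsilon\in\mathcal{E}_\tau(\mathbb{R}^n)$ put $$A_\epsilon u_\epsilon(x)=(2\pi)^{-n}\int_{\mathbb{R}^{2n}}e^{i(x-y)\xi}a_\epsilon(x,y,\xi)u_\epsilon(y)\widehat{\varphi_\epsilon}(y)\,dy\,d\xi$$ (oscillatory integral). Then $$(u_\epsilon)_\epsilon\in\mathcal{E}_\tau(\mathbb{R}^n)\ \Rightarrow\ (A_\epsilon u_\epsilon)_\epsilon\in\mathcal{E}_\tau(\mathbb{R}^n),\qquad (u_\epsilon)_\epsilon\in\mathcal{N}_{\mathcal{S}}(\mathbb{R}^n)\ \Rightarrow\ (A_\epsilon u_\epsilon)_\epsilon\in\mathcal{N}_{\mathcal{S}}(\mathbb{R}^n).$$ Moreover, if $(a_\epsilon)_\epsilon\in\overline{\mathcal{N}}^m_{\Lambda,\rho}$, then $$(u_\epsilon)_\epsilon\in\mathcal{E}_\tau(\mathbb{R}^n)\ \Rightarrow\ (A_\epsilon u_\epsilon)_\epsilon\in\mathcal{N}_{\mathcal{S}}(\mathbb{R}^n).$$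
   Context: Notation: $\langle x\rangle=(1+|x|^2)^{1/2}$, $\hat f(\xi)=\int e^{-ix\xi}f(x)\,dx$. $f(z)\prec g(z)$ on a set means $f\le c\,g$ there with a constant $c>0$ independent of $z$; $f\sim g$ means $f\prec g$ and $g\prec f$. $\mathcal{E}[\mathbb{R}^p]$ is the algebra of all nets $(u_\epsilon)_{\epsilon\in(0,1]}$ with $u_\epsilon\in\mathcal{C}^\infty(\mathbb{R}^p)$. $\mathcal{E}_\tau(\mathbb{R}^n)$: all $(u_\epsilon)_\epsilon\in\mathcal{E}[\mathbb{R}^n]$ such that for all $\alpha\in\mathbb{N}^n$ there is $N\in\mathbb{N}$ with $\sup_{\epsilon\in(0,1]}\epsilon^N\|\langle x\rangle^{-N}\partial^\alpha u_\epsilon\|_{L^\infty}<\infty$. $\mathcal{N}_{\mathcal{S}}(\mathbb{R}^n)$: all $(u_\epsilon)_\epsilon\in\mathcal{E}[\mathbb{R}^n]$ such that for all $\alpha,\beta\in\mathbb{N}^n$, $q\in\mathbb{N}$, $\sup_{\epsilon\in(0,1]}\epsilon^{-q}\|x^\alpha\partial^\beta u_\epsilon\|_{L^\infty}<\infty$. Mollifier: $\varphi\in\mathcal{S}(\mathbb{R}^n)$ is fixed with $\int\varphi\,dx=1$ and $\int x^\alpha\varphi\,dx=0$ for all $\alpha\neq0$; $\varphi_\epsilon(x)=\epsilon^{-n}\varphi(x/\epsilon)$, so $\widehat{\varphi_\epsilon}(y)=\hat\varphi(\epsilon y)$. Weight function: a continuous real function $\Lambda$ on $\mathbb{R}^{2n}$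 such that (i) there is $\mu>0$ with $\langle z\rangle^\mu\prec\Lambda(z)\prec\langle z\rangle$ on $\mathbb{R}^{2n}$; (ii) $\Lambda(z)\sim\Lambda(\zeta)$ on $\{(z,\zeta):|\zeta-z|\le\mu\Lambda(z)\}$; (iii) for all $t\in\mathbb{R}^{2n}$, $\Lambda(tz)\prec\Lambda(z)$ on $\mathbb{R}^{2n}$, where $tz=(t_1z_1,\dots,t_{2n}z_{2n})$. Amplitudes: for $m'\in\mathbb{R}$ let $\lambda_{m,m',\alpha,\beta,\gamma}(x,y,\xi)=\Lambda(x,\xi)^m\langle x-y\rangle^{m'}\big(1+\Lambda(x,\xi)\langle x-y\rangle^{-m'}\big)^{-\rho|\alpha+\beta+\gamma|}$. $\overline{\mathcal{S}}^m_{\Lambda,\rho}$ is the set of all $(a_\epsilon)_\epsilon\in\mathcal{E}[\mathbb{R}^{3n}]$ for which there is $m'\in\mathbb{R}$ (independent of the derivatives) such that for all $\alpha,\beta,\gamma\in\mathbb{N}^n$ there are $N\in\mathbb{N}$, $c>0$ with $|\partial_\xi^\alpha\partial_x^\beta\partial_y^\gamma a_\epsilon(x,y,\xi)|\le c\,\lambda_{m,m',\alpha,\beta,\gamma}(x,y,\xi)\epsilon^{-N}$ for all $\epsilon\in(0,1]$, $(x,y,\xi)\in\mathbb{R}^{3n}$. $\overline{\mathcal{N}}^m_{\Lambda,\rho}$ (negligible amplitudes) is the subset of those for which, for a suitable $m'$ independent of the derivatives, for all $\alpha,\beta,\gamma$ and all $q\in\mathbb{N}$ there is $c>0$ such that the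 same estimate holds with $\epsilon^{-N}$ replaced by $\epsilon^q$. Oscillatory integral: $\int e^{i(x-y)\xi}c(x,y,\xi)\,dy\,d\xi:=\lim_{h\to0^+}\int e^{i(x-y)\xi}c(x,y,\xi)\psi(hy,h\xi)\,dy\,d\xi$ with $\psi\in\mathcal{S}(\mathbb{R}^{2n})$, $\psi(0)=1$; for the integrands considered the limit exists, is independent of $\psi$, and defines a smooth function of $x$. *)

(* Defs.v *)
From HB Require Import structures.
From mathcomp Require Import all_boot all_order all_algebra.
From mathcomp Require Import complex.
From mathcomp Require Import all_classical all_reals all_analysis.

Set Implicit Arguments.
Unset Strict Implicit.
Unset Printing Implicit Defensive.

Import Order.TTheory GRing.Theory Num.Theory.
Import numFieldNormedType.Exports.
Import Normc.

Local Open Scope classical_set_scope.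
Local Open Scope ring_scope.
Local Open Scope complex_scope.

Definition tcons (R : realType) (n : nat)
    (p : measurableTypeR R * n.-tuple (measurableTypeR R)) :
    n.+1.-tuple (measurableTypeR R) := [tuple of p.1 :: p.2].

(* Lebesgue measure on R^n, as the n-fold product of lebesgue_measure. *)
Fixpoint lebesgue_tuple (R : realType) (n : nat) :
    set (n.-tuple (measurableTypeR R)) -> \bar R :=
  match n with
  | 0 => dirac [tuple]
  | k.+1 => pushforward (@lebesgue_measure R \x @lebesgue_tuple R k)%E
                        (@tcons R k)
  end.

Section lebesgue_tuple_measure.
Variable R : realType.

Let measurable_tcons n : measurable_fun setT (@tcons R n).
Proof. by apply: measurable_cons. Qed.

Definition tuncons n (t : n.+1.-tuple (measurableTypeR R)) :
  measurableTypeR R * n.-tuple (measurableTypeR R) :=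
  (thead t, [tuple of behead t]).

Let measurable_tuncons n : measurable_fun setT (@tuncons n).
Proof.
apply: measurable_fun_pair; last exact: measurable_behead.
exact: measurable_tnth.
Qed.

Let tconsK n : cancel (@tcons R n) (@tuncons n).
Proof.
by move=> [a t]; rewrite /tcons /tuncons /=; congr pair; apply: val_inj.
Qed.

Let lebesgue_tuple_sigma_finite n :
  exists nu : {sigma_finite_measure
                set (n.-tuple (measurableTypeR R)) -> \bar R},
    @lebesgue_tuple R n = nu :> (set _ -> _).
Proof.
elim: n => [|n [mu muE]].
  pose d : {measure set (0.-tuple (measurableTypeR R)) -> \bar R} :=
    dirac [tuple].
  have sf : sigma_finite setT d.
    exists (fun=> setT); first by rewrite bigcup_const.
    by move=> k; split => //; rewrite /d/= diracT ltry.
  pose P := Measure_isSigmaFinite.Build _ _ _ (Measure.sort d) sf.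
  pose nu := HB.pack_for {sigma_finite_measure set _ -> \bar R}
    (Measure.sort d) P.
  by exists nu.
pose pm : {measure
    set (measurableTypeR R * n.-tuple (measurableTypeR R))%type -> \bar R} :=
  (@lebesgue_measure R \x mu)%E.
have pm_sf : sigma_finite setT pm.
  have /sigma_finiteP[F [TF ndF Foo]] := sigma_finiteT (@lebesgue_measure R).
  have /sigma_finiteP[G [TG ndG Goo]] := sigma_finiteT mu.
  exists (fun k => F k `*` G k).
    rewrite -setXTT TF TG predeqE => -[x y]; split.
      move=> [/= [k _ Fkx] [l _ Gly]]; exists (maxn k l) => //; split.
      - by have /subsetPset := ndF _ _ (leq_maxl k l); exact.
      - by have /subsetPset := ndG _ _ (leq_maxr k l); exact.
    by move=> [k _ []/= ? ?]; split; exists k.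
  move=> k; have [? ?] := Foo k; have [? ?] := Goo k.
  split; first exact: measurableX.
  by rewrite /pm/= product_measure1E// lte_mul_pinfty// ge0_fin_numE.
pose nu0 : set (n.+1.-tuple (measurableTypeR R)) -> \bar R :=
  pushforward pm (@tcons R n).
have -> : @lebesgue_tuple R n.+1 = nu0 by rewrite /= muE.
have nu00 : nu0 set0 = 0%E by rewrite /nu0 /pushforward preimage_set0 measure0.
have nu0_ge0 A : (0 <= nu0 A)%E by exact: (measure_ge0 pm).
have nu0_add : semi_sigma_additive nu0.
  move=> F mF tF mUF; rewrite /nu0 /pushforward preimage_bigcup.
  apply: measure_semi_sigma_additive.
  - by move=> k; rewrite -[X in measurable X]setTI; exact: measurable_tcons.
  - apply/trivIsetP => /= i j _ _ ij; rewrite -preimage_setI.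
    by move/trivIsetP : tF => /(_ _ _ _ _ ij) ->//; rewrite preimage_set0.
  - rewrite -preimage_bigcup -[X in measurable X]setTI.
    exact: measurable_tcons.
have sf : sigma_finite setT nu0.
  have [F FT Ffin] := pm_sf.
  exists (fun k => @tuncons n @^-1` F k).
    by rewrite -preimage_bigcup -FT preimage_setT.
  move=> k; have [mF Fk] := Ffin k; split.
    by rewrite -[X in measurable X]setTI; exact: measurable_tuncons.
  rewrite /nu0 /pushforward -comp_preimage.
  by rewrite (_ : _ \o _ = id) ?preimage_id//; apply/funext => x; exact: tconsK.
pose M := isMeasure.Build _ _ _ nu0 nu00 nu0_ge0 nu0_add.
pose mnu : {measure set _ -> \bar R} := HB.pack nu0 M.
pose P := Measure_isSigmaFinite.Build _ _ _ (Measure.sort mnu) sf.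
pose nu := HB.pack_for {sigma_finite_measure set _ -> \bar R}
  (Measure.sort mnu) P.
by exists nu.
Qed.

Let lebesgue_tuple0 n : @lebesgue_tuple R n set0 = 0%E.
Proof. by have [nu ->] := lebesgue_tuple_sigma_finite n; exact: measure0. Qed.

Let lebesgue_tuple_ge0 n A : (0 <= @lebesgue_tuple R n A)%E.
Proof. by have [nu ->] := lebesgue_tuple_sigma_finite n; exact: measure_ge0. Qed.

Let lebesgue_tuple_sigma_additive n :
  semi_sigma_additive (@lebesgue_tuple R n).
Proof.
have [nu ->] := lebesgue_tuple_sigma_finite n.
exact: measure_semi_sigma_additive.
Qed.

HB.instance Definition _ n := isMeasure.Build _ _ _ (@lebesgue_tuple R n)
  (lebesgue_tuple0 n) (@lebesgue_tuple_ge0 n)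
  (@lebesgue_tuple_sigma_additive n).

Let lebesgue_tuple_sigma_finiteT n : sigma_finite setT (@lebesgue_tuple R n).
Proof.
have [nu ->] := lebesgue_tuple_sigma_finite n; exact: sigma_finiteT.
Qed.

HB.instance Definition _ n := Measure_isSigmaFinite.Build _ _ _
  (@lebesgue_tuple R n) (lebesgue_tuple_sigma_finiteT n).

End lebesgue_tuple_measure.

(* Points of R^n are row vectors; since 'rV[R]_n carries no measure in the
   library, integrals over R^n are taken over n-tuples of coordinates. *)
Definition rvec (R : realType) (n : nat)
    (t : n.-tuple (measurableTypeR R)) : 'rV[R]_n := \row_i tnth t i.

Definition cintegral (R : realType) (n : nat) (f : 'rV[R]_n -> R[i]) : R[i] :=
  (\int[@lebesgue_tuple R n]_t complex.Re (f (rvec t))) +i*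
  (\int[@lebesgue_tuple R n]_t complex.Im (f (rvec t))).

Definition Linfty (R : realType) (n : nat) (f : 'rV[R]_n -> R[i]) : \bar R :=
  Lnorm (@lebesgue_tuple R n) +oo%E (fun t => (normc (f (rvec t)))%:E).

Section euclidean.
Variables (R : realType) (n : nat).
Implicit Types (x y : 'rV[R]_n) (alpha : 'rV[nat]_n).

Definition dotv x y : R := \sum_i x 0 i * y 0 i.

(* The library's norm on 'rV[R]_n is the max norm. *)
Definition enorm x : R := Num.sqrt (dotv x x).

Definition jap x : R := Num.sqrt (1 + enorm x ^+ 2).

Definition monom alpha x : R := \prod_i x 0 i ^+ alpha 0 i.

Definition mdeg alpha : nat := (\sum_i alpha ord0 i)%N.

End euclidean.

Definition expi (R : realType) (t : R) : R[i] := cos t +i* sin t.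

Section smooth_functions.
Variables (R : realType) (p : nat).

Definition partial (i : 'I_p) (g : 'rV[R]_p -> R) : 'rV[R]_p -> R :=
  fun x => 'D_(delta_mx 0 i) g x.

Definition smoothR (g : 'rV[R]_p -> R) : Prop :=
  forall s : seq 'I_p, let h := foldr partial g s in
  continuous h /\ forall i x, derivable h x (delta_mx 0 i).

(* Only applied to smooth functions, for which the order of the partial
   derivatives is immaterial. *)
Definition mpartialR (alpha : 'rV[nat]_p) (g : 'rV[R]_p -> R) :
    'rV[R]_p -> R :=
  foldr (fun i => iter (alpha 0 i) (partial i)) g (enum 'I_p).

Definition smooth (f : 'rV[R]_p -> R[i]) : Prop :=
  smoothR (fun x => complex.Re (f x)) /\ smoothR (fun x => complex.Im (f x)).

Definition mpartial (alpha : 'rV[nat]_p) (f : 'rV[R]_p -> R[i]) :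
    'rV[R]_p -> R[i] :=
  fun x => mpartialR alpha (fun y => complex.Re (f y)) x +i*
           mpartialR alpha (fun y => complex.Im (f y)) x.

Definition schwartz (f : 'rV[R]_p -> R[i]) : Prop :=
  smooth f /\
  forall alpha beta : 'rV[nat]_p,
    let v x := (monom alpha x)%:C * mpartial beta f x in
    (Linfty v < +oo)%E.

(* Only the values u eps for eps in ]0, 1] are relevant. *)
Definition net : Type := R -> 'rV[R]_p -> R[i].

Definition smooth_net (u : net) : Prop :=
  forall eps : R, 0 < eps <= 1 -> smooth (u eps).

Definition E_tau (u : net) : Prop :=
  smooth_net u /\
  forall alpha : 'rV[nat]_p, exists N : nat,
    let v eps x := (jap x ^- N)%:C * mpartial alpha (u eps) x in
    (ereal_sup [set (eps ^+ N)%R%:E * Linfty (v eps)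
               | eps in [set e : R | (0 < e <= 1)%R]] < +oo)%E.

Definition N_S (u : net) : Prop :=
  smooth_net u /\
  forall (alpha beta : 'rV[nat]_p) (q : nat),
    let v eps x := (monom alpha x)%:C * mpartial beta (u eps) x in
    (ereal_sup [set (eps ^- q)%R%:E * Linfty (v eps)
               | eps in [set e : R | (0 < e <= 1)%R]] < +oo)%E.

End smooth_functions.

Section mollifiers.
Variables (R : realType) (n : nat).

Definition fourier (f : 'rV[R]_n -> R[i]) (xi : 'rV[R]_n) : R[i] :=
  cintegral (fun x => expi (- dotv x xi) * f x).

Definition mollifier (phi : 'rV[R]_n -> R[i]) : Prop :=
  [/\ schwartz phi,
      cintegral phi = 1 &
      forall alpha : 'rV[nat]_n, alpha != 0 ->
        cintegral (fun x => (monom alpha x)%:C * phi x) = 0].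

Definition rescale (phi : 'rV[R]_n -> R[i]) (eps : R) : 'rV[R]_n -> R[i] :=
  fun x => (eps ^- n)%:C * phi (eps^-1 *: x).

End mollifiers.

Definition prec (R : realType) (T : Type) (D : set T) (f g : T -> R) : Prop :=
  exists2 c : R, 0 < c & forall z, D z -> f z <= c * g z.

Definition weight (R : realType) (n : nat) (Lambda : 'rV[R]_(n + n) -> R) :
    Prop :=
  [/\ continuous Lambda,
      exists2 mu : R, 0 < mu &
        [/\ prec setT (fun z => jap z `^ mu) Lambda,
            prec setT Lambda (@jap R (n + n)) &
            let D := [set w : 'rV[R]_(n + n) * 'rV[R]_(n + n) |
                       enorm (w.2 - w.1) <= mu * Lambda w.1] in
            prec D (fun w => Lambda w.1) (fun w => Lambda w.2) /\
            prec D (fun w => Lambda w.2) (fun w => Lambda w.1)] &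
      forall t : 'rV[R]_(n + n),
        prec setT (fun z : 'rV[R]_(n + n) => Lambda (\row_i (t 0 i * z 0 i)))
          Lambda].

Section amplitudes.
Variables (R : realType) (n : nat).
Variables (Lambda : 'rV[R]_(n + n) -> R) (m rho : R).

Definition lambda (m' : R) (alpha beta gamma : 'rV[nat]_n)
    (x y xi : 'rV[R]_n) : R :=
  let L := Lambda (row_mx x xi) in
  L `^ m * jap (x - y) `^ m' *
  (1 + L * jap (x - y) `^ (- m'))
    `^ (- rho * (mdeg alpha + mdeg beta + mdeg gamma)%:R).

(* The coordinates of R^(3n) are ordered as (x, y, xi), so the multi-index of
   the derivative d_xi^alpha d_x^beta d_y^gamma is (beta, gamma, alpha). *)
Definition amplitude_deriv (a : net R (n + (n + n))) (eps : R)
    (alpha beta gamma : 'rV[nat]_n) (x y xi : 'rV[R]_n) : R[i] :=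
  mpartial (row_mx beta (row_mx gamma alpha)) (a eps)
    (row_mx x (row_mx y xi)).

Definition amplitude (a : net R (n + (n + n))) : Prop :=
  smooth_net a /\
  exists m' : R, forall alpha beta gamma : 'rV[nat]_n,
  exists (N : nat) (c : R), 0 < c /\
    forall (eps : R) (x y xi : 'rV[R]_n), 0 < eps <= 1 ->
      normc (amplitude_deriv a eps alpha beta gamma x y xi)
        <= c * lambda m' alpha beta gamma x y xi * eps ^- N.

Definition negligible_amplitude (a : net R (n + (n + n))) : Prop :=
  amplitude a /\
  exists m' : R, forall (alpha beta gamma : 'rV[nat]_n) (q : nat),
  exists c : R, 0 < c /\
    forall (eps : R) (x y xi : 'rV[R]_n), 0 < eps <= 1 ->
      normc (amplitude_deriv a eps alpha beta gamma x y xi)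
        <= c * lambda m' alpha beta gamma x y xi * eps ^+ q.

End amplitudes.

Section oscillatory_integrals.
Variables (R : realType) (n : nat).
Implicit Types (c : 'rV[R]_n -> 'rV[R]_n -> 'rV[R]_n -> R[i]).

(* w : 'rV_(n + n) is the pair (y, xi). *)
Definition regularized_integral c (psi : 'rV[R]_(n + n) -> R[i])
    (x : 'rV[R]_n) (h : R) : R[i] :=
  cintegral (fun w : 'rV[R]_(n + n) =>
    expi (dotv (x - lsubmx w) (rsubmx w)) *
    c x (lsubmx w) (rsubmx w) * psi (h *: w)).

Definition is_oscillatory_integral c (x : 'rV[R]_n) (l : R[i]) : Prop :=
  forall psi : 'rV[R]_(n + n) -> R[i], schwartz psi -> psi 0 = 1 ->
    normc (regularized_integral c psi x h - l) @[h --> 0^'+] --> (0 : R).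

(* The common limit over all cut-offs psi; the default value 0 is only taken
   when the oscillatory integral does not exist. *)
Definition oscillatory_integral c (x : 'rV[R]_n) : R[i] :=
  xget 0 [set l | is_oscillatory_integral c x l].

End oscillatory_integrals.

Definition pseudo_diff_op (R : realType) (n : nat)
    (phi : 'rV[R]_n -> R[i]) (a : net R (n + (n + n))) (u : net R n) :
    net R n :=
  fun eps x => ((2 * pi) ^- n)%:C *
    oscillatory_integral
      (fun x y xi => a eps (row_mx x (row_mx y xi)) * u eps y *
                     fourier (rescale phi eps) y) x.

(* Main.v *)
(* The amplitude b = a u chi, where chi(y) is the Fourier transform of the
   mollifier at eps y, decreases faster than every power of y and grows at most
   polynomially in x and xi, with constants that are moderate or negligible in
   eps. Writing b = (1 + i xi_j) r with r = b / (1 + i xi_j) and integrating by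
   parts in y_j replaces b by r + d r / d y_j, which is smaller than b by a
   factor (1 + xi_j^2)^(1/2), up to a multiple of h that comes from the cut-off
   psi(h y, h xi). After finitely many steps the oscillatory integral is an
   absolutely convergent integral.

   The functions of x so obtained are stable under d/dx_j, which turns b into
   i xi_j b + d b / d x_j (regularised again), and under multiplication by x_j,
   which by an integration by parts in xi_j turns b into y_j b + i d b / d xi_j.
   All of them are bounded by the same power of x, so they are Schwartz functions
   of x, and their seminorms are moderate or negligible in eps. *)

Require Import Defs.
From mathcomp Require Import all_boot all_order all_algebra.
From mathcomp Require Import complex.
From mathcomp Require Import all_classical all_reals all_analysis.
From mathcomp Require Import measurable_realfun ess_sup_inf.
From mathcomp Require Import ring lra.

Set Implicit Arguments.
Unset Strict Implicit.
Unset Printing Implicit Defensive.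

Import Order.TTheory GRing.Theory Num.Theory.
Import numFieldNormedType.Exports.
Import Normc.

Local Open Scope classical_set_scope.
Local Open Scope ring_scope.
Local Open Scope complex_scope.

(** Absolute convergence alone does not give Schwartz functions: rapid decrease has to be recovered
    from one fixed power of x that bounds all iterated derivatives and all monomial multiples at
    once. For the amplitude such a power exists because m' is common to all derivatives and, rho
    being positive, the last factor of [lambda] is at most 1. For u the order of growth does depend
    on the derivative, but it concerns y only, where the transformed mollifier absorbs it. The
    regularised amplitudes are brought down to omega(xi)^-2, whereas omega(xi)^-1 already gives an
    integrable weight. The spare power pays for the factor xi_j that d/dx_j produces; the new
    integral still converges absolutely and can be regularised again. Uniformity in eps is carried
    by families indexed by eps, with a boolean telling negligible from moderate ones: a product is
    negligible as soon as one factor is. The same notions over a one-element index set describe the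
    cut-offs psi. *)

Section normc_theory.
Variable R : rcfType.
Implicit Types z : R[i].

Lemma normc_ge0 z : 0 <= normc z.
Proof. by case: z => a b; exact: sqrtr_ge0. Qed.

Lemma ler_Re_normc z : `|complex.Re z| <= normc z.
Proof.
case: z => a b /=; rewrite -sqrtr_sqr; apply: ler_wsqrtr.
by rewrite lerDl sqr_ge0.
Qed.

Lemma ler_Im_normc z : `|complex.Im z| <= normc z.
Proof.
case: z => a b /=; rewrite -sqrtr_sqr; apply: ler_wsqrtr.
by rewrite lerDr sqr_ge0.
Qed.

Lemma normc_le_ReIm z : normc z <= `|complex.Re z| + `|complex.Im z|.
Proof.
case: z => a b /=.
rewrite -[leRHS]ger0_norm ?addr_ge0// -[leRHS]sqrtr_sqr; apply: ler_wsqrtr.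
rewrite sqrrD !real_normK ?num_real// [leRHS]addrAC lerDl.
by rewrite mulrn_wge0// mulr_ge0.
Qed.

Lemma normc_real (a : R) : normc a%:C = `|a|.
Proof. by rewrite /= expr0n addr0 sqrtr_sqr. Qed.
End normc_theory.

(** * Integration over R^n: Fubini, integration by parts, parameters, essential suprema *)

Section lebesgue_tuple_theory.
Variable R : realType.
Implicit Types n p : nat.

(* Unlike the Japanese bracket, this weight is a product over the coordinates:
   the integral of its inverse is an iterated one-dimensional integral, and the
   factors are those gained by integrating by parts. *)
Definition omega p (x : 'rV[R]_p) : R := \prod_i (1 + x 0 i ^+ 2).

Lemma omega_ge1 p (x : 'rV[R]_p) : 1 <= omega x.
Proof.
rewrite /omega; elim/big_ind: _ => // [a b a1 b1|i _].
  by rewrite -[1]mulr1; apply: ler_pM.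
by rewrite lerDl sqr_ge0.
Qed.

Lemma omega_gt0 p (x : 'rV[R]_p) : 0 < omega x.
Proof. exact: lt_le_trans (omega_ge1 x). Qed.

Lemma omegaX_gt0 p (x : 'rV[R]_p) k : 0 < omega x ^+ k.
Proof. by rewrite exprn_gt0// omega_gt0. Qed.

Lemma continuous_prodr (T : topologicalType) (I : Type) (r : seq I)
    (F : I -> T -> R) :
  (forall i, continuous (F i)) -> continuous (fun x => \prod_(i <- r) F i x).
Proof.
move=> cF; elim: r => [|i r ih].
  by under eq_fun do rewrite big_nil; exact: cst_continuous.
under eq_fun do rewrite big_cons.
by move=> x; apply: continuousM; [exact: cF|exact: ih].
Qed.

Lemma cont_add (T : topologicalType) (f g : T -> R) :
  continuous f -> continuous g -> continuous (fun x => f x + g x).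
Proof. by move=> cf cg x; apply: continuousD; [exact: cf|exact: cg]. Qed.

Lemma cont_opp (T : topologicalType) (f : T -> R) :
  continuous f -> continuous (fun x => - f x).
Proof. by move=> cf x; apply: continuousN; exact: cf. Qed.

Lemma cont_mul (T : topologicalType) (f g : T -> R) :
  continuous f -> continuous g -> continuous (fun x => f x * g x).
Proof. by move=> cf cg x; apply: continuousM; [exact: cf|exact: cg]. Qed.

Lemma cont_exp (T : topologicalType) (f : T -> R) k :
  continuous f -> continuous (fun x => f x ^+ k).
Proof.
move=> cf; elim: k => [|k ih]; first exact: cst_continuous.
by under eq_fun do rewrite exprS; exact: cont_mul.
Qed.

Lemma cont_inv (T : topologicalType) (f : T -> R) :
  continuous f -> (forall x, f x != 0) -> continuous (fun x => (f x)^-1).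
Proof. by move=> cf f0 x; apply: continuousV; [exact: f0|exact: cf]. Qed.

Lemma cont_comp (T U V : topologicalType) (f : T -> U) (g : U -> V) :
  continuous f -> continuous g -> continuous (fun x => g (f x)).
Proof. by move=> cf cg x; apply: continuous_comp; [exact: cf|exact: cg]. Qed.

Lemma continuous_omega p : continuous (@omega p).
Proof.
apply: continuous_prodr => i; apply: cont_add; first exact: cst_continuous.
exact/cont_exp/coord_continuous.
Qed.

Definition vcons p (a : R) (x : 'rV[R]_p) : 'rV[R]_p.+1 :=
  \row_i oapp (x 0) a (unlift ord0 i).

Lemma rvec_tcons p a (t : p.-tuple (measurableTypeR R)) :
  rvec (tcons (a, t)) = vcons a (rvec t).
Proof.
apply/rowP => i; rewrite !mxE; case: unliftP => [j ->|->] /=.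
  by rewrite mxE tnthS.
by rewrite tnth0.
Qed.

Lemma omega_vcons p a (x : 'rV[R]_p) :
  omega (vcons a x) = (1 + a ^+ 2) * omega x.
Proof.
rewrite /omega big_ord_recl mxE unlift_none /=; congr (_ * _).
by apply: eq_bigr => i _; rewrite mxE liftK.
Qed.

(** The sigma-algebra on tuples is generated by the coordinates, so the open set is exhausted by
    countably many half-open cubes: those of the grids of mesh 1/(k+1) that it contains. *)
Lemma measurable_rvec_open p (U : set 'rV[R]_p) :
  open U -> measurable (@rvec R p @^-1` U).
Proof.
move=> oU.
pose box (z : p.-tuple int * nat) : set (p.-tuple (measurableTypeR R)) :=
  \bigcap_(i : 'I_p) [set t | tnth t i \in
     `[(tnth z.1 i)%:~R / z.2.+1%:R : R, (tnth z.1 i + 1)%:~R / z.2.+1%:R[].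
pose B z := if `[< box z `<=` @rvec R p @^-1` U >] then box z else set0.
have -> : @rvec R p @^-1` U = \bigcup_z B z.
  apply/seteqP; split=> [t /= Ut|t [z _]]; last first.
    by rewrite /B; case: asboolP => // sub /sub.
  move: oU; rewrite openE => /(_ _ Ut) /nbhs_ballP[e /= e0 eU].
  have [k ke] : exists k : nat, k.+1%:R^-1 < e.
    near \oo => k; exists k; near: k.
    exact: (near_infty_natSinv_lt (PosNum e0)).
  pose z := [tuple Num.floor (tnth t i * k.+1%:R) | i < p].
  have k0 : (0 : R) < k.+1%:R by rewrite ltr0n.
  have btz : box (z, k) t.
    move=> i _ /=; rewrite in_itv/= tnth_mktuple ler_pdivrMr// ltr_pdivlMr//.
    by rewrite ge_floor/= floorD1_gt.
  exists (z, k) => //; rewrite /B; case: asboolP => // -[s bs] /=.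
  apply: eU; split => // i j; rewrite (ord1 i) !mxE /ball/=.
  have := btz j I; have := bs j I => /=; rewrite !in_itv/= => /andP[s1 s2] /andP[t1 t2].
  have {}ke : (tnth z j + 1)%:~R / k.+1%:R - (tnth z j)%:~R / k.+1%:R < e.
    by rewrite -mulrBl intrD addrAC subrr add0r mul1r.
  have aux (a b c d : R) : c <= a -> a < d -> c <= b -> b < d -> d - c < e ->
    `|a - b| < e by move=> *; rewrite ltr_norml; lra.
  exact: aux t1 t2 s1 s2 ke.
apply: countable_bigcupT_measurable; first exact: countableP.
move=> z; rewrite /B; case: asboolP => // _.
apply: fin_bigcap_measurable; first exact: finite_finset.
move=> i _; rewrite -[X in measurable X]setTI.
exact: (@measurable_tnth _ (measurableTypeR R) p i measurableT
  [set` `[_, _[] (measurable_itv _)).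
Unshelve. all: by end_near. Qed.

Lemma measurable_rvec p (f : 'rV[R]_p -> R) : continuous f ->
  measurable_fun setT (fun t => f (rvec t)).
Proof.
move=> /continuousP cf; apply: (measurability _ (measurable_realfun.RGenOpens.measurableE R)).
move=> _ [_ [a [b ->]] <-]; rewrite setTI.
exact: (measurable_rvec_open (cf _ (@interval_open _ _ _ _ _))).
Qed.

Local Notation mu := (@lebesgue_measure R).
Local Notation lam p := (@lebesgue_tuple R p).

Lemma measurable_tcons n : measurable_fun setT (@tcons R n).
Proof. by apply: measurable_cons. Qed.

Lemma integrable_oneDsqrV :
  mu.-integrable [set: R] (fun a : R => ((1 + a ^+ 2)^-1)%:E).
Proof.
have cf : continuous (fun a : R => (1 + a ^+ 2)^-1) :=
  @continuous_oneDsqrV R.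
have mf : measurable_fun [set: R] (fun a : R => ((1 + a ^+ 2)^-1)%:E).
  by apply/measurable_EFinP; exact: (continuous_measurable_fun cf).
have f0 (a : R) : 0 <= (1 + a ^+ 2)^-1.
  by rewrite invr_ge0 addr_ge0// sqr_ge0.
apply/integrableP; split => //.
under eq_integral do rewrite gee0_abs ?lee_fin//.
rewrite ge0_symfun_integralT//=; last first.
  by move=> x; rewrite /= sqrrN.
rewrite (_ : [set x | _] = `[0, +oo[%classic); last first.
  by apply/seteqP; split => x/=; rewrite in_itv/= andbT.
by rewrite integral0y_oneDsqr -EFinM ltry.
Qed.

Lemma ge0_integral_tupleS p (f : p.+1.-tuple (measurableTypeR R) -> \bar R) :
  measurable_fun setT f -> (forall t, 0 <= f t)%E ->
  (\int[lam (p.+1)]_t f t = \int[mu]_a \int[lam p]_t f (tcons (a, t)))%E.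
Proof.
move=> mf f0.
rewrite [LHS](_ : _ = \int[pushforward (mu \x lam p) (@tcons R p)]_t f t)%E //.
rewrite ge0_integral_pushforward//; last exact: measurable_tcons.
rewrite preimage_setT fubini_tonelli1//.
  by apply: measurableT_comp => //; exact: measurable_tcons.
by move=> x; exact: f0.
Qed.
Lemma ge0_integral_omegaV p :
  (\int[lam p]_t ((omega (rvec t))^-1)%:E < +oo)%E.
Proof.
have m q : measurable_fun setT (fun t => ((omega (@rvec R q t))^-1)%:E).
  apply/measurable_EFinP.
  apply: (@measurable_rvec _ (fun x : 'rV[R]_q => (omega x)^-1)).
  by apply: cont_inv; [exact: continuous_omega|move=> x; rewrite gt_eqF ?omega_gt0].
have w0 q (x : 'rV[R]_q) : (0 <= ((omega x)^-1)%:E)%E.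
  by rewrite lee_fin invr_ge0 ltW ?omega_gt0.
elim: p => [|p ih].
  rewrite integral_dirac//; last exact: m.
  by rewrite /dirac indicE in_setT mul1e ltry.
rewrite (ge0_integral_tupleS (m p.+1))//.
have b0 (a : R) : (0 <= ((1 + a ^+ 2)^-1)%:E)%E.
  by rewrite lee_fin invr_ge0 addr_ge0 ?sqr_ge0.
have step (a : R) : (\int[lam p]_t ((omega (rvec (tcons (a, t))))^-1)%:E =
    ((1 + a ^+ 2)^-1)%:E * \int[lam p]_t ((omega (rvec t))^-1)%:E)%E.
  under eq_integral do rewrite rvec_tcons omega_vcons invfM EFinM.
  by rewrite ge0_integralZl//; exact: m.
under eq_integral do rewrite step.
have /integrableP[mf] := integrable_oneDsqrV.
under [X in (X < _)%E -> _]eq_integral do rewrite gee0_abs//.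
move=> fin; rewrite ge0_integralZr//; last exact: integral_ge0.
rewrite lte_mul_pinfty//; first exact: integral_ge0.
by rewrite ge0_fin_numE//; exact: integral_ge0.
Qed.
(** Because [omega] is a product over the coordinates, this class is stable under freezing a
    coordinate, which is what Fubini and inductions on the dimension require. *)
Definition dominated p (f : 'rV[R]_p -> R) :=
  continuous f /\ exists C, forall x, `|f x| <= C / omega x.

Lemma integrable_dominated p (f : 'rV[R]_p -> R) : dominated f ->
  (lam p).-integrable setT (fun t => (f (rvec t))%:E).
Proof.
move=> [cf [C fC]].
have ci : continuous (fun x : 'rV[R]_p => C * (omega x)^-1).
  apply: cont_mul; first exact: cst_continuous.
  by apply: cont_inv; [exact: continuous_omega|move=> x; rewrite gt_eqF ?omega_gt0].
have iw : (lam p).-integrable setT (fun t => (C * (omega (rvec t))^-1)%:E).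
  under eq_fun do rewrite EFinM.
  apply: integrableZl => //; apply/integrableP; split.
    apply/measurable_EFinP.
    apply: (@measurable_rvec _ (fun x : 'rV[R]_p => (omega x)^-1)).
    by apply: cont_inv; [exact: continuous_omega|move=> x; rewrite gt_eqF ?omega_gt0].
  under eq_integral do rewrite gee0_abs ?lee_fin ?invr_ge0 ?ltW ?omega_gt0//.
  exact: ge0_integral_omegaV.
apply: le_integrable iw => //; first by apply/measurable_EFinP; exact: measurable_rvec.
move=> t _; rewrite lee_fin; apply: le_trans (fC _) _; exact: ler_norm.
Qed.

Lemma integrable_dominated_tcons p (f : 'rV[R]_p.+1 -> R) : dominated f ->
  (mu \x lam p)%E.-integrable setT (fun z => (f (rvec (tcons z)))%:E).
Proof.
move=> df; have /integrableP[mf] := integrable_dominated df.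
rewrite ge0_integral_tupleS//; last exact: measurableT_comp.
move=> fin; apply/integrable12ltyP => //.
apply: (measurableT_comp mf); exact: measurable_tcons.
Qed.

Lemma integral_tupleS p (f : 'rV[R]_p.+1 -> R) : dominated f ->
  (\int[lam (p.+1)]_t (f (rvec t))%:E =
   \int[mu \x lam p]_z (f (rvec (tcons z)))%:E)%E.
Proof.
move=> df; have /integrableP[mf _] := integrable_dominated df.
rewrite [LHS](_ : _ =
  \int[pushforward (mu \x lam p) (@tcons R p)]_t (f (rvec t))%:E)%E //.
by rewrite integral_pushforward//; [exact: measurable_tcons|exact: integrable_dominated_tcons].
Qed.

Lemma integral_tupleS12 p (f : 'rV[R]_p.+1 -> R) : dominated f ->
  (\int[lam (p.+1)]_t (f (rvec t))%:E =
   \int[mu]_a \int[lam p]_t (f (vcons a (rvec t)))%:E)%E.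
Proof.
move=> df; rewrite integral_tupleS// -integral12_prod_meas1; last exact: integrable_dominated_tcons.
by apply: eq_integral => a _; apply: eq_integral => t _; rewrite -rvec_tcons.
Qed.

Lemma integral_tupleS21 p (f : 'rV[R]_p.+1 -> R) : dominated f ->
  (\int[lam (p.+1)]_t (f (rvec t))%:E =
   \int[lam p]_t \int[mu]_a (f (vcons a (rvec t)))%:E)%E.
Proof.
move=> df; rewrite integral_tupleS// -integral21_prod_meas1; last exact: integrable_dominated_tcons.
by apply: eq_integral => a _; apply: eq_integral => t _; rewrite -rvec_tcons.
Qed.
(** The two difference quotients are the same function of [h], so only a directional derivative of
    [f] has to exist. Used for lines, frozen coordinates and coordinate projections. *)
Lemma is_derive_comp_affine (U V : normedModType R) (phi : U -> V) (f : V -> R)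
    a v u d :
  (forall h : R, phi (h *: v + a) = h *: u + phi a) ->
  is_derive (phi a) u f d -> is_derive a v (fun x => f (phi x)) d.
Proof.
move=> phiE [df dfE].
have E : (fun h : R => h^-1 *: (((fun x => f (phi x)) \o shift a) (h *: v) -
    f (phi a))) =
    (fun h => h^-1 *: ((f \o shift (phi a)) (h *: u) - f (phi a))).
  by apply/funext => h /=; rewrite phiE.
by apply: DeriveDef; [rewrite /derivable E|rewrite /derive E].
Qed.

(** Over [-k, k] the integral is g(k) - g(-k), which tends to 0 by the decay of [g]; by dominated
    convergence it also tends to the full integral. *)
Lemma integral_derive0 (g dg : R -> R) C :
  (forall x, is_derive x (1 : R) g (dg x)) -> continuous dg ->
  (forall x, `|g x| <= C / (1 + x ^+ 2)) ->
  (forall x, `|dg x| <= C / (1 + x ^+ 2)) ->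
  (\int[mu]_x (dg x)%:E = 0)%E.
Proof.
move=> gd cdg gC dgC.
have mdg : measurable_fun [set: R] (fun x => (dg x)%:E).
  by apply/measurable_EFinP; exact: (continuous_measurable_fun cdg).
pose G (x : R) : \bar R := (C / (1 + x ^+ 2))%:E.
have iG : mu.-integrable [set: R] G.
  rewrite /G; under eq_fun do rewrite EFinM.
  by apply: integrableZl => //; exact: integrable_oneDsqrV.
pose S (k : nat) : set R := `[- k%:R, k%:R]%classic.
pose F (k : nat) : R -> \bar R := (fun x => (dg x)%:E) \_ (S k).
have FE k : (0 < k)%N -> (\int[mu]_x F k x = (g k%:R - g (- k%:R))%:E)%E.
  move=> k0; rewrite -integral_mkcond (@continuous_FTC2 _ dg g)//.
  - by rewrite gtrN// ltr0n.
  - exact: continuous_subspaceT.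
  - split.
    + by move=> x _; have [] := gd x.
    + apply: cvg_at_right_filter; apply: differentiable_continuous.
      by apply/derivable1_diffP; have [] := gd (- k%:R).
    + apply: cvg_at_left_filter; apply: differentiable_continuous.
      by apply/derivable1_diffP; have [] := gd (k%:R).
  - by move=> x _; rewrite derive1E; have [_ ->] := gd x.
have Fdg : (\int[mu]_x F k x)%E @[k --> \oo] --> (\int[mu]_x (dg x)%:E)%E.
  apply: (@dominated_cvg _ _ _ mu [set: R] _ F _ G) => //.
  - move=> k; apply/(measurable_restrictT _ _).1 => //.
      exact: measurable_itv.
    exact: measurable_funS mdg.
  - move=> x _; apply: cvg_near_cst.
    near=> k; rewrite /F /patch mem_set// /S/= in_itv/= -ler_norml.
    by near: k; exact: nbhs_infty_ger.
  - move=> k x _; rewrite /F /patch; case: ifPn => _ //; last first.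
      rewrite [X in (X <= _)%E](_ : _ = 0%E); last exact: abse0.
      by rewrite lee_fin (le_trans _ (gC x)).
    by rewrite lee_fin; exact: dgC.
have F0 : (\int[mu]_x F k x)%E @[k --> \oo] --> (0 : \bar R)%E.
  suff gk0 : (g k%:R - g (- k%:R)) @[k --> \oo] --> (0 : R).
    have : (g k%:R - g (- k%:R))%:E @[k --> \oo] --> (0%:E : \bar R).
      by apply: cvg_EFin => //; exact: nearW.
    apply: cvg_trans; apply: near_eq_cvg; near=> k.
    by rewrite FE//; near: k; exact: nbhs_infty_gt.
  have C0 : 0 <= C.
    by have := le_trans (normr_ge0 _) (gC 0); rewrite expr0n addr0 divr1.
  (* At x = k and x = -k the bound C/(1 + k^2) is at most 2C/(k+1), which compares [g] with the
     harmonic sequence. *)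
  have bnd (k : nat) (x : R) : x ^+ 2 = k%:R ^+ 2 ->
      `|g x| <= 2 * C * k.+1%:R^-1.
    move=> xk; apply: le_trans (gC x) _; rewrite xk [2 * C]mulrC -mulrA.
    apply: ler_wpM2l => //; rewrite -[k.+1%:R]natr1.
    have : (0 : R) <= k%:R by rewrite ler0n.
    move: (k%:R : R) => a a0.
    have a1 : 0 < a + 1 by lra.
    have a2 : 0 < 1 + a ^+ 2 by nra.
    have := sqr_ge0 (a - 1).
    by rewrite ler_pdivlMr// mulrC ler_pdivrMr//; nra.
  have h0 : (4 * C * k.+1%:R^-1) @[k --> \oo] --> (0 : R).
    by rewrite -[X in _ --> X](mulr0 (4 * C)); apply: cvgMr; exact: cvg_harmonic.
  apply/norm_cvg0P; apply: (@squeeze_cvgr _ _ _ _ (cst 0) _ _ _ _ _ h0).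
    near=> k; rewrite normr_ge0/= (le_trans (ler_normB _ _))//.
    apply: le_trans (lerD (bnd k _ erefl) (bnd k _ (sqrrN _))) _.
    by rewrite -mulrDl -mulrDl -natrD.
  exact: cvg_cst.
by apply: cvg_unique Fdg F0.
Unshelve. all: by end_near. Qed.
Lemma continuous_rV (T : topologicalType) p (F : T -> 'rV[R]_p) :
  (forall i, continuous (fun t => F t 0 i)) -> continuous F.
Proof.
move=> cF t; apply/cvg_ballP => e e0.
have h i : \forall s \near t, ball (F t 0 i) e (F s 0 i).
  by have /cvg_ballP := cF i t; apply.
near=> s; split => // i j; rewrite (ord1 i).
by move: j; near: s; apply: filter_forall.
Unshelve. all: by end_near. Qed.

Lemma vcons0E p a h (x : 'rV[R]_p) :
  vcons (h *: (1 : R) + a) x = h *: delta_mx 0 ord0 + vcons a x.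
Proof.
apply/rowP => i; rewrite !mxE; case: unliftP => [j ->|->] /=.
  by rewrite mulr0 add0r.
by [].
Qed.

Lemma vconsSE p a h (x : 'rV[R]_p) i :
  vcons a (h *: delta_mx 0 i + x) = h *: delta_mx 0 (lift ord0 i) + vcons a x.
Proof.
apply/rowP => j; rewrite !mxE; case: unliftP => [k ->|->] /=.
  by rewrite !mxE !eqxx /= (inj_eq lift_inj).
by rewrite mulr0 add0r.
Qed.

Lemma continuous_vconsr p a : continuous (@vcons p a).
Proof.
apply: continuous_rV => i; rewrite /vcons.
case: (unliftP ord0 i) => [j ->|->].
  by under eq_fun do rewrite mxE liftK; exact: coord_continuous.
by under eq_fun do rewrite mxE unlift_none; exact: cst_continuous.
Qed.

Lemma continuous_vconsl p (x : 'rV[R]_p) : continuous (fun a => vcons a x).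
Proof.
apply: continuous_rV => i; rewrite /vcons.
case: (unliftP ord0 i) => [j ->|->].
  by under eq_fun do rewrite mxE liftK; exact: cst_continuous.
by under eq_fun do rewrite mxE unlift_none; move=> a; exact: cvg_id.
Qed.

Lemma dominated_vcons p (f : 'rV[R]_p.+1 -> R) a :
  dominated f -> dominated (fun x => f (vcons a x)).
Proof.
move=> [cf [C fC]]; split.
  exact: (cont_comp (@continuous_vconsr p a) cf).
exists (C / (1 + a ^+ 2)) => x.
by rewrite -mulrA -invfM -omega_vcons.
Qed.

(** The order in Fubini is chosen so that the inner integral vanishes: the first coordinate is
    integrated first if it is the differentiated one, and otherwise it is frozen and the induction
    hypothesis applies to the others. *)
Lemma integral_partial p (i : 'I_p) (f df : 'rV[R]_p -> R) :
  dominated f -> dominated df ->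
  (forall x, is_derive x (delta_mx 0 i) f (df x)) ->
  (\int[lam p]_t (df (rvec t))%:E = 0)%E.
Proof.
elim: p i f df => [|p ih] i f df domf domdf fd; first by case: i fd.
case: (unliftP ord0 i) fd => [j ->|->] fd.
  rewrite integral_tupleS12//; apply: integral0_eq => a _.
  apply: (ih j (fun x => f (vcons a x)) (fun x => df (vcons a x))).
  - exact: dominated_vcons.
  - exact: dominated_vcons.
  - move=> x; apply: is_derive_comp_affine (fd _) => h.
    exact: vconsSE.
rewrite integral_tupleS21//; apply: integral0_eq => t _.
have [_ [C fC]] := domf; have [cdf [D dfD]] := domdf.
have wa (a : R) : 0 <= (1 + a ^+ 2)^-1 by rewrite invr_ge0 addr_ge0 ?sqr_ge0.
have le1 (B E a : R) : B <= E ->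
    B / omega (vcons a (rvec t)) <= E / omega (rvec t) / (1 + a ^+ 2).
  move=> BE; rewrite omega_vcons invfM mulrA mulrAC.
  by rewrite !ler_wpM2r// invr_ge0 ltW// omega_gt0.
apply: (@integral_derive0 (fun a => f (vcons a (rvec t)))
  (fun a => df (vcons a (rvec t))) ((`|C| + `|D|) / omega (rvec t))).
- by move=> a; apply: is_derive_comp_affine (fd _) => h; exact: vcons0E.
- exact: (cont_comp (@continuous_vconsl _ _) cdf).
- move=> a; apply: le_trans (fC _) (le1 _ _ _ _).
  by rewrite (le_trans (ler_norm _))// lerDl.
- move=> a; apply: le_trans (dfD _) (le1 _ _ _ _).
  by rewrite (le_trans (ler_norm _))// lerDr.
Qed.
Definition integ p (f : 'rV[R]_p -> R) : R := (\int[lam p]_t f (rvec t))%R.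

(** Dominated convergence speaks of sequences. If continuity failed, points [u k] within 1/(k+1) of
    [x0], and inside the ball where the domination holds, would keep the integrals at distance at
    least [e]. *)
Lemma continuous_integ (X : pseudoMetricType R) p (c : X -> 'rV[R]_p -> R) x0 C :
  (forall x, continuous (c x)) ->
  (\forall x \near x0, forall w, `|c x w| <= C / omega w) ->
  (forall w, {for x0, continuous (fun x => c x w)}) ->
  {for x0, continuous (fun x => integ (c x))}.
Proof.
move=> cc /nbhs_ballP[r /= r0 cC] ccx.
have dom x : ball x0 r x -> dominated (c x).
  by move=> /cC h; split => //; exists C.
apply: contrapT => /cvgrPdist_lt/existsNP[e] /not_implyP[e0] nnear.
have /choice[u uP] (k : nat) : exists x,
    [/\ ball x0 (Num.min r k.+1%:R^-1) x & e <= `|integ (c x0) - integ (c x)|].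
  apply: contrapT => /forallNP h; apply: nnear; apply/nbhs_ballP.
  exists (Num.min r k.+1%:R^-1) => /=; first by rewrite lt_min r0 invr_gt0 ltr0n.
  move=> x bx; have /not_andP[//|/negP] := h x.
  by rewrite -ltNge.
have ur k : ball x0 r (u k).
  by have [b _] := uP k; apply: le_ball b; rewrite ge_min lexx.
have ux0 : u k @[k --> \oo] --> x0.
  apply/cvg_ballP => d d0; near=> k.
  have [b _] := uP k; apply: le_ball b; rewrite ge_min; apply/orP; right.
  by apply: ltW; near: k; exact: (near_infty_natSinv_lt (PosNum d0)).
have ix0 := dom _ (ballxx x0 r0).
have : (\int[lam p]_t (c (u k) (rvec t))%:E)%E @[k --> \oo] -->
       (\int[lam p]_t (c x0 (rvec t))%:E)%E.
  apply: (@dominated_cvg _ _ _ (lam p) setT _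
     (fun k t => (c (u k) (rvec t))%:E) _ (fun t => (C / omega (rvec t))%:E)) => //.
  - by move=> k; have /integrableP[] := integrable_dominated (dom _ (ur k)).
  - move=> t _; apply: cvg_EFin; first exact: nearW.
    exact: (cvg_comp _ _ ux0 (ccx (rvec t))).
  - apply: (@integrable_dominated _ (fun w => C / omega w)); split.
      apply: cont_mul; first exact: cst_continuous.
      by apply: cont_inv; [exact: continuous_omega|
         move=> x; rewrite gt_eqF ?omega_gt0].
    exists `|C| => w; rewrite normrM normfV (ger0_norm (ltW (omega_gt0 w))).
    by [].
  - by move=> k t _; rewrite lee_fin; exact: cC (ur k) _.
rewrite -[X in _ --> X]fineK; last first.
  by apply: integrable_fin_num => //; exact: integrable_dominated.
move/fine_cvg => /cvgrPdist_lt/(_ _ e0)[N _ /(_ N (leqnn N))].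
by rewrite ltNge; have [_ ->] := uP N.
Unshelve. all: by end_near. Qed.

(** On the line through [x] in direction [v] this is differentiation under the integral in one real
    parameter; domination of [dc] is asked on the segment |h| < 1 only, while [C] may vary with the
    point. *)
Lemma is_derive_integ (V : normedModType R) p (c dc : V -> 'rV[R]_p -> R) x v C D :
  (forall y, continuous (c y)) -> (forall y w, `|c y w| <= C y / omega w) ->
  (forall y w, is_derive y v (fun z => c z w) (dc y w)) ->
  (forall w (h : R), `|h| < 1 -> `|dc (h *: v + x) w| <= D / omega w) ->
  is_derive x v (fun y => integ (c y)) (integ (dc x)).
Proof.
move=> cc cC dcE dcC.
pose f (h : R) (t : p.-tuple (measurableTypeR R)) := c (h *: v + x) (rvec t).
have fd h t : is_derive h (1 : R) (f ^~ t) (dc (h *: v + x) (rvec t)).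
  apply: (@is_derive_comp_affine _ _ (fun h : R => h *: v + x)
    (fun z => c z (rvec t)) h 1 v) => // k.
  by rewrite scalerDl addrA /= [k *: _]mulr1.
have d1 h t : partial1of2 f h t = dc (h *: v + x) (rvec t).
  by rewrite partial1of2E; have [_] := fd h t.
have dom y : dominated (c y) by split => //; exists (C y).
pose G (t : p.-tuple (measurableTypeR R)) := D / omega (rvec t).
have iG : (lam p).-integrable setT (EFin \o G).
  apply: (@integrable_dominated _ (fun w => D / omega w)); split.
    apply: cont_mul; first exact: cst_continuous.
    by apply: cont_inv; [exact: continuous_omega|
       move=> y; rewrite gt_eqF ?omega_gt0].
  exists `|D| => w.
  by rewrite normrM normfV (ger0_norm (ltW (omega_gt0 w))).
have G0 t : 0 <= G t.
  have := dcC (rvec t) 0; rewrite normr0 ltr01 => /(_ isT).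
  exact: le_trans (normr_ge0 _).
have I0 : `]-1, 1[%classic (0 : R) by rewrite /= in_itv/= ltr01 ltrN10.
have H := @cvg_differentiation_under_integral R _ _ (lam p) f setT measurableT
  0 (-1) 1 I0 (fun h _ => integrable_dominated (dom _))
  (fun h t _ _ => @ex_derive _ _ _ _ _ _ _ (fd h t)) G G0 iG.
have : (forall x0 (y : p.-tuple (measurableTypeR R)), `]-1, 1[%classic x0 -> setT y ->
    `|partial1of2 f x0 y| <= G y).
  move=> h0 t; rewrite /= in_itv/= -ltr_norml => h1 _; rewrite d1; exact: dcC.
move/H => {}H.
have E : (fun h : R => h^-1 *: (((fun y => integ (c y)) \o shift x) (h *: v) -
   integ (c x))) = (fun k : R => k^-1 *: (\int[lam p]_t (f (k + 0) t) - \int[lam p]_t (f 0 t))).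
  by apply/funext => k; rewrite addr0 /f scale0r add0r.
have E' : \int[lam p]_t (partial1of2 f 0 t) = integ (dc x).
  by apply: eq_Rintegral => t _; rewrite d1 scale0r add0r.
apply: DeriveDef.
  by rewrite /derivable E; apply/cvg_ex; eexists; exact: H.
by rewrite /derive E -E'; exact/cvg_lim/H.
Qed.
(** Balls of the max norm are products of intervals. Their positive measure is what turns essential
    bounds of continuous functions into pointwise ones. *)
Lemma lebesgue_tuple_ball_gt0 p (x : 'rV[R]_p) (e : R) : 0 < e ->
  (0 < lam p (@rvec R p @^-1` ball x e))%E.
Proof.
move=> e0; elim: p x => [|p ih] x.
  by rewrite [lam 0]/= /dirac indicE mem_set ?lte01//=; split => // i [] m m0; exfalso; move: m0;
    rewrite ltn0.
pose y : 'rV[R]_p := \row_i x 0 (lift ord0 i).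
have E : @tcons R p @^-1` (@rvec R p.+1 @^-1` ball x e) =
   (ball (x 0 ord0) e : set R) `*` (@rvec R p @^-1` ball y e).
  apply/seteqP; split => -[a t] /=; rewrite rvec_tcons.
    move=> [_ b]; split => /=; last first.
      split => // i j; rewrite (ord1 i) mxE.
      by have := b 0 (lift ord0 j); rewrite [vcons _ _ _ _]mxE liftK.
    by have := b 0 ord0; rewrite [vcons _ _ _ _]mxE unlift_none.
  move=> [/= ba [_ bt]]; split => // i j; rewrite (ord1 i).
  case: (unliftP ord0 j) => [k ->|->]; rewrite [vcons _ _ _ _]mxE.
    by rewrite liftK /=; have := bt 0 k; rewrite mxE.
  by rewrite unlift_none.
rewrite [X in (_ < X)%E](_ : _ = (mu \x lam p)%E
   ((ball (x 0 ord0) e : set R) `*` (@rvec R p @^-1` ball y e))); last first.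
  by rewrite -E.
rewrite product_measure1E; last 2 first.
- exact: measurable_ball.
- by apply: measurable_rvec_open; exact: ball_open.
apply: mule_gt0; last exact: ih.
rewrite [X in (_ < X)%E](lebesgue_measure_ball (x 0 ord0) (ltW e0)) lte_fin.
by rewrite mulrn_wgt0.
Qed.

Lemma Linfty_ub p (f : 'rV[R]_p -> R[i]) (C : R) : 0 <= C ->
  (forall x, normc (f x) <= C) -> (Linfty f <= C%:E)%E.
Proof.
move=> C0 fC; rewrite /Linfty unlock; case: ifP => _; last by rewrite lee_fin.
apply/ess_supP; apply: nearW => t /=.
by rewrite lee_fin ger0_norm ?fC// normc_ge0.
Qed.

(** If the value at [x] exceeded the essential supremum, continuity would spread the excess to a
    ball, which is not a null set. *)
Lemma le_Linfty p (f : 'rV[R]_p -> R[i]) x :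
  continuous (fun x => normc (f x)) -> ((normc (f x))%:E <= Linfty f)%E.
Proof.
move=> cf; have lamT : (0 < lam p setT)%E.
  apply: lt_le_trans (lebesgue_tuple_ball_gt0 0 ltr01) _.
  by apply: le_measure; rewrite ?inE//; by apply: measurable_rvec_open; exact: ball_open.
rewrite /Linfty unlock lamT leNgt; apply/negP => lt.
set N := (X in (X < _)%E) in lt.
have [r Nr] : exists r, N = r%:E \/ N = -oo%E.
  by move: lt; case: N => [r _|//|_]; [exists r; left|exists 0; right].
have oU : open [set y : 'rV[R]_p | (N < (normc (f y))%:E)%E].
  case: Nr => ->; last first.
    by rewrite (_ : [set y | _] = setT); [exact: openT|apply/seteqP; split => y //= _;
      rewrite ltNyr].
  rewrite (_ : [set y | _] = (fun x => normc (f x)) @^-1` `]r, +oo[%classic).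
    by apply: open_comp => [y _|]; [exact: cf|exact: interval_open].
  by apply/seteqP; split => y /=; rewrite in_itv/= andbT lte_fin.
have /nbhs_ballP[e /= e0 eU] : nbhs x [set y : 'rV[R]_p | (N < (normc (f y))%:E)%E].
  exact: open_nbhs_nbhs.
have := ess_sup_ge (lam p) (fun t => `|(normc (f (rvec t)))%:E|%E).
move=> [Z [mZ Z0 sub]].
have : (lam p (@rvec R p @^-1` ball x e) <= lam p Z)%E.
  apply: le_measure; rewrite ?inE//; first by apply: measurable_rvec_open; exact: ball_open.
  move=> t /eU /= lt1; apply: sub => /=; apply/negP; rewrite -ltNge.
  apply: lt_le_trans lt1 _; rewrite lee_fin; exact: ler_norm.
by rewrite Z0 leNgt lebesgue_tuple_ball_gt0.
Qed.

End lebesgue_tuple_theory.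

(** * Symmetry of mixed partial derivatives and multi-indices *)

Section real_partials.
Variable R : realType.

Lemma MVT_line (V : normedModType R) (f : V -> R) x v (h : R) : 0 < h ->
  (forall y, derivable f y v) ->
  exists2 c, 0 < c < h & f (h *: v + x) - f x = h * 'D_v f (c *: v + x).
Proof.
move=> h0 fd.
pose g (t : R) := f (t *: v + x).
have gd t : is_derive t (1 : R) g ('D_v f (t *: v + x)).
  apply: (@is_derive_comp_affine R _ _ (fun t : R => t *: v + x) f t 1 v) => [k|].
    by rewrite scalerDl addrA /= [k *: _]mulr1.
  exact: derivableP.
have cg : {within `[0, h], continuous g}.
  apply: continuous_subspaceT => t; apply: differentiable_continuous.
  by apply/derivable1_diffP; have [] := gd t.
have [c] := MVT h0 (fun t _ => gd t) cg.
rewrite in_itv/= => ch; rewrite /g scale0r add0r subr0 mulrC => E.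
by exists c.
Qed.

Variable p : nat.
Implicit Types (g : 'rV[R]_p -> R) (i j : 'I_p) (s : seq 'I_p).

Lemma smoothR_partial g i : smoothR g -> smoothR (partial i g).
Proof.
move=> sg s; have := sg (rcons s i); by rewrite foldr_rcons.
Qed.

Lemma smoothR_cont g : smoothR g -> continuous g.
Proof. by move=> /(_ [::])[]. Qed.

Lemma smoothR_derivable g i x : smoothR g -> derivable g x (delta_mx 0 i).
Proof. by move=> /(_ [::])[]. Qed.

Let corner g x i j (h : R) :=
  g (h *: delta_mx 0 i + (h *: delta_mx 0 j + x)) - g (h *: delta_mx 0 i + x)
  - (g (h *: delta_mx 0 j + x) - g x).

(** The mean value theorem in direction [i], applied to the increment of [g] in direction [j], and
    then in direction [j], applied to [partial i g]. The bound 2h places the intermediate point near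
    [x]. *)
Let corner_mvt g x i j (h : R) : smoothR g -> 0 < h -> exists y,
  `|y - x| <= 2 * h /\ corner g x i j h = h * (h * partial j (partial i g) y).
Proof.
move=> sg h0.
pose u y := g (h *: delta_mx 0 j + y) - g y.
have ud y : is_derive y (delta_mx 0 i : 'rV[R]_p) u
    (partial i g (h *: delta_mx 0 j + y) - partial i g y).
  apply: is_deriveB; last first.
    by apply: derivableP; exact: smoothR_derivable.
  apply: (@is_derive_comp_affine R _ _ (fun y => h *: delta_mx 0 j + y) g y
    (delta_mx 0 i) (delta_mx 0 i)) => [k|]; first by rewrite addrCA.
  by apply: derivableP; exact: smoothR_derivable.
have [c /andP[c0 ch] E] := @MVT_line _ u x (delta_mx 0 i) h h0 (fun y => @ex_derive _ _ _ _ _ _ _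
  (ud y)).
have [d /andP[d0 dh] E'] := @MVT_line _ (partial i g) (c *: delta_mx 0 i + x)
  (delta_mx 0 j) h h0 (fun y => @smoothR_derivable _ j y (smoothR_partial i sg)).
exists (d *: delta_mx 0 j + (c *: delta_mx 0 i + x)); split.
  rewrite addrA addrK (le_trans (ler_normD _ _))// !normrZ.
  have n1 k : `|delta_mx 0 k : 'rV[R]_p| <= 1.
    rewrite [leLHS]mx_normrE; apply/bigmax_leP; split => // -[a b] _ /=.
    by rewrite mxE; case: (_ && _); rewrite ?normr1 ?normr0.
  rewrite mulr2n mulrDl mul1r; apply: lerD.
    by rewrite -[leRHS]mulr1 ler_pM// ger0_norm ltW.
  by rewrite -[leRHS]mulr1 ler_pM// ger0_norm ltW.
have [_ Du] := ud (c *: delta_mx 0 i + x).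
rewrite -E' -Du -E /corner /u.
by rewrite [h *: delta_mx 0 i + (h *: _ + x)]addrCA.
Qed.

(* Both mixed derivatives are limits of the same second difference. *)
Lemma partialC g i j : smoothR g -> partial i (partial j g) = partial j (partial i g).
Proof.
move=> sg; apply/funext => x; apply/eqP; rewrite -subr_eq0; apply/negPn/negP => ne.
pose e := `|partial i (partial j g) x - partial j (partial i g) x| / 2.
have e0 : 0 < e by rewrite divr_gt0// normr_gt0.
have c1 := smoothR_cont (smoothR_partial i (smoothR_partial j sg)).
have c2 := smoothR_cont (smoothR_partial j (smoothR_partial i sg)).
have /cvgrPdist_lt/(_ _ e0)/nbhs_normP[r1 /= r10 h1] := c1 x.
have /cvgrPdist_lt/(_ _ e0)/nbhs_normP[r2 /= r20 h2] := c2 x.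
have [h [h0 hr1 hr2]] : exists h : R, [/\ 0 < h, 2 * h < r1 & 2 * h < r2].
  have m0 : 0 < Num.min r1 r2 by rewrite lt_min r10.
  have hm : 2 * (Num.min r1 r2 / 3) < Num.min r1 r2.
    by rewrite mulrA ltr_pdivrMr// mulrC ltr_pM2l ?ltr_nat.
  exists (Num.min r1 r2 / 3); split; first by rewrite divr_gt0.
    by apply: lt_le_trans hm _; rewrite ge_min lexx.
  by apply: lt_le_trans hm _; rewrite ge_min lexx orbT.
have [y [yx Ey]] := corner_mvt x i j sg h0.
have [z [zx Ez]] := corner_mvt x j i sg h0.
have : corner g x i j h = corner g x j i h.
  by rewrite /corner [h *: delta_mx 0 i + (h *: _ + x)]addrCA; ring.
rewrite Ey Ez => /(mulfI (lt0r_neq0 h0))/(mulfI (lt0r_neq0 h0)) yz.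
have H1 : `|partial i (partial j g) x - partial i (partial j g) z| < e.
  by apply: h1 => /=; rewrite distrC; exact: le_lt_trans zx hr1.
have H2 : `|partial i (partial j g) z - partial j (partial i g) x| < e.
  by rewrite -yz distrC; apply: h2 => /=; rewrite distrC; exact: le_lt_trans yx hr2.
have := ler_distD (partial i (partial j g) z) (partial i (partial j g) x)
  (partial j (partial i g) x).
rewrite leNgt => /negP; apply.
apply: lt_le_trans (ltrD H1 H2) _.
by rewrite -mulr2n -[_ *+ 2]mulr_natr divfK.
Qed.

Lemma smoothR_foldr g s : smoothR g -> smoothR (foldr (@partial R p) g s).
Proof. by move=> sg; elim: s => [|i s ih]; [exact: sg|exact: smoothR_partial]. Qed.

Lemma partial_foldr g s i : smoothR g ->
  foldr (@partial R p) (partial i g) s = partial i (foldr (@partial R p) g s).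
Proof.
move=> sg; elim: s => //= j s ->; apply: partialC; exact: smoothR_foldr.
Qed.

Lemma perm_foldr_partial g s s' : smoothR g -> perm_eq s s' ->
  foldr (@partial R p) g s = foldr (@partial R p) g s'.
Proof.
move=> sg; elim: s s' => [|i s ih] s'.
  by move=> /perm_size /esym /size0nil ->.
move=> pe; have is' : i \in s' by rewrite -(perm_mem pe) mem_head.
have [s1 [s2 E]] : exists s1 s2, s' = s1 ++ i :: s2.
  by case/splitPr: is' => s1 s2; exists s1, s2.
move: pe; rewrite E perm_sym perm_catC cat_cons perm_cons perm_catC perm_sym => /ih /= ->.
rewrite !foldr_cat /= partial_foldr; [reflexivity|exact: smoothR_foldr].
Qed.

(** Passage from derivatives along a list of directions, suited to induction, to the multi-indices
    of the definitions: by symmetry only the multiplicity of each direction counts. *)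
Lemma foldr_partialE g s : smoothR g ->
  foldr (@partial R p) g s = mpartialR (\row_i count_mem i s) g.
Proof.
move=> sg; rewrite /mpartialR.
have E r : foldr (fun i => iter ((\row_i count_mem i s) 0 i) (partial i)) g r =
    foldr (@partial R p) g (flatten [seq nseq (count_mem i s) i | i <- r]).
  elim: r => //= i r ->; rewrite foldr_cat mxE.
  by elim: (count_mem i s) => //= k ->.
rewrite E; apply: perm_foldr_partial => //; apply/allP => i _ /=.
rewrite count_flatten -map_comp; apply/eqP.
have -> : [seq (count_mem i \o (fun j => nseq (count_mem j s) j)) j | j <- enum 'I_p] =
  [seq (count_mem i s * (j == i))%N | j <- enum 'I_p].
  apply: eq_map => j /=; rewrite count_nseq /= eq_sym.
  by case: eqP => [->|_]; rewrite ?mul1n ?muln1// mul0n muln0.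
rewrite sumnE big_map big_enum /= (bigD1 i)//= eqxx muln1 big1 ?addn0// => j ji.
by rewrite (negbTE ji) muln0.
Qed.

Lemma mpartialRE alpha : exists s, forall g, mpartialR alpha g = foldr (@partial R p) g s.
Proof.
exists (flatten [seq nseq (alpha 0 i) i | i <- enum 'I_p]) => g; rewrite /mpartialR.
elim: (enum 'I_p) => //= i r ->; rewrite foldr_cat.
by elim: (alpha 0 i) => //= k ->.
Qed.

End real_partials.

(** * Continuity, differentiation and smoothness of complex-valued functions *)

Section complex_functions.
Variables (R : realType) (p : nat).
Implicit Types (f g df dg : 'rV[R]_p -> R[i]) (i j : 'I_p) (s : seq 'I_p).
Local Notation Re := complex.Re.
Local Notation Im := complex.Im.

Definition ccontinuous (T : topologicalType) (f : T -> R[i]) :=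
  continuous (fun x => Re (f x)) /\ continuous (fun x => Im (f x)).

Lemma ccontinuous_cst (T : topologicalType) c : ccontinuous (fun _ : T => c).
Proof. by split; exact: cst_continuous. Qed.

Lemma ccontinuousD (T : topologicalType) (f g : T -> R[i]) :
  ccontinuous f -> ccontinuous g -> ccontinuous (fun x => f x + g x).
Proof.
move=> [f1 f2] [g1 g2]; split; under eq_fun do rewrite raddfD /=; exact: cont_add.
Qed.

Lemma ccontinuousM (T : topologicalType) (f g : T -> R[i]) :
  ccontinuous f -> ccontinuous g -> ccontinuous (fun x => f x * g x).
Proof.
have ReM (a b : R[i]) : Re (a * b) = Re a * Re b + - (Im a * Im b).
  by case: a b => [a1 a2] [b1 b2].
have ImM (a b : R[i]) : Im (a * b) = Re a * Im b + Im a * Re b.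
  by case: a b => [a1 a2] [b1 b2].
move=> [f1 f2] [g1 g2]; split.
  under eq_fun do rewrite ReM; apply: cont_add; first exact: cont_mul.
  by apply: cont_opp; exact: cont_mul.
by under eq_fun do rewrite ImM; apply: cont_add; exact: cont_mul.
Qed.

Lemma ccontinuous_comp (T U : topologicalType) (h : T -> U) (f : U -> R[i]) :
  continuous h -> ccontinuous f -> ccontinuous (fun x => f (h x)).
Proof. by move=> ch [f1 f2]; split; [exact: (cont_comp ch f1)|exact: (cont_comp ch f2)]. Qed.

Lemma ccontinuous_normc (T : topologicalType) (f : T -> R[i]) :
  ccontinuous f -> continuous (fun x => normc (f x)).
Proof.
move=> [f1 f2].
have -> : (fun x => normc (f x)) =
    (fun x => Num.sqrt (Re (f x) ^+ 2 + Im (f x) ^+ 2)).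
  by apply/funext => x; case: (f x).
apply: (@cont_comp T R R _ (fun z : R => Num.sqrt z)); last exact: sqrt_continuous.
by apply: cont_add; exact: cont_exp.
Qed.

Definition is_cderive i f df := forall x,
  is_derive x (delta_mx 0 i : 'rV[R]_p) (fun y => Re (f y)) (Re (df x)) /\
  is_derive x (delta_mx 0 i : 'rV[R]_p) (fun y => Im (f y)) (Im (df x)).

Definition cpartial i f : 'rV[R]_p -> R[i] := fun x =>
  partial i (fun y => Re (f y)) x +i* partial i (fun y => Im (f y)) x.

Lemma is_cderive_partial i f df : is_cderive i f df -> cpartial i f = df.
Proof.
move=> h; apply/funext => x; have [[_ h1] [_ h2]] := h x.
by rewrite /cpartial /partial h1 h2; case: (df x).
Qed.

Lemma is_cderive_ext i f g df dg : f =1 g -> df =1 dg ->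
  is_cderive i f df -> is_cderive i g dg.
Proof. by move=> /funext -> /funext ->. Qed.

Lemma is_cderive_cst i (c : R[i]) : is_cderive i (fun=> c) (fun=> 0).
Proof. by move=> x; split; exact: is_derive_cst. Qed.

Lemma is_cderiveD i f g df dg : is_cderive i f df -> is_cderive i g dg ->
  is_cderive i (fun x => f x + g x) (fun x => df x + dg x).
Proof.
move=> hf hg x; have [f1 f2] := hf x; have [g1 g2] := hg x.
split; rewrite raddfD /=; under eq_fun do rewrite raddfD /=; exact: is_deriveD.
Qed.

Lemma is_cderiveM i f g df dg : is_cderive i f df -> is_cderive i g dg ->
  is_cderive i (fun x => f x * g x) (fun x => df x * g x + f x * dg x).
Proof.
move=> hf hg x; have [f1 f2] := hf x; have [g1 g2] := hg x; split.
  rewrite (_ : (fun y => _) = (fun y => Re (f y)) * (fun y => Re (g y)) -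
     (fun y => Im (f y)) * (fun y => Im (g y))); last first.
    by apply/funext => y; rewrite !fctE; case: (f y) => ? ?; case: (g y).
  apply: is_derive_eq.
  case: (f x) => ? ?; case: (g x) => ? ?; case: (df x) => ? ?; case: (dg x) => ? ? /=.
  by rewrite /GRing.scale /=; ring.
rewrite (_ : (fun y => _) = (fun y => Re (f y)) * (fun y => Im (g y)) +
   (fun y => Im (f y)) * (fun y => Re (g y))); last first.
  by apply/funext => y; rewrite !fctE; case: (f y) => ? ?; case: (g y).
apply: is_derive_eq.
case: (f x) => ? ?; case: (g x) => ? ?; case: (df x) => ? ?; case: (dg x) => ? ? /=.
by rewrite /GRing.scale /=; ring.
Qed.

Definition coordc i : 'rV[R]_p -> R[i] := fun x => (x 0 i)%:C.

Lemma is_derive_coord i j (x : 'rV[R]_p) :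
  is_derive x (delta_mx 0 i : 'rV[R]_p) (fun y : 'rV[R]_p => y 0 j) (i == j)%:R.
Proof.
have E : (fun h : R => h^-1 *: (((fun y : 'rV[R]_p => y 0 j) \o shift x)
    (h *: delta_mx 0 i) - x 0 j)) = (fun h => h^-1 * (h * (i == j)%:R)).
  by apply/funext => h /=; rewrite !mxE addrK eqxx /= eq_sym.
have lim : (fun h : R => h^-1 * (h * (i == j)%:R)) @ 0^' --> ((i == j)%:R : R).
  apply: cvg_near_cst; near=> h; rewrite mulrA mulVf ?mul1r//.
  by near: h; exact: nbhs_dnbhs_neq.
apply: DeriveDef.
  by rewrite /derivable E; apply/cvg_ex; eexists; exact: lim.
by rewrite /derive E; exact/cvg_lim.
Unshelve. all: by end_near. Qed.

Lemma is_cderive_coordc i j : is_cderive i (coordc j) (cst (i == j)%:R).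
Proof.
move=> x; split => /=.
  by rewrite (_ : Re _ = (i == j)%:R); [exact: is_derive_coord|case: (i == j)].
by rewrite (_ : Im _ = 0); [exact: is_derive_cst|case: (i == j)].
Qed.

Lemma ccontinuous_coordc i : ccontinuous (coordc i).
Proof. by split; [exact: coord_continuous|exact: cst_continuous]. Qed.

Lemma smooth_ccontinuous f : smooth f -> ccontinuous f.
Proof. by move=> [h1 h2]; split; exact: smoothR_cont. Qed.

Lemma smooth_is_cderive f i : smooth f -> is_cderive i f (cpartial i f).
Proof.
by move=> [h1 h2] x; split; apply: derivableP; exact: smoothR_derivable.
Qed.

Lemma smooth_cpartial f i : smooth f -> smooth (cpartial i f).
Proof. by move=> [h1 h2]; split; exact: smoothR_partial. Qed.

Lemma foldr_cpartialE f s : foldr cpartial f s = fun x =>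
  foldr (@partial R p) (fun y => Re (f y)) s x +i*
  foldr (@partial R p) (fun y => Im (f y)) s x.
Proof.
elim: s => [|i s /= ->]; last reflexivity.
by apply/funext => x /=; case: (f x).
Qed.

Lemma smooth_foldr f s : smooth f -> smooth (foldr cpartial f s).
Proof. by move=> sf; elim: s => [|i s ih]; [exact: sf|exact: smooth_cpartial]. Qed.

(** Coinduction: a class of continuous functions stable under every partial derivative consists of
    smooth functions. It dispenses with formulas for iterated derivatives. *)
Lemma smooth_coind (Q : ('rV[R]_p -> R[i]) -> Prop) :
  (forall f, Q f -> ccontinuous f /\ forall i, exists2 df, is_cderive i f df & Q df) ->
  forall f, Q f -> smooth f.
Proof.
move=> QP f Qf.
have QF s : Q (foldr cpartial f s).
  elim: s => [//|i s ih] /=; have [_ /(_ i)[df d]] := QP _ ih.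
  by rewrite (is_cderive_partial d).
split => s; have [[c1 c2] d] := QP _ (QF s);
  rewrite foldr_cpartialE /= in c1 c2 d; split => //= i x.
  by have [df /(_ x)[[h _] _] _] := d i.
by have [df /(_ x)[_ [h _]] _] := d i.
Qed.

Lemma smooth_cst (c : R[i]) : smooth (fun _ : 'rV[R]_p => c).
Proof.
apply: (@smooth_coind (fun f => exists c, f = fun=> c)); last by exists c.
move=> _ [{}c ->]; split; first exact: ccontinuous_cst.
by move=> i; exists (cst 0); [exact: is_cderive_cst|exists 0].
Qed.

Lemma smooth_intro f : ccontinuous f ->
  (forall i, exists2 df, is_cderive i f df & smooth df) -> smooth f.
Proof.
move=> cf df; apply: (@smooth_coind (fun g => g = f \/ smooth g)); last by left.
move=> g [->|sg]; split => //.
- by move=> i; have [h h1 h2] := df i; exists h => //; right.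
- exact: smooth_ccontinuous.
- by move=> i; exists (cpartial i g);
   [exact: smooth_is_cderive|right; exact: smooth_cpartial].
Qed.

Lemma smooth_coordc i : smooth (coordc i).
Proof.
apply: smooth_intro; first exact: ccontinuous_coordc.
by move=> j; exists (cst (j == i)%:R); [exact: is_cderive_coordc|exact: smooth_cst].
Qed.

End complex_functions.

(** * Chain rule for affine substitutions and coordinate projections *)

Section affine_substitution.
Variable R : realType.

(** Only a derivative along [v] is available, so the claim is reduced to the chain rule for t |-> a
    t on the line through [x]; this includes a = 0. *)
Lemma is_derive_scale_dir (V : normedModType R) (f : V -> R) x v d (a : R) :
  is_derive x v f d -> is_derive x (a *: v) f (a * d).
Proof.
move=> fd; pose l (t : R) := f (t *: v + x).
have ld : is_derive (a * 0) (1 : R) l d.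
  apply: (@is_derive_comp_affine R _ _ (fun t : R => t *: v + x) f (a * 0) 1 v) => [k|].
    by rewrite scalerDl addrA /= [k *: _]mulr1.
  by rewrite mulr0 scale0r add0r.
have lad : is_derive (0 : R) (1 : R) (fun t : R => l (a * t)) (d * a).
  have aid : is_derive (0 : R) (1 : R) ( *%R a) a.
    have := @is_deriveZ _ _ _ id a (0 : R) 1 1 _.
    by rewrite /GRing.scale /= mulr1; apply.
  exact: is_derive1_comp.
have E : (fun h : R => h^-1 *: ((f \o shift x) (h *: (a *: v)) - f x)) =
  (fun h : R => h^-1 *: (((fun t : R => l (a * t)) \o shift 0) (h *: (1 : R)) - l (a * 0))).
  apply/funext => h; rewrite /l /= addr0 mulr0 scale0r add0r scalerA.
  by rewrite /GRing.scale /= mulr1 [a * h]mulrC.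
have [h1 h2] := lad; apply: DeriveDef; first by rewrite /derivable E.
by rewrite [a * d]mulrC -h2 /derive E.
Qed.

Variables (p q : nat) (phi : 'rV[R]_p -> 'rV[R]_q).

Lemma is_cderive_affine i k (a : R) (f df : 'rV[R]_q -> R[i]) :
  (forall (h : R) z, phi (h *: delta_mx 0 i + z) = h *: (a *: delta_mx 0 k) + phi z) ->
  is_cderive k f df -> is_cderive i (fun z => f (phi z)) (fun z => a%:C * df (phi z)).
Proof.
move=> phiE fd z; have [h1 h2] := fd (phi z).
have E (c : R[i]) : (a%:C * c) = (a * complex.Re c) +i* (a * complex.Im c).
  by case: c => c d; rewrite /= {1}/GRing.mul /= !mul0r addr0 subr0.
rewrite E; split.
  apply: (@is_derive_comp_affine R _ _ phi (fun y => complex.Re (f y)) z _ (a *: delta_mx 0 k))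
    => //.
  exact: is_derive_scale_dir.
apply: (@is_derive_comp_affine R _ _ phi (fun y => complex.Im (f y)) z _ (a *: delta_mx 0 k)) => //.
exact: is_derive_scale_dir.
Qed.

Lemma is_cderive_affine0 i (f : 'rV[R]_q -> R[i]) :
  (forall (h : R) z, phi (h *: delta_mx 0 i + z) = phi z) ->
  is_cderive i (fun z => f (phi z)) (fun=> 0).
Proof.
move=> phiE z; split.
  apply: (@is_derive_comp_affine R _ _ phi (fun y => complex.Re (f y)) z _ 0) => [h|].
    by rewrite scaler0 add0r phiE.
  exact: is_derive0.
apply: (@is_derive_comp_affine R _ _ phi (fun y => complex.Im (f y)) z _ 0) => [h|].
  by rewrite scaler0 add0r phiE.
exact: is_derive0.
Qed.

End affine_substitution.

Section coordinate_substitution.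
Variables (R : realType) (p q : nat).

Definition rowsel (s : 'I_q -> 'I_p) (z : 'rV[R]_p) : 'rV[R]_q := \row_k z 0 (s k).

Lemma continuous_rowsel s : continuous (rowsel s).
Proof.
by apply: continuous_rV => i; under eq_fun do rewrite mxE; exact: coord_continuous.
Qed.

Lemma rowselE (s : 'I_q -> 'I_p) k (h : R) z : injective s ->
  rowsel s (h *: delta_mx 0 (s k) + z) = h *: delta_mx 0 k + rowsel s z.
Proof. by move=> si; apply/rowP => l; rewrite !mxE (inj_eq si). Qed.

Lemma rowsel0E (s : 'I_q -> 'I_p) i (h : R) z : (forall k, s k != i) ->
  rowsel s (h *: delta_mx 0 i + z) = rowsel s z.
Proof.
by move=> si; apply/rowP => l; rewrite !mxE (negbTE (si l)) andbF mulr0 add0r.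
Qed.

End coordinate_substitution.

(** * Families of functions with moderate or negligible estimates *)

Section families.
Variables (R : realType) (T : Type) (gauge : T -> R).
Hypothesis gauge01 : forall t, 0 < gauge t <= 1.
Local Notation fam p := (T -> 'rV[R]_p -> R[i]).

Let g0 t : 0 < gauge t. Proof. by case/andP: (gauge01 t). Qed.
Let gX0 t q : 0 <= gauge t ^+ q. Proof. by rewrite exprn_ge0// ltW. Qed.

(* [neg] selects between negligible and moderate families. *)
Definition est p (neg : bool) (F : fam p) (w : 'rV[R]_p -> R) : Prop :=
  if neg then forall q : nat, exists2 C, 0 <= C &
    forall t x, normc (F t x) <= C * gauge t ^+ q * w x
  else exists q : nat, exists2 C, 0 <= C &
    forall t x, normc (F t x) <= C * gauge t ^- q * w x.

Lemma est_le p neg (F : fam p) (w w' : 'rV[R]_p -> R) (c : R) : 0 <= c ->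
  (forall x, w x <= c * w' x) -> est neg F w -> est neg F w'.
Proof.
move=> c0 ww'.
have aux C (a : R) x : 0 <= C -> 0 <= a -> C * a * w x <= C * c * a * w' x.
  move=> C0 a0; rewrite -[C * c * a]mulrA [c * a]mulrC mulrA -[leRHS]mulrA.
  by apply: ler_wpM2l; [exact: mulr_ge0|exact: ww'].
case: neg => /= [h q|[q [C C0 h]]].
  have [C C0 {}h] := h q; exists (C * c); first exact: mulr_ge0.
  by move=> t x; apply: le_trans (h t x) (aux _ _ _ C0 _).
exists q, (C * c); first exact: mulr_ge0.
by move=> t x; apply: le_trans (h t x) (aux _ _ _ C0 _); rewrite invr_ge0.
Qed.

Lemma est_bound p neg (F G : fam p) w :
  (forall t x, normc (F t x) <= normc (G t x)) -> est neg G w -> est neg F w.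
Proof.
move=> FG; case: neg => /= [h q|[q [C C0 h]]].
  by have [C C0 {}h] := h q; exists C => // t x; exact: le_trans (FG _ _) (h _ _).
by exists q, C => // t x; exact: le_trans (FG _ _) (h _ _).
Qed.

Lemma estD p neg (F G : fam p) w : (forall x, 0 <= w x) ->
  est neg F w -> est neg G w -> est neg (fun t x => F t x + G t x) w.
Proof.
move=> w0; have tri (a b : R[i]) (c d : R) : normc a <= c -> normc b <= d ->
    normc (a + b) <= c + d.
  by move=> ac bd; apply: le_trans (le_normcD _ _) (lerD ac bd).
case: neg => /= [hF hG q|[q [C C0 hF]] [q' [C' C0' hG]]].
  have [C C0 {}hF] := hF q; have [C' C0' {}hG] := hG q.
  exists (C + C'); first exact: addr_ge0.
  by move=> t x; rewrite 2!mulrDl; exact: tri.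
exists (q + q')%N, (C + C'); first exact: addr_ge0.
have le1 t k : gauge t ^+ k <= 1.
  by case/andP: (gauge01 t) => h1 h2; apply: exprn_ile1 => //; exact: ltW.
move=> t x; rewrite 2!mulrDl; apply: tri.
  apply: le_trans (hF t x) _; apply: ler_wpM2r => //; apply: ler_wpM2l => //.
  rewrite lef_pV2 ?posrE ?exprn_gt0// exprD.
  by rewrite ler_piMr.
apply: le_trans (hG t x) _; apply: ler_wpM2r => //; apply: ler_wpM2l => //.
rewrite lef_pV2 ?posrE ?exprn_gt0// exprD.
by rewrite ler_piMl.
Qed.

(** A negligible factor can be taken at an order raised by the loss [q'] of a moderate one, hence
    the disjunction of the flags. *)
Lemma estM p neg neg' (F G : fam p) w w' :
  est neg F w -> est neg' G w' ->
  est (neg || neg') (fun t x => F t x * G t x) (fun x => w x * w' x).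
Proof.
have aux (a b : R[i]) (C C' s s' v v' : R) : normc a <= C * s * v ->
    normc b <= C' * s' * v' -> normc (a * b) <= C * C' * (s * s') * (v * v').
  move=> h h'; rewrite normcM.
  rewrite (_ : C * C' * _ * _ = (C * s * v) * (C' * s' * v')); last by ring.
  by apply: ler_pM => //; exact: normc_ge0.
case: neg; case: neg' => /=.
- move=> hF hG q; have [C C0 {}hF] := hF q; have [C' C0' {}hG] := hG 0%N.
  exists (C * C'); first exact: mulr_ge0.
  move=> t x; rewrite -[gauge t ^+ q]mulr1; apply: aux; first exact: hF.
  by have := hG t x; rewrite expr0.
- move=> hF [q' [C' C0' hG]] q; have [C C0 {}hF] := hF (q + q')%N.
  exists (C * C'); first exact: mulr_ge0.
  move=> t x; rewrite (_ : gauge t ^+ q = gauge t ^+ (q + q') * gauge t ^- q').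
    exact: aux.
  by rewrite exprD mulfK// expf_neq0// gt_eqF.
- move=> [q' [C C0 hF]] hG q; have [C' C0' {}hG] := hG (q' + q)%N.
  exists (C * C'); first exact: mulr_ge0.
  move=> t x; rewrite (_ : gauge t ^+ q = gauge t ^- q' * gauge t ^+ (q' + q)).
    exact: aux.
  by rewrite exprD mulrA mulVf ?mul1r// expf_neq0// gt_eqF.
move=> [q [C C0 hF]] [q' [C' C0' hG]].
exists (q + q')%N, (C * C'); first exact: mulr_ge0.
by move=> t x; rewrite exprD invfM; exact: aux.
Qed.

Lemma est0 p neg (w : 'rV[R]_p -> R) : est neg (fun _ _ => 0) w.
Proof.
have n0 : normc (0 : R[i]) = 0 by exact: normc0.
rewrite /est; case: neg => [q|]; last exists 0%N.
  by exists 0 => // t x; rewrite n0 !mul0r.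
by exists 0 => // t x; rewrite n0 !mul0r.
Qed.

Lemma est_const p (f : 'rV[R]_p -> R[i]) w C : 0 <= C ->
  (forall x, normc (f x) <= C * w x) -> est false (fun=> f) w.
Proof. by move=> C0 h; exists 0%N, C => // t x; rewrite expr0 invr1 mulr1. Qed.

Lemma est_at p neg (F : fam p) w : est neg F w -> forall t, exists2 C, 0 <= C &
  forall x, normc (F t x) <= C * w x.
Proof.
case: neg => /= [/(_ 0%N)[C C0 h] t|[q [C C0 h]] t].
  by exists C => // x; have := h t x; rewrite expr0 mulr1.
by exists (C * gauge t ^- q) => //; rewrite mulr_ge0 ?invr_ge0.
Qed.

(** Derivatives are indexed by lists of directions, so that passing to a partial derivative is just
    appending to the list. [P] may hide constants and exponents that depend on the derivative. *)
Definition hered p (P : fam p -> Prop) (F : fam p) :=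
  (forall t, smooth (F t)) /\
  forall s, P (fun t => foldr (@cpartial R p) (F t) s).

Lemma hered_self p P (F : fam p) : hered P F -> P F.
Proof. by move=> [_ /(_ [::])]. Qed.

Lemma hered_smooth p P (F : fam p) t : hered P F -> smooth (F t).
Proof. by move=> []. Qed.

Lemma hered_partial p P (F : fam p) i : hered P F ->
  hered P (fun t => cpartial i (F t)).
Proof.
move=> [sF hF]; split => [t|s]; first exact: smooth_cpartial.
have := hF (rcons s i).
by under eq_fun do rewrite foldr_rcons.
Qed.

Lemma hered_sub p (P Q : fam p -> Prop) (F : fam p) : (forall F, P F -> Q F) ->
  hered P F -> hered Q F.
Proof. by move=> PQ [sF hF]; split => // s; exact: PQ. Qed.

(** The analogue of [smooth_coind] for families: to estimate all derivatives, exhibit a class stable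
    under differentiation whose members satisfy [P]. *)
Lemma hered_coind p (P : fam p -> Prop) (Q : fam p -> Prop) :
  (forall F, Q F -> [/\ (forall t, ccontinuous (F t)), P F &
     forall i, exists2 dF, (forall t, is_cderive i (F t) (dF t)) & Q dF]) ->
  forall F, Q F -> hered P F.
Proof.
move=> QP F QF.
have Qs s : Q (fun t => foldr (@cpartial R p) (F t) s).
  elim: s => [//|i s ih] /=; have [_ _ /(_ i)[dF dFE QdF]] := QP _ ih.
  rewrite (_ : (fun t => _) = dF)//; apply/funext => t.
  exact: is_cderive_partial.
split=> [t|s]; last by have [] := QP _ (Qs s).
apply: (@smooth_coind _ _ (fun f => exists2 F, Q F & f = F t)); last by exists F.
move=> _ [G QG ->]; have [cG _ dG] := QP _ QG; split => // i.
by have [dF dFE QdF] := dG i; exists (dF t) => //; exists dF.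
Qed.

(** Differentiating a product gives a sum of two products of the same kind, so these finite sums
    form a class stable under differentiation; this replaces the Leibniz formula in [heredM]. *)
Inductive hered_span p (P Q : fam p -> Prop) : fam p -> Prop :=
| hered_spanM F G : hered P F -> hered Q G ->
    hered_span P Q (fun t x => F t x * G t x)
| hered_spanD F G : hered_span P Q F -> hered_span P Q G ->
    hered_span P Q (fun t x => F t x + G t x).

Lemma heredM p (P Q S : fam p -> Prop) :
  (forall F G, P F -> Q G -> S (fun t x => F t x * G t x)) ->
  (forall F G, S F -> S G -> S (fun t x => F t x + G t x)) ->
  forall F G, hered P F -> hered Q G -> hered S (fun t x => F t x * G t x).
Proof.
move=> PQS SD F G hF hG.
apply: (@hered_coind _ S (hered_span P Q)); last exact: hered_spanM.
move=> {F G hF hG} H; elim => {H}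
  [F G hF hG|F G hF [cF SF dF] hG [cG SG dG]].
  split.
  - move=> t; apply: ccontinuousM; apply: smooth_ccontinuous.
      exact: (hered_smooth t hF).
    exact: (hered_smooth t hG).
  - by apply: PQS; exact: hered_self.
  - move=> i; exists (fun t x => cpartial i (F t) x * G t x + F t x * cpartial i (G t) x).
      move=> t; apply: is_cderiveM; apply: smooth_is_cderive.
        exact: (hered_smooth t hF).
      exact: (hered_smooth t hG).
    by apply: hered_spanD; apply: hered_spanM => //; exact: hered_partial.
split.
- by move=> t; exact: ccontinuousD.
- exact: SD.
- move=> i; have [F' F'E sF] := dF i; have [G' G'E sG] := dG i.
  exists (fun t x => F' t x + G' t x); last exact: hered_spanD.
  by move=> t; exact: is_cderiveD.
Qed.

Lemma heredD p (P : fam p -> Prop) :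
  (forall F G, P F -> P G -> P (fun t x => F t x + G t x)) ->
  forall F G, hered P F -> hered P G -> hered P (fun t x => F t x + G t x).
Proof.
move=> PD F G hF hG.
apply: (@hered_coind _ P (fun H => exists F G, [/\ hered P F, hered P G &
   H = fun t x => F t x + G t x])); last by exists F, G.
move=> _ [{}F [{}G [{}hF {}hG ->]]]; split.
- move=> t; apply: ccontinuousD; apply: smooth_ccontinuous.
    exact: (hered_smooth t hF).
  exact: (hered_smooth t hG).
- by apply: PD; exact: hered_self.
- move=> i; exists (fun t x => cpartial i (F t) x + cpartial i (G t) x).
    move=> t; apply: is_cderiveD; apply: smooth_is_cderive.
        exact: (hered_smooth t hF).
      exact: (hered_smooth t hG).
  exists (fun t => cpartial i (F t)), (fun t => cpartial i (G t)).
  by split => //; exact: hered_partial.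
Qed.

Lemma hered_cst p (P : fam p -> Prop) (c : R[i]) : P (fun _ _ => 0) ->
  P (fun _ _ => c) -> hered P (fun _ _ => c).
Proof.
move=> P0 Pc; apply: (@hered_coind _ P (fun H => exists c, P (fun _ _ => c) /\ H = fun _ _ => c)).
  move=> _ [{Pc}c [Pc ->]]; split => //; first by move=> t; exact: ccontinuous_cst.
  move=> i; exists (fun _ _ => 0); first by move=> t; exact: is_cderive_cst.
  by exists 0.
by exists c.
Qed.

(** A derivative in direction [s k] is the pullback of the [k]-th one, while a direction outside the
    image of [s] gives zero; hence the demand that [Q] hold for the zero family. *)
Lemma hered_rowsel p q (s : 'I_q -> 'I_p) (P : fam q -> Prop) (Q : fam p -> Prop) F :
  injective s -> (forall F, P F -> Q (fun t z => F t (rowsel s z))) ->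
  Q (fun _ _ => 0) -> hered P F -> hered Q (fun t z => F t (rowsel s z)).
Proof.
move=> si PQ Q0 hF.
apply: (@hered_coind _ Q (fun H => H = (fun _ _ => 0) \/
  exists2 F, hered P F & H = fun t z => F t (rowsel s z))); last by right; exists F.
move=> _ [->|[{}F {}hF ->]].
  split => //; first by move=> t; exact: ccontinuous_cst.
  by move=> i; exists (fun _ _ => 0); [move=> t; exact: is_cderive_cst|left].
split.
- move=> t; apply: (ccontinuous_comp (@continuous_rowsel R p q s)).
  by apply: smooth_ccontinuous; exact: (hered_smooth t hF).
- by apply: PQ; exact: hered_self.
- move=> i; case: (pselect (exists k, s k = i)) => [[k <-]|nk].
    exists (fun t z => cpartial k (F t) (rowsel s z)); last first.
      by right; exists (fun t => cpartial k (F t)) => //; exact: hered_partial.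
    move=> t; have := @is_cderive_affine R p q (rowsel s) (s k) k 1 (F t) _ _
      (smooth_is_cderive k (hered_smooth t hF)).
    have -> : (fun z => 1%:C * cpartial k (F t) (rowsel s z)) =
       (fun z => cpartial k (F t) (rowsel s z)).
      by apply/funext => z; rewrite mul1r.
    by apply => h z; rewrite scale1r; exact: rowselE.
  exists (fun _ _ => 0); last by left.
  move=> t; apply: is_cderive_affine0 => h z; apply: rowsel0E => k.
  by apply/eqP => sk; apply: nk; exists k.
Qed.

End families.

(** * Complex integrals and integrals depending on parameters *)

Section complex_integrals.
Variable R : realType.
Local Notation Re := complex.Re.
Local Notation Im := complex.Im.

Lemma dominatedZ p (f : 'rV[R]_p -> R) (a : R) :
  dominated f -> dominated (fun x => a * f x).
Proof.
move=> [cf [C fC]]; split; first by apply: cont_mul => //; exact: cst_continuous.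
by exists (`|a| * C) => x; rewrite normrM -mulrA ler_wpM2l.
Qed.

Lemma integD p (f g : 'rV[R]_p -> R) : dominated f -> dominated g ->
  integ (fun x => f x + g x) = integ f + integ g.
Proof.
by move=> df dg; apply: RintegralD => //; exact: integrable_dominated.
Qed.

Lemma integZ p (f : 'rV[R]_p -> R) (a : R) : dominated f ->
  integ (fun x => a * f x) = a * integ f.
Proof. by move=> df; apply: RintegralZl => //; exact: integrable_dominated. Qed.

Lemma dominated_omegaV p : dominated (fun x : 'rV[R]_p => (omega x)^-1).
Proof.
split.
  apply: cont_inv; first exact: continuous_omega.
  by move=> x; rewrite gt_eqF ?omega_gt0.
by exists 1 => x; rewrite ger0_norm ?invr_ge0 ?mul1r// ltW ?omega_gt0.
Qed.

Definition omega_mass p : R := integ (fun x : 'rV[R]_p => (omega x)^-1).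

Lemma omega_mass_ge0 p : 0 <= omega_mass p.
Proof.
by apply: Rintegral_ge0 => x _; rewrite invr_ge0 ltW ?omega_gt0.
Qed.

Lemma integ_le p (f : 'rV[R]_p -> R) C : continuous f ->
  (forall x, `|f x| <= C / omega x) -> `|integ f| <= C * omega_mass p.
Proof.
move=> cf fC; have df : dominated f by split => //; exists C.
apply: le_trans (le_normr_Rintegral measurableT (integrable_dominated df)) _.
rewrite -integZ; last exact: dominated_omegaV.
apply: le_Rintegral; [by []| | |move=> t _; exact: fC].
  have : dominated (fun x => `|f x|).
    split; last by exists C => x; rewrite normr_id.
    by apply: (cont_comp cf) => y; exact: norm_continuous.
  by move/integrable_dominated.
apply: (@integrable_dominated _ _ (fun x => C / omega x)).
by apply: dominatedZ; exact: dominated_omegaV.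
Qed.

Definition cdominated p (f : 'rV[R]_p -> R[i]) :=
  ccontinuous f /\ exists C, forall x, normc (f x) <= C / omega x.

Lemma cdominatedRe p (f : 'rV[R]_p -> R[i]) : cdominated f -> dominated (fun x => Re (f x)).
Proof.
move=> [[cf _] [C fC]]; split => //; exists C => x.
exact: le_trans (ler_Re_normc _) (fC x).
Qed.

Lemma cdominatedIm p (f : 'rV[R]_p -> R[i]) : cdominated f -> dominated (fun x => Im (f x)).
Proof.
move=> [[_ cf] [C fC]]; split => //; exists C => x.
exact: le_trans (ler_Im_normc _) (fC x).
Qed.

Lemma cintegralE p (f : 'rV[R]_p -> R[i]) :
  cintegral f = integ (fun x => Re (f x)) +i* integ (fun x => Im (f x)).
Proof. by []. Qed.

Lemma cdominatedD p (f g : 'rV[R]_p -> R[i]) :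
  cdominated f -> cdominated g -> cdominated (fun x => f x + g x).
Proof.
move=> [cf [C fC]] [cg [D gD]]; split; first exact: ccontinuousD.
exists (C + D) => x; rewrite mulrDl.
exact: le_trans (le_normcD _ _) (lerD (fC x) (gD x)).
Qed.

Lemma cdominatedZ p (f : 'rV[R]_p -> R[i]) (a : R[i]) :
  cdominated f -> cdominated (fun x => a * f x).
Proof.
move=> [cf [C fC]]; split; first by apply: ccontinuousM => //; exact: ccontinuous_cst.
by exists (normc a * C) => x; rewrite normcM -mulrA ler_wpM2l// normc_ge0.
Qed.

Lemma cintegralD p (f g : 'rV[R]_p -> R[i]) : cdominated f -> cdominated g ->
  cintegral (fun x => f x + g x) = cintegral f + cintegral g.
Proof.
move=> df dg; rewrite !cintegralE.
rewrite [LHS](_ : _ = integ (fun x => Re (f x) + Re (g x)) +i*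
   integ (fun x => Im (f x) + Im (g x))).
  rewrite !integD//; [exact: cdominatedIm|exact: cdominatedIm|exact: cdominatedRe|exact:
    cdominatedRe].
by congr (_ +i* _); congr integ; apply/funext => x; rewrite raddfD.
Qed.

Lemma cintegralZ p (f : 'rV[R]_p -> R[i]) (a : R[i]) : cdominated f ->
  cintegral (fun x => a * f x) = a * cintegral f.
Proof.
move=> df; have dR := cdominatedRe df; have dI := cdominatedIm df.
rewrite !cintegralE; case: a => a b.
rewrite [LHS](_ : _ = integ (fun x => a * Re (f x) + (- b) * Im (f x)) +i*
   integ (fun x => a * Im (f x) + b * Re (f x))).
  rewrite !integD; [|exact: dominatedZ..].
  by rewrite !integZ// mulNr.
by congr (_ +i* _); congr integ; apply/funext => x; case: (f x) => c d //=; rewrite mulNr.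
Qed.

(** The factor 2 comes from bounding the real and imaginary parts separately. *)
Lemma cintegral_le p (f : 'rV[R]_p -> R[i]) C : ccontinuous f ->
  (forall x, normc (f x) <= C / omega x) ->
  normc (cintegral f) <= (2 * omega_mass p) * C.
Proof.
move=> [cr ci] fC; apply: le_trans (normc_le_ReIm _) _.
have -> : 2 * omega_mass p * C = C * omega_mass p + C * omega_mass p by ring.
apply: lerD.
  apply: (@integ_le p (fun x => Re (f x)) C cr) => x.
  exact: le_trans (ler_Re_normc _) (fC x).
apply: (@integ_le p (fun x => Im (f x)) C ci) => x.
exact: le_trans (ler_Im_normc _) (fC x).
Qed.

Lemma cintegral_partial p (i : 'I_p) (f df : 'rV[R]_p -> R[i]) :
  cdominated f -> cdominated df -> is_cderive i f df -> cintegral df = 0.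
Proof.
move=> cf cdf fd; rewrite cintegralE /integ /Rintegral.
rewrite (integral_partial (cdominatedRe cf) (cdominatedRe cdf) (fun x => (fd x).1)).
by rewrite (integral_partial (cdominatedIm cf) (cdominatedIm cdf) (fun x => (fd x).2)).
Qed.

Lemma continuous_row_mx p q (x : 'rV[R]_q) : continuous (fun w : 'rV[R]_p => row_mx x w).
Proof.
apply: continuous_rV => i; rewrite -(splitK i); case: (fintype.split i) => j /=.
  by under eq_fun do rewrite row_mxEl; exact: cst_continuous.
by under eq_fun do rewrite row_mxEr; exact: coord_continuous.
Qed.

Lemma continuous_row_mxl p q (w : 'rV[R]_p) : continuous (fun x : 'rV[R]_q => row_mx x w).
Proof.
apply: continuous_rV => i; rewrite -(splitK i); case: (fintype.split i) => j /=.
  by under eq_fun do rewrite row_mxEl; exact: coord_continuous.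
by under eq_fun do rewrite row_mxEr; exact: cst_continuous.
Qed.

Lemma row_mxlE p q (x : 'rV[R]_q) (w : 'rV[R]_p) (h : R) j :
  row_mx (h *: delta_mx 0 j + x) w = h *: delta_mx 0 (lshift p j) + row_mx x w.
Proof.
apply/rowP => k; rewrite -(splitK k); case: (fintype.split k) => l /=.
  rewrite [RHS]mxE [X in _ = X + _]mxE !row_mxEl [LHS]mxE [X in X + _ = _]mxE.
  by rewrite ![delta_mx _ _ _ _]mxE !eqxx /= eq_lshift.
rewrite [RHS]mxE [X in _ = X + _]mxE !row_mxEr [delta_mx _ _ _ _]mxE.
by rewrite eq_rlshift andbF mulr0 add0r.
Qed.

Lemma row_mxrE p q (x : 'rV[R]_q) (w : 'rV[R]_p) (h : R) j :
  row_mx x (h *: delta_mx 0 j + w) = h *: delta_mx 0 (rshift q j) + row_mx x w.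
Proof.
apply/rowP => k; rewrite -(splitK k); case: (fintype.split k) => l /=.
  rewrite [RHS]mxE [X in _ = X + _]mxE !row_mxEl [delta_mx _ _ _ _]mxE.
  by rewrite eq_lrshift andbF mulr0 add0r.
rewrite [RHS]mxE [X in _ = X + _]mxE !row_mxEr [LHS]mxE [X in X + _ = _]mxE.
by rewrite ![delta_mx _ _ _ _]mxE !eqxx /= eq_rshift.
Qed.

(* Integrals with parameters: z = (x, w) is integrated over w. *)
Definition fiber_integral p q (c : 'rV[R]_(q + p) -> R[i]) (x : 'rV[R]_q) : R[i] :=
  cintegral (fun w => c (row_mx x w)).

Definition fiber_bounded p q (c : 'rV[R]_(q + p) -> R[i]) (W : 'rV[R]_q -> R) :=
  ccontinuous c /\ forall x w, normc (c (row_mx x w)) <= W x / omega w.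

Lemma fiber_dominated p q (c : 'rV[R]_(q + p) -> R[i]) W x :
  fiber_bounded c W -> cdominated (fun w => c (row_mx x w)).
Proof.
move=> [cc cW]; split; last by exists (W x).
exact: (ccontinuous_comp (@continuous_row_mx p q x)).
Qed.

Lemma fiber_integral_le p q (c : 'rV[R]_(q + p) -> R[i]) W x :
  fiber_bounded c W -> normc (fiber_integral c x) <= 2 * omega_mass p * W x.
Proof.
move=> cW; apply: cintegral_le; first by have [] := fiber_dominated x cW.
by move=> w; have [_] := cW; apply.
Qed.

Lemma ccontinuous_fiber_integral p q (c : 'rV[R]_(q + p) -> R[i]) W :
  continuous W -> fiber_bounded c W -> ccontinuous (fiber_integral c).
Proof.
move=> cW cc; have [cont bnd] := cc; have [cR cI] := cont.
(* As [W] is continuous, it stays below W(x) + 1 near [x], which gives one dominating function for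
   all nearby parameters. *)
have near_le x : \forall y \near x, forall w : 'rV[R]_p, normc (c (row_mx y w)) <= (W x + 1) /
  omega w.
  have : \forall y \near x, W y < W x + 1.
    by have /cvgr_lt := cW x; apply; rewrite ltrDl.
  apply: filterS => y Wy w; apply: le_trans (bnd y w) _.
  by rewrite ler_wpM2r ?invr_ge0 ?(ltW Wy)// ltW// omega_gt0.
split=> x.
  apply: (@continuous_integ R _ p (fun x w => Re (c (row_mx x w))) x (W x + 1)).
  - by move=> y; exact: (cont_comp (@continuous_row_mx p q y) cR).
  - apply: filterS (near_le x) => y h w; exact: le_trans (ler_Re_normc _) (h w).
  - by move=> w; exact: (cont_comp (@continuous_row_mxl p q w) cR).
apply: (@continuous_integ R _ p (fun x w => Im (c (row_mx x w))) x (W x + 1)).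
- by move=> y; exact: (cont_comp (@continuous_row_mx p q y) cI).
- apply: filterS (near_le x) => y h w; exact: le_trans (ler_Im_normc _) (h w).
- by move=> w; exact: (cont_comp (@continuous_row_mxl p q w) cI).
Qed.

(** Boundedness of [W'] on a segment around each point in the direction of differentiation gives the
    dominating function for the difference quotients. *)
Lemma is_cderive_fiber_integral p q (c dc : 'rV[R]_(q + p) -> R[i]) W W' j :
  (forall x, exists D, forall h : R, `|h| < 1 -> W' (h *: delta_mx 0 j + x) <= D) ->
  fiber_bounded c W -> fiber_bounded dc W' -> is_cderive (lshift p j) c dc ->
  is_cderive j (fiber_integral c) (fiber_integral dc).
Proof.
move=> WW [[cR cI] bnd] [_ dbnd] d.
have dl x w : is_derive x (delta_mx 0 j : 'rV[R]_q) (fun y => Re (c (row_mx y w))) (Re (dc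
  (row_mx x w))) /\
   is_derive x (delta_mx 0 j : 'rV[R]_q) (fun y => Im (c (row_mx y w))) (Im (dc (row_mx x w))).
  have [d1 d2] := d (row_mx x w); split.
    apply: (@is_derive_comp_affine R _ _ (fun y : 'rV[R]_q => row_mx y w)
      (fun z => Re (c z)) x _ (delta_mx 0 (lshift p j))) => // h; exact: row_mxlE.
  apply: (@is_derive_comp_affine R _ _ (fun y : 'rV[R]_q => row_mx y w)
    (fun z => Im (c z)) x _ (delta_mx 0 (lshift p j))) => // h; exact: row_mxlE.
move=> x; have [D WD] := WW x.
have le1 w (h : R) : `|h| < 1 ->
    normc (dc (row_mx (h *: delta_mx 0 j + x) w)) <= D / omega w.
  move=> h1; apply: le_trans (dbnd _ w) _.
  by rewrite ler_wpM2r ?WD// invr_ge0 ltW// omega_gt0.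
split.
  apply: (@is_derive_integ R _ p (fun y w => Re (c (row_mx y w)))
    (fun y w => Re (dc (row_mx y w))) x _ W D).
  - by move=> y; exact: (cont_comp (@continuous_row_mx p q y) cR).
  - by move=> y w; exact: le_trans (ler_Re_normc _) (bnd y w).
  - by move=> y w; have [] := dl y w.
  - by move=> w h h1; exact: le_trans (ler_Re_normc _) (le1 _ _ h1).
apply: (@is_derive_integ R _ p (fun y w => Im (c (row_mx y w)))
  (fun y w => Im (dc (row_mx y w))) x _ W D).
- by move=> y; exact: (cont_comp (@continuous_row_mx p q y) cI).
- by move=> y w; exact: le_trans (ler_Im_normc _) (bnd y w).
- by move=> y w; have [] := dl y w.
- by move=> w h h1; exact: le_trans (ler_Im_normc _) (le1 _ _ h1).
Qed.

Lemma fiber_integral_partial p q (c dc : 'rV[R]_(q + p) -> R[i]) j x :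
  cdominated (fun w => c (row_mx x w)) -> cdominated (fun w => dc (row_mx x w)) ->
  is_cderive (rshift q j) c dc -> fiber_integral dc x = 0.
Proof.
move=> dc1 dc2 d; apply: (cintegral_partial (i := j) dc1 dc2) => w.
have [d1 d2] := d (row_mx x w); split.
  apply: (@is_derive_comp_affine R _ _ (fun w : 'rV[R]_p => row_mx x w)
    (fun z => Re (c z)) w _ (delta_mx 0 (rshift q j))) => // h; exact: row_mxrE.
apply: (@is_derive_comp_affine R _ _ (fun w : 'rV[R]_p => row_mx x w)
  (fun z => Im (c z)) w _ (delta_mx 0 (rshift q j))) => // h; exact: row_mxrE.
Qed.

End complex_integrals.

(** * Families of Schwartz functions with uniform seminorm estimates *)

Section schwartz_families.
Variables (R : realType) (T : Type) (gauge : T -> R).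
Hypothesis gauge01 : forall t, 0 < gauge t <= 1.
Local Notation fam p := (T -> 'rV[R]_p -> R[i]).
Local Notation est := (est gauge).

Lemma omegaX_ge0 p (x : 'rV[R]_p) k : 0 <= omega x ^+ k.
Proof. by rewrite ltW// omegaX_gt0. Qed.

Lemma omegaXV_ge0 p (x : 'rV[R]_p) k : 0 <= omega x ^- k.
Proof. by rewrite invr_ge0 omegaX_ge0. Qed.

Lemma oneDsqr_le_omega p (x : 'rV[R]_p) i : 1 + x 0 i ^+ 2 <= omega x.
Proof.
rewrite /omega (bigD1 i)//= ler_peMr ?addr_ge0 ?sqr_ge0//.
elim/big_ind: _ => // [a b a1 b1|j _]; first by rewrite -[1]mulr1; apply: ler_pM.
by rewrite lerDl sqr_ge0.
Qed.

Lemma norm_coord_le_omega p (x : 'rV[R]_p) i : `|x 0 i| <= omega x.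
Proof.
apply: le_trans (oneDsqr_le_omega x i); rewrite -real_normK ?num_real//.
by have := sqr_ge0 (`|x 0 i| - 1); have := normr_ge0 (x 0 i); nra.
Qed.

Lemma norm_monom_le p (x : 'rV[R]_p) alpha : `|monom alpha x| <= omega x ^+ mdeg alpha.
Proof.
rewrite /monom /mdeg -prodrXr normr_prod.
apply: ler_prod => i _; rewrite normr_ge0 normrX/= lerXn2r ?nnegrE//.
  by rewrite ltW// omega_gt0.
exact: norm_coord_le_omega.
Qed.

(** A power of [omega] is a sum of monomials. It is built one factor 1 + x_i^2 at a time, and [P]
    keeps an arbitrary further monomial in reserve so that each factor can be split into two
    monomial estimates. *)
Lemma est_monom p neg (F : fam p) (w : 'rV[R]_p -> R) : (forall x, 0 <= w x) ->
  (forall alpha, est neg (fun t x => (monom alpha x)%:C * F t x) w) ->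
  forall k, est neg F (fun x => w x / omega x ^+ k).
Proof.
move=> w0 h k.
pose P (m : 'rV[R]_p -> R) := forall alpha : 'rV[nat]_p,
  est neg (fun t x => (m x * monom alpha x)%:C * F t x) w.
have P1 : P (fun=> 1).
  by move=> alpha; under eq_fun do under eq_fun do rewrite mul1r; exact: h.
have Pstep m i : P m -> P (fun x => m x * (1 + x 0 i ^+ 2)).
  move=> Pm alpha.
  have mE x : monom (\row_j (alpha 0%R j + (j == i) * 2)%N) x = monom alpha x * x 0 i ^+ 2.
    rewrite /monom [LHS](eq_bigr (fun j => x 0 j ^+ alpha 0 j * x 0 j ^+ ((j == i) * 2)%N)).
      rewrite big_split /=; congr (_ * _).
      by rewrite (bigD1 i)//= eqxx mul1n big1 ?mulr1// => j /negbTE ->; rewrite mul0n.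
    by move=> j _; rewrite mxE exprD.
  have -> : (fun t x => (m x * (1 + x 0 i ^+ 2) * monom alpha x)%:C * F t x) =
    (fun t x => (m x * monom alpha x)%:C * F t x +
      (m x * monom (\row_j (alpha 0%R j + (j == i) * 2)%N) x)%:C * F t x).
    apply/funext => t; apply/funext => x; rewrite mE -mulrDl -rmorphD /=.
    by congr (_%:C * _); ring.
  by apply: estD.
have Pomega m : P m -> P (fun x => m x * omega x).
  move=> Pm; rewrite /omega; elim: (index_enum _) => [|i r ih].
    by under eq_fun do rewrite big_nil mulr1.
  under eq_fun do rewrite big_cons mulrCA mulrC -mulrA.
  have := Pstep _ i ih; congr P; apply/funext => x.
  by rewrite mulrA.
have Pk : P (fun x => omega x ^+ k).
  elim: k => [|k ih]; first exact: P1.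
  by have := Pomega _ ih; congr P; apply/funext => x; rewrite exprSr.
have := Pk 0.
have m0 x : monom 0 x = 1 :> R by rewrite /monom big1// => i _; rewrite mxE.
have aux C (s : R) x t : normc ((omega x ^+ k * monom 0 x)%:C * F t x) <= C * s * w x ->
    normc (F t x) <= C * s * (w x / omega x ^+ k).
  rewrite m0 mulr1 normcM normc_real ger0_norm ?omegaX_ge0// mulrA.
  by rewrite ler_pdivlMr ?omegaX_gt0// mulrC.
rewrite /est; case: neg {h P P1 Pstep Pomega Pk} => [h q|[q [C C0 h]]].
  by have [C C0 {}h] := h q; exists C => // t x; apply: aux; exact: h.
by exists q, C => // t x; apply: aux; exact: h.
Qed.

Definition rapid p neg (F : fam p) := forall k, est neg F (fun x => omega x ^- k).

Definition schwartz_fam p neg (F : fam p) := hered (rapid neg) F.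

(** The exponent [k] is shared by the whole class. Since all monomial multiples of a member stay in
    the class, [est_monom] divides the common bound by omega^(k+l), leaving omega^-l; derivatives
    are again members, so the same holds for them. *)
Lemma schwartz_fam_closure p neg k (G : fam p -> Prop) :
  (forall F, G F -> [/\ (forall t, ccontinuous (F t)), est neg F (fun x => omega x ^+ k),
    forall i, exists2 dF, (forall t, is_cderive i (F t) (dF t)) & G dF &
    forall i, G (fun t x => coordc i x * F t x)]) ->
  forall F, G F -> schwartz_fam neg F.
Proof.
move=> GP; apply: hered_coind => F GF.
have [cF eF dF xF] := GP F GF; split => // l.
have Gm alpha : G (fun t x => (monom alpha x)%:C * F t x).
  rewrite /monom; elim: (index_enum _) => [|i r ih].
    have := GF; congr G; apply/funext => t; apply/funext => x.
    by rewrite big_nil mul1r.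
  have : G (fun t x => (x 0 i ^+ alpha 0 i)%:C * ((\prod_(i <- r) x 0 i ^+ alpha 0 i)%:C * F t x)).
    elim: (alpha 0 i) => [|j ihj].
      by have := ih; congr G; apply/funext => t; apply/funext => x; rewrite mul1r.
    have [_ _ _ /(_ i)] := GP _ ihj; congr G; apply/funext => t; apply/funext => x.
    by rewrite /coordc mulrA -rmorphM -exprS.
  congr G; apply/funext => t; apply/funext => x.
  by rewrite mulrA -rmorphM big_cons.
have /(_ (k + l)%N) := est_monom (fun x => omegaX_ge0 x k)
  (fun alpha => let: And4 _ h _ _ := GP _ (Gm alpha) in h).
apply: (est_le gauge01 ler01) => x; rewrite mul1r exprD invfM mulrA.
by rewrite mulfV ?mul1r// gt_eqF ?omegaX_gt0.
Qed.

Lemma hered_coordc p (i : 'I_p) (w : 'rV[R]_p -> R) : (forall x, 1 <= w x) ->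
  (forall x : 'rV[R]_p, `|x 0 i| <= w x) -> hered (fun F => est false F w) (fun _ => coordc i).
Proof.
move=> w1 xw; have cst_est (c : R[i]) : est false (fun _ _ => c) w.
  apply: (@est_const R T gauge p (fun=> c) _ (normc c)); first exact: normc_ge0.
  by move=> x; rewrite ler_peMr ?normc_ge0.
split=> [t|s]; first exact: smooth_coordc.
elim/last_ind: s => [|s j _] /=.
  apply: (@est_const R T gauge p (@coordc R p i) _ 1) => // x.
  by rewrite mul1r normc_real.
under eq_fun do rewrite foldr_rcons (is_cderive_partial (@is_cderive_coordc R p j i)).
have := hered_cst (P := fun F => est false F w) (cst_est 0) (cst_est (j == i)%:R).
by move=> [_ /(_ s)].
Qed.

Lemma rapidD p neg (F G : fam p) : rapid neg F -> rapid neg G ->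
  rapid neg (fun t x => F t x + G t x).
Proof.
by move=> hF hG k; apply: estD => // x; exact: omegaXV_ge0.
Qed.

Lemma schwartz_famM p neg neg' (F G : fam p) k :
  hered (fun F => est neg F (fun x => omega x ^+ k)) F -> schwartz_fam neg' G ->
  schwartz_fam (neg || neg') (fun t x => F t x * G t x).
Proof.
apply: heredM => [{}F {}G hF hG l|{}F {}G]; last exact: rapidD.
have := estM gauge01 hF (hG (k + l)%N); apply: (est_le gauge01 ler01) => x.
rewrite mul1r exprD invfM mulrA mulfV ?mul1r// gt_eqF ?omegaX_gt0//.
Qed.

Lemma schwartz_fam_coord p neg (F : fam p) i : schwartz_fam neg F ->
  schwartz_fam neg (fun t x => coordc i x * F t x).
Proof.
apply: (@schwartz_famM p false neg (fun _ => coordc i) F 1).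
apply: hered_coordc => x; first by rewrite expr1 omega_ge1.
by rewrite expr1 norm_coord_le_omega.
Qed.

Lemma schwartz_famZ p neg (F : fam p) (c : R[i]) : schwartz_fam neg F ->
  schwartz_fam neg (fun t x => c * F t x).
Proof.
apply: (@schwartz_famM p false neg (fun _ _ => c) F 0).
have e (d : R[i]) : est false (fun _ _ => d) (fun x : 'rV[R]_p => omega x ^+ 0).
  apply: (@est_const R T gauge p (fun=> d) _ (normc d)); first exact: normc_ge0.
  by move=> x; rewrite expr0 mulr1.
exact: hered_cst.
Qed.

Lemma schwartz_fam_partial p neg (F : fam p) i : schwartz_fam neg F ->
  schwartz_fam neg (fun t => cpartial i (F t)).
Proof. exact: hered_partial. Qed.

Lemma est_fiber_integral p q neg (c : T -> 'rV[R]_(q + p) -> R[i]) (W : 'rV[R]_q -> R) :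
  (forall t, ccontinuous (c t)) ->
  est neg c (fun z => W (lsubmx z) / omega (rsubmx z)) ->
  est neg (fun t => fiber_integral (c t)) W.
Proof.
move=> cc; rewrite /est.
have m0 : 0 <= 2 * omega_mass R p by rewrite mulr_ge0// omega_mass_ge0.
have aux C (s : R) x t :
    (forall z, normc (c t z) <= C * s * (W (lsubmx z) / omega (rsubmx z))) ->
    normc (fiber_integral (c t) x) <= 2 * omega_mass R p * C * s * W x.
  move=> h; have : fiber_bounded (c t) (fun x => C * s * W x).
    split => // {}x w; have := h (row_mx x w).
    by rewrite row_mxKl row_mxKr mulrA.
  by move=> /(fiber_integral_le x) /le_trans; apply; rewrite !mulrA.
case: neg => [h q'|[q' [C C0 h]]].
  have [C C0 {}h] := h q'; exists (2 * omega_mass R p * C); first exact: mulr_ge0.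
  by move=> t x; apply: aux => z; exact: h.
exists q', (2 * omega_mass R p * C); first exact: mulr_ge0.
by move=> t x; apply: aux => z; exact: h.
Qed.

End schwartz_families.

(** * Exponentials of imaginary bilinear forms *)

Section phases.
Variable R : realType.

Lemma normc_expi (t : R) : normc (expi t) = 1.
Proof. by rewrite /expi /= cos2Dsin2 sqrtr1. Qed.

Lemma expiD (a b : R) : expi (a + b) = expi a * expi b.
Proof.
by rewrite /expi cosD sinD; apply/eqP; rewrite eq_complex /= [sin a * _ + _]addrC !eqxx.
Qed.

Lemma mulNi_real (a : R) : (0 -i* 1) * a%:C = 0 +i* (-1 * a).
Proof. by apply/eqP; rewrite eq_complex /= !mul0r !mulr0 subr0 add0r !eqxx. Qed.

Lemma ccontinuous_expi (U : topologicalType) (f : U -> R) : continuous f ->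
  ccontinuous (fun x => expi (f x)).
Proof.
move=> cf; split; first exact: (cont_comp cf (@continuous_cos R)).
exact: (cont_comp cf (@continuous_sin R)).
Qed.

Lemma is_derive_line (V : normedModType R) (f : V -> R) x v d :
  is_derive (0 : R) (1 : R) (fun h : R => f (h *: v + x)) d -> is_derive x v f d.
Proof.
move=> [h1 h2].
have E : (fun h : R => h^-1 *: (((fun h : R => f (h *: v + x)) \o shift 0) (h *: (1 : R)) -
   f (0 *: v + x))) = (fun h : R => h^-1 *: ((f \o shift x) (h *: v) - f x)).
  by apply/funext => h /=; rewrite addr0 scale0r add0r [h *: 1]mulr1.
by apply: DeriveDef; rewrite ?/derivable ?/derive -E.
Qed.

Lemma is_cderive_expi p (f df : 'rV[R]_p -> R) i :
  (forall x, is_derive x (delta_mx 0 i : 'rV[R]_p) f (df x)) ->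
  is_cderive i (fun x => expi (f x)) (fun x => (0 +i* df x) * expi (f x)).
Proof.
move=> fd x.
have ld : is_derive (0 : R) (1 : R) (fun h : R => f (h *: delta_mx 0 i + x)) (df x).
  apply: (@is_derive_comp_affine R _ _ (fun h : R => h *: delta_mx 0 i + x) f 0 1
    (delta_mx 0 i)) => [h|]; last by rewrite scale0r add0r; exact: fd.
  by rewrite addr0 scale0r add0r [h *: (1 : R)]mulr1.
have f0 : f (0 *: delta_mx 0 i + x) = f x by rewrite scale0r add0r.
split; apply: is_derive_line.
  have := is_derive1_comp (is_derive_cos (f (0 *: delta_mx 0 i + x))) ld.
  by move=> h; apply: (is_derive_eq h); rewrite f0 /=; ring.
have := is_derive1_comp (is_derive_sin (f (0 *: delta_mx 0 i + x))) ld.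
by move=> h; apply: (is_derive_eq h); rewrite f0 /=; ring.
Qed.

Variables (p n : nat) (a b : 'I_n -> 'I_p).
Implicit Types (s : R) (z : 'rV[R]_p).

(** The maps [a] and [b] select two blocks of coordinates. One formula then covers the Fourier
    kernel and the two factors e^(i x xi) and e^(-i y xi) of the oscillatory kernel. *)
Definition bilin z : R := \sum_k z 0 (a k) * z 0 (b k).

Definition phase s z : R[i] := expi (s * bilin z).

Definition dbilin i z : R := \sum_k ((i == a k)%:R * z 0 (b k) + (i == b k)%:R * z 0 (a k)).

Lemma is_derive_bilin i z :
  is_derive z (delta_mx 0 i : 'rV[R]_p) bilin (dbilin i z).
Proof.
rewrite (_ : bilin = \sum_k ((fun y : 'rV[R]_p => y 0 (a k)) * (fun y : 'rV[R]_p => y 0 (b k))));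
  last first.
  by apply/funext => y; rewrite fct_sumE.
apply: is_derive_eq.
  apply: is_derive_sum => k.
  by apply: is_deriveM; exact: is_derive_coord.
apply: eq_bigr => k _; rewrite /GRing.scale /=; ring.
Qed.

Lemma continuous_bilin : continuous bilin.
Proof.
rewrite /bilin; elim: (index_enum _) => [|k r ih].
  by under eq_fun do rewrite big_nil; exact: cst_continuous.
under eq_fun do rewrite big_cons; apply: cont_add => //.
by apply: cont_mul; exact: coord_continuous.
Qed.

Lemma ccontinuous_phase s : ccontinuous (phase s).
Proof.
apply: ccontinuous_expi; apply: cont_mul; first exact: cst_continuous.
exact: continuous_bilin.
Qed.

Lemma is_cderive_phase i s :
  is_cderive i (phase s) (fun z => (0 +i* (s * dbilin i z)) * phase s z).
Proof.
apply: is_cderive_expi => z.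
apply: is_derive_eq; first by apply: is_deriveZ; exact: is_derive_bilin.
by [].
Qed.

Lemma dbilinl k z : injective a -> (forall j, a k != b j) -> dbilin (a k) z = z 0 (b k).
Proof.
move=> ai ab; rewrite /dbilin (bigD1 k)//= eqxx (negbTE (ab k)) mul1r mul0r addr0.
rewrite big1 ?addr0// => j jk; rewrite (negbTE (ab j)) (inj_eq ai) eq_sym (negbTE jk).
by rewrite !mul0r addr0.
Qed.

Lemma dbilinr k z : injective b -> (forall j, b k != a j) -> dbilin (b k) z = z 0 (a k).
Proof.
move=> ai ab; rewrite /dbilin (bigD1 k)//= eqxx (negbTE (ab k)) mul1r mul0r add0r.
rewrite big1 ?addr0// => j jk; rewrite (negbTE (ab j)) (inj_eq ai) eq_sym (negbTE jk).
by rewrite !mul0r addr0.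
Qed.

Lemma dbilin0 i z : (forall j, i != a j) -> (forall j, i != b j) -> dbilin i z = 0.
Proof.
move=> ia ib; rewrite /dbilin big1// => k _.
by rewrite (negbTE (ia k)) (negbTE (ib k)) !mul0r addr0.
Qed.

End phases.

(** * The Fourier transform on Schwartz families *)

Section fourier_transform.
Variables (R : realType) (T : Type) (gauge : T -> R).
Hypothesis gauge01 : forall t, 0 < gauge t <= 1.
Variables (n : nat) (neg : bool).
Local Notation fam p := (T -> 'rV[R]_p -> R[i]).
Local Notation sch := (@schwartz_fam R T gauge n neg).

(* The variables are z = (xi, x), integrated over x. *)
Let kernel : 'rV[R]_(n + n) -> R[i] := phase (@rshift n n) (@lshift n n) (-1).

Let cF (F : fam n) (t : T) (z : 'rV[R]_(n + n)) : R[i] := kernel z * F t (rsubmx z).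

Let cFE F t xi : fiber_integral (cF F t) xi = fourier (F t) xi.
Proof.
congr cintegral; apply/funext => x; rewrite /cF row_mxKr; congr (expi _ * _).
rewrite mulN1r; congr (- _); apply: eq_bigr => k _.
by rewrite row_mxEr row_mxEl.
Qed.

Let continuous_rsub : continuous (fun z : 'rV[R]_(n + n) => rsubmx z).
Proof.
apply: continuous_rV => i; under eq_fun do rewrite mxE; exact: coord_continuous.
Qed.

Let cF_cont F t : sch F -> ccontinuous (cF F t).
Proof.
move=> hF; apply: ccontinuousM; first exact: ccontinuous_phase.
apply: (ccontinuous_comp continuous_rsub); apply: smooth_ccontinuous.
exact: (hered_smooth t hF).
Qed.

Let normc_kernelM z (c : R[i]) : normc (kernel z * c) = normc c.
Proof. by rewrite normcM normc_expi mul1r. Qed.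

Let cF_bound F t : sch F -> exists2 C, 0 <= C & fiber_bounded (cF F t) (fun=> C).
Proof.
move=> hF; have := hered_self hF 1 => /(est_at gauge01) /(_ t)[C C0 FC].
exists C => //; split; first exact: cF_cont.
by move=> xi x; rewrite normc_kernelM row_mxKr; have := FC x; rewrite expr1.
Qed.

Let cF_dl F t j : sch F -> is_cderive (lshift n j) (cF F t)
   (cF (fun t x => (0 -i* 1) * (coordc j x * F t x)) t).
Proof.
move=> hF.
have d1 : is_cderive (lshift n j) (fun z : 'rV[R]_(n + n) => F t (rsubmx z)) (fun=> 0).
  apply: (@is_cderive_affine0 R _ _ (fun z : 'rV[R]_(n + n) => rsubmx z)) => h z.
  apply/rowP => k; rewrite !mxE eq_rlshift andbF mulr0 add0r//.
have := is_cderiveM (is_cderive_phase (@rshift n n) (@lshift n n) (lshift n j) (-1)) d1.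
congr is_cderive; apply/funext => z; rewrite mulr0 addr0 /cF.
rewrite dbilinr; [|exact: lshift_inj|by move=> k; rewrite eq_lrshift].
rewrite (_ : 0 +i* (-1 * z 0 (rshift n j)) = (0 -i* 1) * coordc j (rsubmx z)).
  by rewrite /kernel; ring.
by rewrite -mulNi_real /coordc mxE.
Qed.

Let cF_dr F t j : sch F -> is_cderive (rshift n j) (cF F t)
   (fun z => (0 -i* 1) * coordc j (lsubmx z) * cF F t z + cF (fun t => cpartial j (F t)) t z).
Proof.
move=> hF.
have d1 : is_cderive (rshift n j) (fun z : 'rV[R]_(n + n) => F t (rsubmx z))
    (fun z => cpartial j (F t) (rsubmx z)).
  have := @is_cderive_affine R _ _ (fun z : 'rV[R]_(n + n) => rsubmx z) (rshift n j) j 1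
    (F t) _ _ (smooth_is_cderive j (hered_smooth t hF)).
  have -> : (fun z : 'rV[R]_(n + n) => 1%:C * cpartial j (F t) (rsubmx z)) =
       (fun z => cpartial j (F t) (rsubmx z)).
    by apply/funext => z; rewrite mul1r.
  apply=> h z; apply/rowP => k; rewrite !mxE !eqxx /= eq_rshift.
  by rewrite mul1r.
have := is_cderiveM (is_cderive_phase (@rshift n n) (@lshift n n) (rshift n j) (-1)) d1.
congr is_cderive; apply/funext => z; rewrite /cF; congr (_ + _).
rewrite dbilinl; [|exact: rshift_inj|by move=> k; rewrite eq_rlshift].
rewrite (_ : 0 +i* (-1 * z 0 (lshift n j)) = (0 -i* 1) * coordc j (lsubmx z)).
  by rewrite /kernel; ring.
by rewrite -mulNi_real /coordc mxE.
Qed.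

(** The x_j-derivative of e^(-i x xi) F(x) integrates to zero; its two terms are -i xi_j times the
    transform of F and the transform of the j-th derivative of F. *)
Lemma fourier_coord F t j xi : sch F ->
  coordc j xi * fourier (F t) xi = fourier (fun x => (0 -i* 1) * cpartial j (F t) x) xi.
Proof.
move=> hF; rewrite -[fourier (F t) xi]cFE.
have hdF := schwartz_fam_partial j hF.
have dom G : sch G -> cdominated (fun x => cF G t (row_mx xi x)).
  by move=> hG; have [C _ bC] := cF_bound t hG; exact: (fiber_dominated xi bC).
have rE : (fun w => (fun z => (0 -i* 1) * coordc j (lsubmx z) * cF F t z +
      cF (fun t => cpartial j (F t)) t z) (row_mx xi w)) =
    (fun w => (0 -i* 1) * coordc j xi * cF F t (row_mx xi w) +
      cF (fun t => cpartial j (F t)) t (row_mx xi w)).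
  by apply/funext => w; rewrite row_mxKl.
have := @fiber_integral_partial R n n (cF F t) _ j xi (dom _ hF) _ (cF_dr t j hF).
rewrite /fiber_integral rE => h0.
have {h0} : (0 -i* 1) * coordc j xi * fiber_integral (cF F t) xi +
    fiber_integral (cF (fun t => cpartial j (F t)) t) xi = 0.
  rewrite -[RHS]h0; last by apply: cdominatedD; [apply: cdominatedZ; exact: dom|exact: dom].
  rewrite cintegralD; [|by apply: cdominatedZ; exact: dom|exact: dom].
  by rewrite cintegralZ//; exact: dom.
move/eqP; rewrite addr_eq0 => /eqP h0.
rewrite (_ : fourier (fun x => (0 -i* 1) * cpartial j (F t) x) xi =
  (0 -i* 1) * fiber_integral (cF (fun t => cpartial j (F t)) t) xi); last first.
  rewrite -[LHS](cFE (fun t x => (0 -i* 1) * cpartial j (F t) x) t).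
  rewrite /fiber_integral -cintegralZ; last exact: dom.
  by congr cintegral; apply/funext => x; rewrite /cF mulrCA.
rewrite -[RHS]mulrNN -h0 !mulrA mulNr.
have -> : (0 -i* 1) * (0 -i* 1) = -1 :> R[i].
  by apply/eqP; rewrite eq_complex /= !mul0r !mulr0 !addr0 mulrNN mulr1 sub0r oppr0 !eqxx.
by rewrite opprK mul1r.
Qed.

(** The transforms of Schwartz families form the class required by [schwartz_fam_closure]: d/dxi_j
    corresponds to -i x_j, multiplication by xi_j to -i d/dx_j, and the integrals are bounded in xi,
    so the common exponent is 0. *)
Lemma schwartz_fam_fourier F : sch F -> sch (fun t => fourier (F t)).
Proof.
move=> hF.
apply: (@schwartz_fam_closure R T gauge gauge01 n neg 0
  (fun G => exists2 F, sch F & G = fun t => fourier (F t))); last by exists F.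
move=> _ [{hF}F hF ->].
have cE t : fiber_integral (cF F t) = fourier (F t).
  by apply/funext => xi; exact: cFE.
split.
- move=> t; have [C _ bC] := cF_bound t hF; rewrite -cE.
  by apply: ccontinuous_fiber_integral bC; exact: cst_continuous.
- under eq_fun do rewrite -cE.
  apply: est_fiber_integral => // [t|]; first exact: cF_cont.
  have := hered_self hF 1; rewrite /est.
  have aux C (s : R) t z : (forall x, normc (F t x) <= C * s * omega x ^- 1) ->
      normc (cF F t z) <= C * s * (omega (lsubmx z) ^+ 0 / omega (rsubmx z)).
    by move=> h; rewrite normc_kernelM expr0 mul1r -[omega (rsubmx z)]expr1.
  case: neg => [h q|[q [C C0 h]]].
    by have [C C0 {}h] := h q; exists C => // t z; apply: aux => x; exact: h.
  by exists q, C => // t z; apply: aux => x; exact: h.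
- move=> j; have hxF := schwartz_famZ gauge01 (0 -i* 1) (schwartz_fam_coord gauge01 j hF).
  exists (fun t => fourier (fun x => (0 -i* 1) * (coordc j x * F t x)));
    last by exists (fun t x => (0 -i* 1) * (coordc j x * F t x)).
  move=> t; rewrite -cE.
  have [C _ bC] := cF_bound t hF; have [D _ bD] := cF_bound t hxF.
  have -> : fourier (fun x => (0 -i* 1) * (coordc j x * F t x)) =
     fiber_integral (cF (fun t x => (0 -i* 1) * (coordc j x * F t x)) t).
    by apply/funext => xi; rewrite cFE.
  apply: is_cderive_fiber_integral bC bD (cF_dl t j hF).
  by move=> _; exists D.
- move=> j; exists (fun t x => (0 -i* 1) * cpartial j (F t) x).
    by apply: schwartz_famZ => //; exact: schwartz_fam_partial.
  by apply/funext => t; apply/funext => xi; exact: fourier_coord.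
Qed.

End fourier_transform.

(** * Limits of complex quantities as the cut-off parameter h tends to 0 *)

Section cut_off_limits.
Variable R : realType.

Definition clim (u : R -> R[i]) (a : R[i]) := normc (u h - a) @[h --> 0^'+] --> (0 : R).

Lemma clim_squeeze (u : R -> R[i]) a (f : R -> R) :
  (forall h, 0 < h -> normc (u h - a) <= f h) -> f h @[h --> 0^'+] --> (0 : R) -> clim u a.
Proof.
move=> uf f0; apply: (@squeeze_cvgr _ _ _ _ (cst 0) _ _ _ _ _ f0); last exact: cvg_cst.
near=> h; rewrite normc_ge0 /= uf//; near: h; exact: nbhs_right_gt.
Unshelve. all: by end_near. Qed.

Lemma clim_ext (u v : R -> R[i]) a : (forall h, 0 < h -> u h = v h) -> clim v a -> clim u a.
Proof. by move=> uv; apply: clim_squeeze => h h0; rewrite uv. Qed.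

Lemma climD (u v : R -> R[i]) a b : clim u a -> clim v b -> clim (fun h => u h + v h) (a + b).
Proof.
move=> ua vb.
apply: (@clim_squeeze _ _ (fun h => normc (u h - a) + normc (v h - b))) => [h _|].
  by rewrite opprD addrACA; exact: le_normcD.
by rewrite -[X in _ --> X]addr0; exact: cvgD.
Qed.

Lemma climZ (u : R -> R[i]) a c : clim u a -> clim (fun h => c * u h) (c * a).
Proof.
move=> ua; apply: (@clim_squeeze _ _ (fun h => normc c * normc (u h - a))) => [h _|].
  by rewrite -mulrBr normcM.
by rewrite -[X in _ --> X](mulr0 (normc c)); exact: cvgMr.
Qed.

(** Disposes of the term in which an integration by parts differentiates psi(h w) and produces a
    factor h. *)
Lemma clim_small (u : R -> R[i]) a : clim u a -> clim (fun h => h%:C * u h) 0.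
Proof.
move=> ua.
have h0 : h @[h --> (0 : R)^'+] --> (0 : R) by apply: cvg_at_right_filter; exact: cvg_id.
apply: (@clim_squeeze _ _ (fun h => h * (normc (u h - a) + normc a))) => [h hp|].
  rewrite subr0 normcM normc_real gtr0_norm//; apply: ler_wpM2l; first exact: ltW.
  by rewrite -{1}(subrK a (u h)); exact: le_normcD.
rewrite -[X in _ --> X](mul0r (0 + normc a)); apply: cvgM => //.
by apply: cvgD => //; exact: cvg_cst.
Qed.

Lemma clim_unique (u : R -> R[i]) a b : clim u a -> clim u b -> a = b.
Proof.
move=> ua ub.
have := climD ua (climZ (-1) ub) => ab0.
have {}ab0 : clim (fun=> 0) (a + -1 * b).
  by apply: clim_ext ab0 => h _; rewrite mulN1r subrr.
apply/eqP; rewrite -subr_eq0 -mulN1r; apply/eqP; apply: eq0_normc.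
have c1 : normc (0 - (a + -1 * b)) @[h --> (0 : R)^'+] --> normc (0 - (a + -1 * b)).
  exact: cvg_cst.
rewrite -[LHS]normcN -sub0r; symmetry.
by apply: (cvg_unique _ ab0 c1).
Qed.

Lemma continuous_clim (u : R -> R[i]) : {for 0, continuous (fun h => complex.Re (u h))} ->
  {for 0, continuous (fun h => complex.Im (u h))} -> clim u (u 0).
Proof.
move=> cR cI.
have l (f : R -> R) : {for 0, continuous f} ->
    `|f h - f 0| @[h --> 0^'+] --> (0 : R).
  move=> cf; have fc : f h @[h --> 0^'+] --> f 0 by exact: cvg_at_right_filter.
  apply/cvgrPdist_lt => e e0; have /cvgrPdist_lt/(_ _ e0) := fc.
  by apply: filterS => h; rewrite sub0r normrN normr_id distrC.
have lR := l _ cR; have lI := l _ cI.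
apply: (@clim_squeeze _ _ (fun h => `|complex.Re (u h) - complex.Re (u 0)| +
  `|complex.Im (u h) - complex.Im (u 0)|)) => [h _|].
  by apply: le_trans (normc_le_ReIm _) _; rewrite !raddfB.
by rewrite -[X in _ --> X]addr0; exact: cvgD.
Qed.

End cut_off_limits.

(** * The function 1/(1 + i z_k), which divides amplitudes before integration by parts *)

Section resolvent.
Variables (R : realType) (p : nat) (k : 'I_p).
Local Notation ii := (0 +i* 1 : R[i]).

Let oneDi (x : R) : R[i] := 1 +i* x.

Definition resolvent (z : 'rV[R]_p) : R[i] := (1 +i* z 0 k)^-1.

Let oneDi_neq0 x : oneDi x != 0.
Proof. by rewrite eq_complex /= oner_eq0. Qed.

Let resolventE z : resolvent z = (1 + z 0 k ^+ 2)^-1%:C * (1 -i* z 0 (k)).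
Proof.
rewrite /resolvent; apply: (mulfI (oneDi_neq0 (z 0 k))); rewrite mulfV//.
set x := z 0 _; have x0 : 1 + x ^+ 2 != 0 by rewrite gt_eqF// ltr_pwDl// sqr_ge0.
apply/eqP; rewrite eq_complex /= !mul0r !subr0 !addr0; apply/andP; split; apply/eqP.
  by field.
by field.
Qed.

Lemma ccontinuous_resolvent : ccontinuous resolvent.
Proof.
have -> : resolvent = (fun z => (1 + z 0 k ^+ 2)^-1%:C * (1 -i* z 0 (k))).
  by apply/funext => z; exact: resolventE.
apply: ccontinuousM; split => /=; [|exact: cst_continuous|exact: cst_continuous|].
  apply: cont_inv; last by move=> z; rewrite gt_eqF// ltr_pwDl// sqr_ge0.
  apply: cont_add; first exact: cst_continuous.
  exact/cont_exp/coord_continuous.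
by apply: cont_opp; exact: coord_continuous.
Qed.

(** Computed from the real form (1 - i z_k)/(1 + z_k^2). The result being a multiple of the square,
    multiples of powers of the resolvent are stable under differentiation. *)
Lemma is_cderive_resolvent i : is_cderive i resolvent
  (fun z => (- ii * (i == k)%:R) * resolvent z * resolvent z).
Proof.
pose r (z : 'rV[R]_p) : R := (1 + z 0 k ^+ 2)^-1.
have s0 (z : 'rV[R]_p) : 1 + z 0 k ^+ 2 != 0 by rewrite gt_eqF// ltr_pwDl// sqr_ge0.
pose d : R := (i == k)%:R.
have rd z : is_derive z (delta_mx 0 i : 'rV[R]_p) r (- (2 * z 0 k * d) * r z ^+ 2).
  pose q : 'rV[R]_p -> R := cst 1 + (fun y : 'rV[R]_p => y 0 k) ^+ 2.
  have qd : is_derive z (delta_mx 0 i : 'rV[R]_p) q (2 * z 0 k * d).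
    have cd := @is_derive_coord R p i k z.
    by rewrite /q; apply: is_derive_eq; rewrite /d /GRing.scale /=; ring.
  have qE : q z = 1 + z 0 k ^+ 2 by [].
  have q0 : q z != 0 by rewrite qE.
  have [h1 h2] := qd.
  have -> : r = (fun y => (q y)^-1) by [].
  apply: DeriveDef; first exact: derivableV.
  by rewrite deriveV// h2 /r qE /GRing.scale /= exprVn; ring.
have rcd : is_cderive i (fun z => (r z)%:C) (fun z => (- (2 * z 0 k * d) * r z ^+ 2)%:C).
  by move=> z; split => /=; [exact: rd|exact: is_derive_cst].
have lcd : is_cderive i (fun z => 1 + (- ii) * coordc k z) (fun z => 0 + (0 * coordc k z + (- ii)
  * (i == k)%:R)).
  apply: is_cderiveD; first exact: is_cderive_cst.
  by apply: is_cderiveM; [exact: is_cderive_cst|exact: is_cderive_coordc].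
have gE z : resolvent z = (r z)%:C * (1 + (- ii) * coordc k z).
  rewrite resolventE; congr (_ * _); apply/eqP; rewrite eq_complex /=.
  by apply/andP; split; apply/eqP; ring.
have := is_cderiveM rcd lcd.
have -> : (fun z => (r z)%:C * (1 + (- ii) * coordc k z)) = resolvent.
  by apply/funext => z; rewrite gE.
congr is_cderive; apply/funext => z; rewrite gE.
have dE : (i == k)%:R = d%:C :> R[i] by rewrite /d; case: (i == k).
have i2 : ii * ii = -1 :> R[i].
  by apply/eqP; rewrite eq_complex /= !mul0r !mulr0 mulr1 sub0r addr0 oppr0 !eqxx.
have rE : (r z)%:C = (r z)%:C ^+ 2 * (1 + coordc k z ^+ 2).
  rewrite /coordc -!rmorphXn -[1]/(1%:C) -rmorphD -rmorphM /=; congr (_%:C).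
  by rewrite expr2 -mulrA mulVf ?mulr1.
rewrite dE rmorphM rmorphXn rmorphN !rmorphM /= -[(z 0 k)%:C]/(coordc k z).
rewrite -[2%:C]/(2%:R%:C) rmorph_nat [X in _ + X * _ = _]rE.
set x := coordc k z; set s := (r z)%:C; set e := d%:C.
have -> : - ii * e * (s * (1 + - ii * x)) * (s * (1 + - ii * x)) =
  - e * s ^+ 2 * (ii + 2 * x * - (ii * ii) + x ^+ 2 * ii * (ii * ii)) by ring.
by rewrite i2; ring.
Qed.

End resolvent.

(** * Amplitude classes graded by their growth in xi, and the oscillatory kernel *)

Section oscillatory_amplitudes.
Variables (R : realType) (T : Type) (gauge : T -> R).
Hypothesis gauge01 : forall t, 0 < gauge t <= 1.
Variables (n : nat) (neg : bool) (M : nat).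
Local Notation fam p := (T -> 'rV[R]_p -> R[i]).
Local Notation est := (est gauge).
Local Notation N := (n + (n + n))%N.
Local Notation ii := (0 +i* 1 : R[i]).

Local Notation ix k := (@lshift n (n + n) k).
Local Notation iy k := (@rshift n (n + n) (@lshift n n k)).
Local Notation ixi k := (@rshift n (n + n) (@rshift n n k)).
Local Notation px z := (lsubmx z).
Local Notation py z := (lsubmx (rsubmx z)).
Local Notation pxi z := (rsubmx (rsubmx z)).

Lemma omega_row_mx p q (a : 'rV[R]_p) (b : 'rV[R]_q) :
  omega (row_mx a b) = omega a * omega b.
Proof.
rewrite /omega big_split_ord /=; congr (_ * _); apply: eq_bigr => i _.
  by rewrite row_mxEl.
by rewrite row_mxEr.
Qed.

Lemma omega_submx p q (w : 'rV[R]_(p + q)) :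
  omega w = omega (lsubmx w) * omega (rsubmx w).
Proof. by rewrite -omega_row_mx hsubmxK. Qed.

(* Amplitudes are functions of z = (x, (y, xi)). *)
Definition amp_weight (tau : 'rV[R]_n -> R) (k : nat) (z : 'rV[R]_N) : R :=
  omega (px z) ^+ M * tau (pxi z) / omega (py z) ^+ k.

(** The power [M] of omega(x) is the same for all derivatives and the decay in y is of every order;
    [tau] alone, the growth in xi, changes in the course of regularisation. *)
Definition amp_class tau (b : fam N) :=
  hered (fun F => forall k, est neg F (amp_weight tau k)) b.

Lemma amp_weight_ge0 tau k z : (forall xi, 0 <= tau xi) -> 0 <= amp_weight tau k z.
Proof.
by move=> t0; rewrite /amp_weight !mulr_ge0 ?omegaX_ge0 ?omegaXV_ge0.
Qed.

Lemma amp_class_le tau tau' c b : 0 <= c -> (forall xi, tau xi <= c * tau' xi) ->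
  amp_class tau b -> amp_class tau' b.
Proof.
move=> c0 tt'; apply: hered_sub => F hF k; apply: (est_le gauge01 c0 _ (hF k)) => z.
rewrite /amp_weight !mulrA ler_wpM2r ?omegaXV_ge0// [c * _]mulrC -mulrA.
by rewrite ler_wpM2l ?omegaX_ge0.
Qed.

Lemma amp_classD tau F G : (forall xi, 0 <= tau xi) -> amp_class tau F -> amp_class tau G ->
  amp_class tau (fun t z => F t z + G t z).
Proof.
move=> t0; apply: heredD => {}F {}G hF hG k; apply: estD => // z.
exact: amp_weight_ge0.
Qed.

(** The growth of [A] in y costs [k] powers, which are recovered by using the decay of [b] at order
    [k + l]; only the growth [sigma] in xi leaves a trace. *)
Lemma amp_classM tau tau' sigma k A b : (forall xi, 0 <= tau' xi) ->
  (forall xi, sigma xi * tau xi <= tau' xi) ->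
  hered (fun F => est false F (fun z => sigma (pxi z) * omega (py z) ^+ k)) A ->
  amp_class tau b -> amp_class tau' (fun t z => A t z * b t z).
Proof.
move=> t0 st; apply: heredM => F G hF hG l; last first.
  by apply: estD => // z; exact: amp_weight_ge0.
have := estM gauge01 hF (hG (k + l)%N); apply: (est_le gauge01 ler01) => z.
rewrite mul1r /amp_weight exprD invfM.
rewrite [leLHS](_ : _ = omega (px z) ^+ M * (sigma (pxi z) * tau (pxi z)) *
  (omega (py z) ^+ k / omega (py z) ^+ k) / omega (py z) ^+ l); last by ring.
rewrite mulfV ?mulr1; last by rewrite gt_eqF ?omegaX_gt0.
by rewrite ler_wpM2r ?omegaXV_ge0// ler_wpM2l ?omegaX_ge0.
Qed.

Lemma amp_classZ tau c b : (forall xi, 0 <= tau xi) -> amp_class tau b ->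
  amp_class tau (fun t z => c * b t z).
Proof.
move=> t0; apply: (@amp_classM tau tau (fun=> 1) 0 (fun _ _ => c)) => //.
  by move=> xi; rewrite mul1r.
have e (d : R[i]) : est false (fun _ _ => d) (fun z : 'rV[R]_N => 1 * omega (py z) ^+ 0).
  apply: (@est_const R T gauge N (fun=> d) _ (normc d)); first exact: normc_ge0.
  by move=> x; rewrite expr0 !mulr1.
exact: hered_cst.
Qed.

Lemma amp_class_xi tau tau' j b : (forall xi, 0 <= tau' xi) ->
  (forall xi, omega xi * tau xi <= tau' xi) -> amp_class tau b ->
  amp_class tau' (fun t z => coordc (ixi j) z * b t z).
Proof.
move=> t0 st; apply: (@amp_classM tau tau' (@omega R n) 0 (fun _ => coordc (ixi j))) => //.
apply: hered_coordc => z; first by rewrite expr0 mulr1 omega_ge1.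
rewrite expr0 mulr1; apply: le_trans (norm_coord_le_omega (pxi z) j).
by rewrite !mxE.
Qed.

Lemma amp_class_y tau j b : (forall xi, 0 <= tau xi) -> amp_class tau b ->
  amp_class tau (fun t z => coordc (iy j) z * b t z).
Proof.
move=> t0; apply: (@amp_classM tau tau (fun=> 1) 1 (fun _ => coordc (iy j))) => //.
  by move=> xi; rewrite mul1r.
apply: hered_coordc => z; first by rewrite mul1r expr1 omega_ge1.
rewrite mul1r expr1; apply: le_trans (norm_coord_le_omega (py z) j).
by rewrite !mxE.
Qed.

(** The gain of a single integration by parts in y_j. The product over j of the squares is
    omega(xi), which links these gains to the integrable weight. *)
Definition japj j (xi : 'rV[R]_n) : R := normc (1 +i* xi 0 j).

Lemma japj_gt0 j xi : 0 < japj j xi.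
Proof. by rewrite /japj /= sqrtr_gt0 expr1n ltr_pwDl// sqr_ge0. Qed.

Lemma japj_sqr j xi : japj j xi ^+ 2 = 1 + xi 0 j ^+ 2.
Proof. by rewrite /japj /= sqr_sqrtr expr1n// addr_ge0// sqr_ge0. Qed.

Lemma normc_resolvent j z : normc (resolvent (ixi j) z) = (japj j (pxi z))^-1.
Proof. by rewrite /resolvent normcV /japj !mxE. Qed.

Lemma japj_ge1 j xi : 1 <= japj j xi.
Proof.
rewrite /japj /= -[leLHS]sqrtr1; apply: ler_wsqrtr.
by rewrite expr1n lerDl sqr_ge0.
Qed.

Lemma japj_le_omega j xi : japj j xi <= omega xi.
Proof.
apply: le_trans (oneDsqr_le_omega xi j); rewrite -japj_sqr expr2.
by rewrite ler_peMr ?japj_ge1// ltW// japj_gt0.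
Qed.

(** Every derivative is a constant times a power of the resolvent of exponent at least 1. As its
    modulus is at most 1, all these powers are bounded by the first. *)
Lemma hered_resolvent j : hered (fun F => est false F (fun z => (japj j (pxi z))^-1))
  (fun _ => resolvent (ixi j)).
Proof.
apply: (@hered_coind R T N _ (fun F => exists (c : R[i]) k,
  F = fun _ z => c * resolvent (ixi j) z ^+ k.+1)); last first.
  exists 1, 0%N; apply/funext => t; apply/funext => z.
  by rewrite mul1r expr1.
move=> _ [c [k ->]].
have dpow m i : is_cderive i (fun z : 'rV[R]_N => resolvent (ixi j) z ^+ m.+1)
   (fun z => m.+1%:R * (- ii * (i == ixi j)%:R) * resolvent (ixi j) z ^+ m.+2).
  elim: m => [|m ih].
    have := @is_cderive_resolvent R N (ixi j) i.
    have -> : (fun z : 'rV[R]_N => resolvent (ixi j) z ^+ 1) = resolvent (ixi j).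
      by apply/funext => z; rewrite expr1.
    by move=> h; apply: (is_cderive_ext _ _ h) => z; rewrite ?expr2//; ring.
  apply: (is_cderive_ext _ _ (is_cderiveM (is_cderive_resolvent (ixi j) i) ih)) => z.
    by rewrite [RHS]exprS.
  by rewrite -[m.+2%:R]natr1 !exprS; ring.
have cpow m : ccontinuous (fun z : 'rV[R]_N => resolvent (ixi j) z ^+ m.+1).
  elim: m => [|m ih].
    have -> : (fun z : 'rV[R]_N => resolvent (ixi j) z ^+ 1) = resolvent (ixi j).
      by apply/funext => z; rewrite expr1.
    exact: ccontinuous_resolvent.
  have -> : (fun z : 'rV[R]_N => resolvent (ixi j) z ^+ m.+2) =
     (fun z => resolvent (ixi j) z * resolvent (ixi j) z ^+ m.+1).
    by apply/funext => z; rewrite exprS.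
  by apply: ccontinuousM ih; exact: ccontinuous_resolvent.
split.
- by move=> t; apply: ccontinuousM; [exact: ccontinuous_cst|exact: cpow].
- apply: (@est_const R T gauge N _ _ (normc c)); first exact: normc_ge0.
  move=> z; rewrite normcM ler_wpM2l ?normc_ge0//.
  have nX m : normc (resolvent (ixi j) z ^+ m) = (japj j (pxi z))^-1 ^+ m.
    elim: m => [|m ih]; first by rewrite !expr0; exact: normc1.
    by rewrite !exprS normcM ih normc_resolvent.
  have j0 : 0 <= (japj j (pxi z))^-1 by rewrite invr_ge0 ltW ?japj_gt0.
  rewrite nX exprS ler_piMr//; apply: exprn_ile1 => //.
  by rewrite invf_le1 ?japj_gt0 ?japj_ge1.
- move=> i; exists (fun _ z => (c * (k.+1%:R * (- ii * (i == ixi j)%:R))) * resolvent (ixi j) z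
  ^+ k.+2).
    move=> t; have := is_cderiveM (@is_cderive_cst R N i c) (dpow k i).
    by move=> h; apply: (is_cderive_ext _ _ h) => // z; rewrite mul0r add0r !mulrA.
  by exists (c * (k.+1%:R * (- ii * (i == ixi j)%:R))), k.+1.
Qed.

Lemma amp_class_resolvent tau j b : (forall xi, 0 <= tau xi) ->
  amp_class (fun xi => japj j xi * tau xi) b ->
  amp_class tau (fun t z => resolvent (ixi j) z * b t z).
Proof.
move=> t0; apply: (@amp_classM _ tau (fun xi => (japj j xi)^-1) 0 (fun _ => resolvent (ixi j)))
  => //.
  by move=> xi; rewrite mulrA mulVf ?mul1r// gt_eqF ?japj_gt0.
have := hered_resolvent j; congr hered; apply/funext => F; congr est.
by apply/funext => z; rewrite expr0 mulr1.
Qed.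

Definition osc_kernel (z : 'rV[R]_N) : R[i] :=
  phase (fun k => ix k) (fun k => ixi k) 1 z * phase (fun k => iy k) (fun k => ixi k) (-1) z.
Local Notation E := osc_kernel.

Lemma osc_kernelE x w :
  E (row_mx x w) = expi (dotv (x - lsubmx w) (rsubmx w)).
Proof.
rewrite /E /phase -expiD mul1r mulN1r -sumrB; congr expi.
apply: eq_bigr => k _; rewrite row_mxEl !row_mxEr !mxE; ring.
Qed.

Lemma normc_osc_kernel z : normc (E z) = 1.
Proof. by rewrite normcM !normc_expi mulr1. Qed.

Lemma ccontinuous_osc_kernel : ccontinuous E.
Proof. by apply: ccontinuousM; exact: ccontinuous_phase. Qed.

Let mulii (a : R) : 0 +i* (1 * a) = ii * a%:C.
Proof. by apply/eqP; rewrite eq_complex /=; apply/andP; split; apply/eqP; ring. Qed.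

Let mulNii (a : R) : 0 +i* (-1 * a) = - ii * a%:C.
Proof. by apply/eqP; rewrite eq_complex /=; apply/andP; split; apply/eqP; ring. Qed.

Let muli0 (s : R) : 0 +i* (s * 0) = 0 :> R[i].
Proof. by rewrite mulr0. Qed.

Let ixiI : injective (fun k : 'I_n => ixi k).
Proof. by move=> k l /rshift_inj /rshift_inj. Qed.

Let iyI : injective (fun k : 'I_n => iy k).
Proof. by move=> k l /rshift_inj /lshift_inj. Qed.

Lemma osc_kernel_dx j : is_cderive (ix j) E (fun z => ii * coordc (ixi j) z * E z).
Proof.
have := is_cderiveM (@is_cderive_phase R N n (fun k => ix k) (fun k => ixi k) (ix j) 1)
  (@is_cderive_phase R N n (fun k => iy k) (fun k => ixi k) (ix j) (-1)).
move=> h; apply: (is_cderive_ext _ _ h) => // z.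
rewrite dbilinl; [|exact: lshift_inj|by move=> k; rewrite eq_lrshift].
rewrite dbilin0; [|by move=> k; rewrite eq_lrshift|by move=> k; rewrite eq_lrshift].
by rewrite mulii muli0 /E /coordc; ring.
Qed.

Lemma osc_kernel_dy j : is_cderive (iy j) E (fun z => - ii * coordc (ixi j) z * E z).
Proof.
have := is_cderiveM (@is_cderive_phase R N n (fun k => ix k) (fun k => ixi k) (iy j) 1)
  (@is_cderive_phase R N n (fun k => iy k) (fun k => ixi k) (iy j) (-1)).
move=> h; apply: (is_cderive_ext _ _ h) => // z.
rewrite dbilin0; [|by move=> k; rewrite eq_rlshift|by move=> k; rewrite eq_rshift eq_lrshift].
rewrite (@dbilinl R N n (fun k => iy k) (fun k => ixi k) j); [|exact: iyI|by move=> k;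
  rewrite eq_rshift eq_lrshift].
by rewrite mulNii muli0 /E /coordc; ring.
Qed.

Lemma osc_kernel_dxi j : is_cderive (ixi j) E
  (fun z => ii * (coordc (ix j) z - coordc (iy j) z) * E z).
Proof.
have := is_cderiveM (@is_cderive_phase R N n (fun k => ix k) (fun k => ixi k) (ixi j) 1)
  (@is_cderive_phase R N n (fun k => iy k) (fun k => ixi k) (ixi j) (-1)).
move=> h; apply: (is_cderive_ext _ _ h) => // z.
rewrite (@dbilinr R N n (fun k => ix k) (fun k => ixi k) j); [|exact: ixiI|by move=> k;
  rewrite eq_rlshift].
rewrite (@dbilinr R N n (fun k => iy k) (fun k => ixi k) j); [|exact: ixiI|by move=> k;
  rewrite eq_rshift eq_rlshift].
by rewrite mulNii mulii /E /coordc; ring.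
Qed.

End oscillatory_amplitudes.

(** * Schwartz cut-off functions and their rescalings *)

Section cut_offs.
Variable R : realType.

(** Schwartz functions seen as families over a one-point index set, so that the stability results
    for families apply to them; [schwartz_cut_off] and [cut_off_schwartz] give the equivalence with
    [schwartz]. *)
Definition cut_off p (psi : 'rV[R]_p -> R[i]) :=
  schwartz_fam (fun _ : unit => 1 : R) false (fun _ => psi).

Lemma cut_off_le p (psi : 'rV[R]_p -> R[i]) k : cut_off psi ->
  exists2 C, 0 <= C & forall w, normc (psi w) <= C / omega w ^+ k.
Proof.
move=> /hered_self/(_ k) /est_at h; apply: (h _ tt) => _.
by rewrite ltr01 lexx.
Qed.

Lemma cut_off_ccontinuous p (psi : 'rV[R]_p -> R[i]) : cut_off psi -> ccontinuous psi.
Proof. by move=> /(hered_smooth tt); exact: smooth_ccontinuous. Qed.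

Lemma cut_off_partial p (psi : 'rV[R]_p -> R[i]) i :
  cut_off psi -> cut_off (cpartial i psi).
Proof. exact: hered_partial. Qed.

Lemma omega_scale p (x : 'rV[R]_p) (h : R) : 0 < h ->
  omega x <= (1 + h ^- 2) ^+ p * omega (h *: x).
Proof.
move=> h0; have -> : (1 + h ^- 2) ^+ p = \prod_(i < p) (1 + h ^- 2).
  by rewrite prodr_const card_ord.
rewrite /omega -big_split /=; apply: ler_prod => i _.
rewrite addr_ge0 ?sqr_ge0//= !mxE.
have -> : (1 + h ^- 2) * (1 + (h * x 0 i) ^+ 2) =
  1 + x 0 i ^+ 2 + (h ^- 2 + (h * x 0 i) ^+ 2).
  by field; rewrite gt_eqF.
by rewrite lerDl addr_ge0 ?sqr_ge0// invr_ge0 sqr_ge0.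
Qed.

(** The constant degenerates as h tends to 0. The bound serves to make the regularised integral at a
    fixed h absolutely convergent, not to pass to the limit. *)
Lemma cut_off_scale_le p (psi : 'rV[R]_p -> R[i]) k h : cut_off psi -> 0 < h ->
  exists2 C, 0 <= C & forall w, normc (psi (h *: w)) <= C / omega w ^+ k.
Proof.
move=> hpsi h0; have [C C0 hC] := cut_off_le k hpsi.
have c0 : 0 < 1 + h ^- 2 by rewrite ltr_pwDl// invr_ge0 sqr_ge0.
exists (C * (1 + h ^- 2) ^+ p ^+ k).
  by rewrite mulr_ge0// !exprn_ge0// ltW.
move=> w; apply: le_trans (hC _) _; rewrite -mulrA ler_wpM2l//.
rewrite -[leLHS]mul1r ler_pdivrMr ?omegaX_gt0// mulrAC ler_pdivlMr ?omegaX_gt0//.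
rewrite mul1r -exprMn; apply: lerXn2r; rewrite ?nnegrE ?mulr_ge0 ?(ltW (omega_gt0 _))//.
  by rewrite exprn_ge0// ltW.
exact: omega_scale.
Qed.

End cut_offs.

(** * Regularised integrals: the absolutely convergent case and one integration by parts *)

Section regularized_integrals.
Variables (R : realType) (n M : nat).
Local Notation N := (n + (n + n))%N.
Local Notation ii := (0 +i* 1 : R[i]).
Local Notation iy k := (@rshift n (n + n) (@lshift n n k)).
Local Notation ixi k := (@rshift n (n + n) (@rshift n n k)).
Local Notation E := (@osc_kernel R n).
Implicit Types (b : 'rV[R]_N -> R[i]) (psi : 'rV[R]_(n + n) -> R[i]).

Definition amp_bounded tau b := ccontinuous b /\
  forall k, exists2 C, 0 <= C & forall z, normc (b z) <= C * amp_weight M tau k z.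

Definition reg_integrand b psi (h : R) (z : 'rV[R]_N) : R[i] :=
  E z * b z * psi (h *: rsubmx z).

Definition osc_integral b : 'rV[R]_n -> R[i] := fiber_integral (fun z => E z * b z).

(** The cut-off is not normalised at 0, because integration by parts also introduces its partial
    derivatives, whose value at 0 is arbitrary; hence the factor [psi 0]. *)
Definition osc_converges b (f : 'rV[R]_n -> R[i]) := forall psi, cut_off psi ->
  forall x, clim (fun h => fiber_integral (reg_integrand b psi h) x) (psi 0 * f x).

Lemma continuous_scale_rsub (h : R) : continuous (fun z : 'rV[R]_N => h *: rsubmx z).
Proof.
apply: continuous_rV => i.
have -> : (fun z : 'rV[R]_N => (h *: rsubmx z) 0 i) = (fun z => cst h z * z 0 (rshift n i)).
  by apply/funext => z; rewrite !mxE.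
by apply: cont_mul; [exact: cst_continuous|exact: coord_continuous].
Qed.

Lemma ccontinuous_reg_integrand b psi h : ccontinuous b -> ccontinuous psi ->
  ccontinuous (reg_integrand b psi h).
Proof.
move=> cb cpsi; apply: ccontinuousM.
  by apply: ccontinuousM => //; exact: ccontinuous_osc_kernel.
by apply: ccontinuous_comp cpsi; exact: continuous_scale_rsub.
Qed.

Lemma reg_integrand_bounded tau J b psi h :
  (forall xi, tau xi <= omega xi ^+ J) -> amp_bounded tau b ->
  cut_off psi -> 0 < h ->
  exists2 C, 0 <= C & fiber_bounded (reg_integrand b psi h) (fun x => C * omega x ^+ M).
Proof.
move=> tauJ [cb hb] hpsi h0.
(* Of the [J.+1] powers of decay of the cut-off, [J] compensate the growth of [tau] and one is left
   for integrability in (y, xi). *)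
have [C C0 {}hb] := hb 0%N; have [D D0 hD] := cut_off_scale_le J.+1 hpsi h0.
exists (C * D); first exact: mulr_ge0.
split; first by apply: ccontinuous_reg_integrand => //; exact: cut_off_ccontinuous.
move=> x w; rewrite /reg_integrand 2!normcM normc_osc_kernel mul1r row_mxKr.
apply: le_trans (ler_pM (normc_ge0 _) (normc_ge0 _) (hb _) (hD _)) _.
rewrite /amp_weight row_mxKl row_mxKr expr0 divr1 exprS invfM.
rewrite [leLHS](_ : _ = C * D * omega x ^+ M / omega w * (tau (rsubmx w) / omega w ^+ J));
  last by ring.
rewrite -[leRHS]mulr1 ler_wpM2l//.
  by rewrite !mulr_ge0 ?omegaX_ge0 ?invr_ge0 ?(ltW (omega_gt0 _)).
rewrite ler_pdivrMr ?omegaX_gt0// mul1r.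
apply: le_trans (tauJ _) _; apply: lerXn2r; rewrite ?nnegrE ?(ltW (omega_gt0 _))//.
by rewrite (omega_submx w) ler_peMl ?omega_ge1// ltW// omega_gt0.
Qed.

Let omegaV_fiber b C : ccontinuous b ->
  (forall z, normc (b z) <= C * amp_weight M (fun xi => (omega xi)^-1) 1 z) ->
  fiber_bounded (fun z => E z * b z) (fun x => C * omega x ^+ M).
Proof.
move=> cb hb; split; first by apply: ccontinuousM => //; exact: ccontinuous_osc_kernel.
move=> x w; cbv beta; rewrite normcM normc_osc_kernel mul1r; apply: le_trans (hb _) _.
rewrite /amp_weight row_mxKl row_mxKr expr1 !mulrA -mulrA -invfM mulrC.
by rewrite (omega_submx w) [omega (rsubmx w) * _]mulrC mulrC.
Qed.

Lemma osc_integral_bounded b : amp_bounded (fun xi => (omega xi)^-1) b ->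
  exists2 C, 0 <= C & fiber_bounded (fun z => E z * b z) (fun x => C * omega x ^+ M).
Proof.
by move=> [cb /(_ 1%N)[C C0 hb]]; exists C => //; exact: omegaV_fiber.
Qed.

(** The integrand is dominated uniformly in h, since psi is bounded, so the regularised integral is
    continuous up to h = 0, where the cut-off is the constant [psi 0]. *)
Lemma osc_converges_omegaV b : amp_bounded (fun xi => (omega xi)^-1) b ->
  osc_converges b (osc_integral b).
Proof.
move=> hb psi hpsi x; have [C C0 bC] := osc_integral_bounded hb.
have [cb _] := hb; have cpsi := cut_off_ccontinuous hpsi.
have [D D0 hD] := cut_off_le 0 hpsi.
have bnd h w : normc (reg_integrand b psi h (row_mx x w)) <= (C * omega x ^+ M * D) / omega w.
  rewrite normcM [leRHS]mulrAC; apply: ler_pM; rewrite ?normc_ge0//; first by have [_ bw] := bC;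
    exact: bw.
  by apply: le_trans (hD _) _; rewrite expr0 invr1 mulr1.
have -> : psi 0 * osc_integral b x = fiber_integral (reg_integrand b psi 0) x.
  rewrite /osc_integral /fiber_integral -cintegralZ; last exact: fiber_dominated bC.
  by congr cintegral; apply/funext => w; rewrite /reg_integrand scale0r mulrC.
have creg h : ccontinuous (fun w => reg_integrand b psi h (row_mx x w)).
  apply: (ccontinuous_comp (@continuous_row_mx R _ _ x)).
  exact: ccontinuous_reg_integrand.
have hcont w : ccontinuous (fun h : R => reg_integrand b psi h (row_mx x w)).
  apply: ccontinuousM; first exact: ccontinuous_cst.
  rewrite row_mxKr; apply: ccontinuous_comp cpsi.
  apply: continuous_rV => i.
  have -> : (fun h : R => (h *: w) 0 i) = (fun h => h * cst (w 0 i) h).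
    by apply/funext => h; rewrite !mxE.
  by apply: cont_mul; [move=> ?; exact: cvg_id|exact: cst_continuous].
apply: continuous_clim.
- apply: (@continuous_integ R R _ (fun h w => complex.Re (reg_integrand b psi h (row_mx x w))) 0
  (C * omega x ^+ M * D)).
  + by move=> h; have [] := creg h.
  + by near=> h => w; exact: le_trans (ler_Re_normc _) (bnd h w).
  + by move=> w; have [cw _] := hcont w; exact: cw.
- apply: (@continuous_integ R R _ (fun h w => complex.Im (reg_integrand b psi h (row_mx x w))) 0
  (C * omega x ^+ M * D)).
  + by move=> h; have [] := creg h.
  + by near=> h => w; exact: le_trans (ler_Im_normc _) (bnd h w).
  + by move=> w; have [_ cw] := hcont w; exact: cw.
Unshelve. all: by end_near. Qed.

Lemma amp_boundedD tau b b' : (forall xi, 0 <= tau xi) -> amp_bounded tau b ->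
  amp_bounded tau b' -> amp_bounded tau (fun z => b z + b' z).
Proof.
move=> t0 [cb hb] [cb' hb']; split; first exact: ccontinuousD.
move=> k; have [C C0 {}hb] := hb k; have [D D0 {}hb'] := hb' k.
exists (C + D); first exact: addr_ge0.
by move=> z; rewrite mulrDl; apply: le_trans (le_normcD _ _) (lerD (hb z) (hb' z)).
Qed.

Lemma scale_rsub_row_mx (h : R) j (e : R) (z : 'rV[R]_N) :
  h *: rsubmx (e *: delta_mx 0 (rshift n j) + z) =
  e *: (h *: delta_mx 0 j) + h *: rsubmx z.
Proof.
apply/rowP => l; rewrite !mxE /= eq_rshift; ring.
Qed.

(** For each h > 0 the integral of [b] with cut-off psi equals that of [b1 + db1] with psi plus h
    times that of [b1] with a derivative of psi. Convergence for [b1] is assumed only so that the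
    last integral has a limit; its value [g] is then killed by h. *)
Lemma osc_converges_xi J tau tau' j b b1 db1 f g :
  (forall xi, 0 <= tau xi <= omega xi ^+ J) ->
  (forall xi, tau' xi <= omega xi ^+ J) ->
  amp_bounded tau' b -> amp_bounded tau b1 -> amp_bounded tau db1 ->
  is_cderive (iy j) b1 db1 ->
  (forall z, b z = (1 + ii * coordc (ixi j) z) * b1 z) ->
  osc_converges (fun z => b1 z + db1 z) f -> osc_converges b1 g ->
  osc_converges b f.
Proof.
move=> tauJ tauJ' hb hb1 hdb1 db bE convf convg psi hpsi x.
have t0 xi : 0 <= tau xi by case/andP: (tauJ xi).
have {}tauJ xi : tau xi <= omega xi ^+ J by case/andP: (tauJ xi).
pose dpsi := cpartial (lshift n j) psi.
have hdpsi : cut_off dpsi by exact: cut_off_partial.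
have hs := amp_boundedD t0 hb1 hdb1.
apply: (@clim_ext _ _ (fun h => fiber_integral (reg_integrand (fun z => b1 z + db1 z) psi h) x +
   h%:C * fiber_integral (reg_integrand b1 dpsi h) x)); last first.
  rewrite -[_ * f x]addr0; apply: climD; first exact: convf.
  by apply: clim_small; exact: convg.
move=> h h0.
(* This is the y_j-derivative of the regularised integrand of [b1]. Its first term is, up to the
   integrand of [b1] itself, minus the integrand of [b]. *)
pose dc z := - ii * coordc (ixi j) z * E z * b1 z * psi (h *: rsubmx z) +
   (E z * db1 z * psi (h *: rsubmx z) + E z * b1 z * (h%:C * dpsi (h *: rsubmx z))).
have dom a s sigma : (forall xi, sigma xi <= omega xi ^+ J) -> amp_bounded sigma a -> cut_off s ->
    cdominated (fun w => reg_integrand a s h (row_mx x w)).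
  move=> sJ ha hs'; have [C _] := reg_integrand_bounded sJ ha hs' h0.
  exact: fiber_dominated.
have d1 := dom _ _ _ tauJ hs hpsi.
have d2 := dom _ _ _ tauJ hb1 hdpsi.
have d3 := dom _ _ _ tauJ' hb hpsi.
have d4 := dom _ _ _ tauJ hb1 hpsi.
have dcE z : dc z = reg_integrand (fun z => b1 z + db1 z) psi h z +
    h%:C * reg_integrand b1 dpsi h z + -1 * reg_integrand b psi h z.
  by rewrite /dc /reg_integrand bE; ring.
have d5 : cdominated (fun w => dc (row_mx x w)).
  have -> : (fun w => dc (row_mx x w)) = (fun w =>
     (reg_integrand (fun z => b1 z + db1 z) psi h (row_mx x w) +
     h%:C * reg_integrand b1 dpsi h (row_mx x w)) + -1 * reg_integrand b psi h (row_mx x w)).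
    by apply/funext => w; exact: dcE.
  by apply: cdominatedD; [apply: cdominatedD => //; exact: cdominatedZ|exact: cdominatedZ].
have i0 : fiber_integral dc x = 0.
  apply: (@fiber_integral_partial R _ _ (reg_integrand b1 psi h) dc (lshift n j)) => //.
  have dpsiE : is_cderive (iy j) (fun z => psi (h *: rsubmx z))
     (fun z => h%:C * dpsi (h *: rsubmx z)).
    apply: (@is_cderive_affine R _ _ (fun z => h *: rsubmx z) _ (lshift n j)).
      by move=> e z; exact: scale_rsub_row_mx.
    by apply: smooth_is_cderive; exact: (hered_smooth tt hpsi).
  apply: (is_cderive_ext _ _ (is_cderiveM (is_cderiveM (osc_kernel_dy j) db) dpsiE)) => // z.
  by rewrite /dc; ring.
have -> : fiber_integral (reg_integrand b psi h) x =
   fiber_integral (fun z => (reg_integrand (fun z => b1 z + db1 z) psi h z +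
    h%:C * reg_integrand b1 dpsi h z) + -1 * dc z) x.
  by congr cintegral; apply/funext => w; rewrite dcE; ring.
rewrite /fiber_integral cintegralD; last first.
- exact: cdominatedZ.
- by apply: cdominatedD => //; exact: cdominatedZ.
rewrite cintegralD//; last exact: cdominatedZ.
by rewrite !cintegralZ// -[cintegral (fun w => dc _)]/(fiber_integral dc x) i0 mulr0 addr0.
Qed.

End regularized_integrals.

(** * Regularisation of oscillatory integrals and the Schwartz property of the result *)

Section oscillatory_convergence.
Variables (R : realType) (T : Type) (gauge : T -> R).
Hypothesis gauge01 : forall t, 0 < gauge t <= 1.
Variables (n : nat) (neg : bool) (M : nat).
Local Notation N := (n + (n + n))%N.
Local Notation ii := (0 +i* 1 : R[i]).
Local Notation ix k := (@lshift n (n + n) k).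
Local Notation iy k := (@rshift n (n + n) (@lshift n n k)).
Local Notation ixi k := (@rshift n (n + n) (@rshift n n k)).
Local Notation amp_class := (@amp_class R T gauge n neg M).
Local Notation omegaV2 := (fun xi : 'rV[R]_n => omega xi ^- 2).

Lemma amp_class_bounded tau b t : amp_class tau b -> amp_bounded M tau (b t).
Proof.
move=> hb; split; first exact: smooth_ccontinuous (hered_smooth t hb).
by move=> k; have /(_ k)/(est_at gauge01) := hered_self hb; apply.
Qed.

(** The replacement [b0] is a family of the same moderate or negligible type, so uniformity in eps
    survives. Its weight is omega^-2, so that multiplying it by xi_j still leaves the integrable
    omega^-1. *)
Definition oscillates tau := forall b, amp_class tau b ->
  exists2 b0, amp_class omegaV2 b0 & forall t, osc_converges (b t) (osc_integral (b0 t)).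

Lemma amp_class_omegaV b : amp_class omegaV2 b -> amp_class (fun xi => (omega xi)^-1) b.
Proof.
apply: (amp_class_le gauge01 ler01) => xi; rewrite mul1r lef_pV2 ?posrE ?omegaX_gt0 ?omega_gt0//.
by rewrite expr2 ler_peMr ?omega_ge1// ltW// omega_gt0.
Qed.

Lemma oscillates_omegaV2 : oscillates omegaV2.
Proof.
move=> b hb; exists b => // t; apply: osc_converges_omegaV.
exact: amp_class_bounded (amp_class_omegaV hb).
Qed.

Lemma oscillates_japj J tau j : (forall xi, 0 <= tau xi <= omega xi ^+ J) ->
  oscillates tau -> oscillates (fun xi => japj j xi * tau xi).
Proof.
move=> tauJ otau b hb.
have t0 xi : 0 <= tau xi by case/andP: (tauJ xi).
have t1 xi : tau xi <= omega xi ^+ J by case/andP: (tauJ xi).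
have hb1 := amp_class_resolvent gauge01 t0 hb.
pose b1 t z := resolvent (ixi j) z * b t z.
have hdb1 : amp_class tau (fun t => cpartial (iy j) (b1 t)) by exact: hered_partial.
have [b0 hb0 ob0] := otau _ (amp_classD gauge01 t0 hb1 hdb1).
(* Only the existence of a limit for [b1] matters here, to make the term with the factor h
   disappear. *)
have [b2 _ ob2] := otau _ hb1.
exists b0 => [|t]; first exact: hb0.
apply: (@osc_converges_xi R n M J.+1 tau (fun xi => japj j xi * tau xi) j (b t) (b1 t)
  (cpartial (iy j) (b1 t)) _ (osc_integral (b2 t))).
- move=> xi; rewrite t0/= (le_trans (t1 xi))// exprS ler_peMl ?omegaX_ge0//.
  exact: omega_ge1.
- move=> xi; rewrite exprS; apply: ler_pM => //; first by rewrite ltW ?japj_gt0.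
  exact: japj_le_omega.
- exact: (amp_class_bounded t hb).
- exact: (amp_class_bounded t hb1).
- exact: (amp_class_bounded t hdb1).
- by apply: smooth_is_cderive; exact: (hered_smooth t hb1).
- move=> z; rewrite /b1 /resolvent mulrA.
  have -> : 1 + ii * coordc (ixi j) z = 1 +i* z 0 (ixi j).
    by apply/eqP; rewrite eq_complex /=; apply/andP; split; apply/eqP; ring.
  by rewrite mulfV ?mul1r// eq_complex /= oner_eq0.
- exact: ob0.
- exact: ob2.
Qed.

Lemma oscillates_prod J s tau : (forall xi, 0 <= tau xi <= omega xi ^+ J) ->
  oscillates tau -> oscillates (fun xi => (\prod_(j <- s) japj j xi) * tau xi).
Proof.
move=> tauJ otau; elim: s => [|j s ih].
  by have -> : (fun xi => (\prod_(j <- [::]) japj j xi) * tau xi) = tau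
    by apply/funext => xi; rewrite big_nil mul1r.
have -> : (fun xi => (\prod_(i <- j :: s) japj i xi) * tau xi) =
    (fun xi => japj j xi * ((\prod_(i <- s) japj i xi) * tau xi)).
  by apply/funext => xi; rewrite big_cons mulrA.
apply: (@oscillates_japj (size s + J)) => // xi; have /andP[t0 t1] := tauJ xi.
have p0 : 0 <= \prod_(i <- s) japj i xi.
  by apply: prodr_ge0 => i _; rewrite ltW ?japj_gt0.
rewrite mulr_ge0//= exprD ler_pM//; elim: s {ih p0} => [|i s ih].
  by rewrite big_nil expr0.
rewrite big_cons /= exprS; apply: ler_pM => //; first by rewrite ltW ?japj_gt0.
  by apply: prodr_ge0 => k _; rewrite ltW ?japj_gt0.
exact: japj_le_omega.
Qed.

Lemma oscillates_omegaX k : oscillates (fun xi => omega xi ^+ k * omega xi ^- 2).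
Proof.
elim: k => [|k ih].
  have -> : (fun xi : 'rV[R]_n => omega xi ^+ 0 * omega xi ^- 2) = omegaV2.
    by apply/funext => xi; rewrite expr0 mul1r.
  exact: oscillates_omegaV2.
(* Each coordinate occurs twice because omega is the product of the squares of the [japj]: one power
   of omega costs 2n integrations by parts. *)
have -> : (fun xi : 'rV[R]_n => omega xi ^+ k.+1 * omega xi ^- 2) = (fun xi =>
   (\prod_(j <- index_enum 'I_n ++ index_enum 'I_n) japj j xi) * (omega xi ^+ k * omega xi ^- 2)).
  apply/funext => xi; rewrite exprS -mulrA; congr (_ * _).
  rewrite big_cat /= -big_split /omega /=; apply: eq_bigr => j _.
  by rewrite -japj_sqr expr2.
apply: (@oscillates_prod k) ih => xi.
rewrite mulr_ge0 ?omegaX_ge0 ?omegaXV_ge0//= -[leRHS]mulr1 ler_wpM2l ?omegaX_ge0//.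
by rewrite invf_le1 ?omegaX_gt0// -(expr1n _ 2) lerXn2r ?nnegrE ?omega_ge1// ltW// omega_gt0.
Qed.

Lemma oscillates_omega k : oscillates (fun xi => omega xi ^+ k).
Proof.
have -> : (fun xi : 'rV[R]_n => omega xi ^+ k) = (fun xi => omega xi ^+ k.+2 * omega xi ^- 2).
  by apply/funext => xi; rewrite -addn2 exprD mulfK// gt_eqF ?omegaX_gt0.
exact: oscillates_omegaX.
Qed.

Lemma oscillates_omegaV : oscillates (fun xi => (omega xi)^-1).
Proof.
have -> : (fun xi : 'rV[R]_n => (omega xi)^-1) = (fun xi => omega xi ^+ 1 * omega xi ^- 2).
  by apply/funext => xi; rewrite expr1 expr2 invfM mulrA mulfV ?mul1r// gt_eqF ?omega_gt0.
exact: oscillates_omegaX.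
Qed.

Lemma osc_converges_unique (b : 'rV[R]_N -> R[i]) f g (psi : 'rV[R]_(n + n) -> R[i]) : cut_off
  psi -> psi 0 = 1 ->
  osc_converges b f -> osc_converges b g -> f = g.
Proof.
move=> hpsi psi0 /(_ _ hpsi) bf /(_ _ hpsi) bg; apply/funext => x.
by have := clim_unique (bf x) (bg x); rewrite psi0 !mul1r.
Qed.

(** Per coordinate, |a| <= 1 gives 1 + (a + c)^2 <= 1 + 2 a^2 + 2 c^2 <= 3 (1 + c^2). This bounds
    omega on the segments used to differentiate under the integral. *)
Lemma omega_shift_le p (x : 'rV[R]_p) j (h : R) : `|h| < 1 ->
  omega (h *: delta_mx 0 j + x) <= 3 ^+ p * omega x.
Proof.
move=> h1; have -> : 3 ^+ p = \prod_(i < p) (3 : R) by rewrite prodr_const card_ord.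
rewrite /omega -big_split /=; apply: ler_prod => i _.
rewrite addr_ge0 ?sqr_ge0//= !mxE /=; set e : R := (i == j)%:R.
have : (h * e) ^+ 2 <= 1.
  rewrite -real_normK ?num_real// normrM expr_le1 ?mulr_ge0//.
  have e1 : `|e| <= 1 by rewrite /e; case: (i == j); rewrite (normr1, normr0).
  by apply: mulr_ile1 => //; exact: ltW.
move: (h * e) (x 0 i) => a c; have := sqr_ge0 (a - c); nra.
Qed.

Definition osc_dx j (b : 'rV[R]_N -> R[i]) z :=
  ii * (coordc (ixi j) z * b z) + cpartial (ix j) b z.

Definition osc_coord j (b : 'rV[R]_N -> R[i]) z :=
  coordc (iy j) z * b z + ii * cpartial (ixi j) b z.

Let omegaV2_ge0 (xi : 'rV[R]_n) : 0 <= omega xi ^- 2.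
Proof. exact: omegaXV_ge0. Qed.

Let omegaV_ge0 (xi : 'rV[R]_n) : 0 <= (omega xi)^-1.
Proof. by rewrite invr_ge0 ltW// omega_gt0. Qed.

Lemma amp_class_osc_dx j b : amp_class omegaV2 b ->
  amp_class (fun xi => (omega xi)^-1) (fun t => osc_dx j (b t)).
Proof.
move=> hb; apply: amp_classD => //.
  apply: amp_classZ => //; apply: amp_class_xi hb => // xi.
  by rewrite expr2 invfM mulrA mulfV ?mul1r// gt_eqF ?omega_gt0.
by apply: amp_class_omegaV; exact: hered_partial.
Qed.

Lemma amp_class_osc_coord j b : amp_class omegaV2 b ->
  amp_class omegaV2 (fun t => osc_coord j (b t)).
Proof.
move=> hb; apply: amp_classD => //; first exact: amp_class_y.
by apply: amp_classZ => //; exact: hered_partial.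
Qed.

Lemma osc_integral_dominated b t x : amp_class omegaV2 b ->
  cdominated (fun w => osc_kernel (row_mx x w) * b t (row_mx x w)).
Proof.
move=> hb.
have [C _] := osc_integral_bounded (amp_class_bounded t (amp_class_omegaV hb)).
exact: fiber_dominated.
Qed.

Lemma is_cderive_osc_integral j b t : amp_class omegaV2 b ->
  is_cderive j (osc_integral (b t)) (osc_integral (osc_dx j (b t))).
Proof.
move=> hb.
have [C _ h1] := osc_integral_bounded (amp_class_bounded t (amp_class_omegaV hb)).
have [D D0 h2] := osc_integral_bounded (amp_class_bounded t (amp_class_osc_dx j hb)).
apply: is_cderive_fiber_integral h1 h2 _ => [x|].
  exists (D * (3 ^+ n * omega x) ^+ M) => h h1'; rewrite ler_wpM2l// lerXn2r ?nnegrE//.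
  - by rewrite ltW ?omega_gt0.
  - by rewrite mulr_ge0 ?exprn_ge0// ltW ?omega_gt0.
  - exact: omega_shift_le.
apply: (is_cderive_ext _ _ (is_cderiveM (osc_kernel_dx j)
  (smooth_is_cderive (ix j) (hered_smooth t hb)))) => // z.
by rewrite /osc_dx; ring.
Qed.

Let ii_algebra (x y e b d : R[i]) :
  ii * (x - y) * e * b + e * d = ii * x * (e * b) + - ii * (e * (y * b + ii * d)).
Proof.
have i2 : ii * ii = -1.
  by apply/eqP; rewrite eq_complex /=; apply/andP; split; apply/eqP; ring.
have -> : ii * x * (e * b) + - ii * (e * (y * b + ii * d)) =
  ii * (x - y) * e * b - (ii * ii) * (e * d) by ring.
by rewrite i2; ring.
Qed.

Lemma coordc_osc_integral j b t x : amp_class omegaV2 b ->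
  coordc j x * osc_integral (b t) x = osc_integral (osc_coord j (b t)) x.
Proof.
move=> hb.
have hy := amp_class_y gauge01 j omegaV2_ge0 hb.
have hd : amp_class omegaV2 (fun t => cpartial (ixi j) (b t)) by exact: hered_partial.
have d1 := osc_integral_dominated t x hb.
have d2 := osc_integral_dominated t x (amp_class_osc_coord j hb).
pose dc z := ii * (coordc (ix j) z - coordc (iy j) z) * osc_kernel z * b t z +
  osc_kernel z * cpartial (ixi j) (b t) z.
have dcE w : dc (row_mx x w) = ii * coordc j x * (osc_kernel (row_mx x w) * b t (row_mx x w)) +
    - ii * (osc_kernel (row_mx x w) * osc_coord j (b t) (row_mx x w)).
  have -> : coordc j x = coordc (ix j) (row_mx x w) by rewrite /coordc row_mxEl.
  exact: ii_algebra.
have dE : (fun w => dc (row_mx x w)) = (fun w =>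
   ii * coordc j x * (osc_kernel (row_mx x w) * b t (row_mx x w)) +
    - ii * (osc_kernel (row_mx x w) * osc_coord j (b t) (row_mx x w))).
  by apply/funext => w; exact: dcE.
have : fiber_integral dc x = 0.
  apply: (@fiber_integral_partial R _ _ (fun z => osc_kernel z * b t z) dc (rshift n j)) => //.
    by rewrite dE; apply: cdominatedD; exact: cdominatedZ.
  by apply: (is_cderiveM (osc_kernel_dxi j)); apply: smooth_is_cderive; exact: (hered_smooth t hb).
rewrite /fiber_integral dE cintegralD; [|exact: cdominatedZ|exact: cdominatedZ].
rewrite !cintegralZ//.
rewrite -[cintegral (fun w => _ * b t _)]/(osc_integral (b t) x).
rewrite -[cintegral (fun w => _ * osc_coord _ _ _)]/(osc_integral (osc_coord j (b t)) x).
move=> /eqP; rewrite mulNr subr_eq0 -mulrA => /eqP; apply: mulfI.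
by rewrite eq_complex /= oner_eq0 andbF.
Qed.

Lemma est_osc_integral b : amp_class omegaV2 b ->
  est gauge neg (fun t => osc_integral (b t)) (fun x => omega x ^+ M).
Proof.
move=> hb; apply: est_fiber_integral => [t|].
  apply: ccontinuousM; first exact: ccontinuous_osc_kernel.
  exact: smooth_ccontinuous (hered_smooth t hb).
have := hered_self (amp_class_omegaV hb) => /(_ 1%N).
have -> : amp_weight M (fun xi : 'rV[R]_n => (omega xi)^-1) 1 =
   (fun z : 'rV[R]_N => omega (lsubmx z) ^+ M / omega (rsubmx z)).
  apply/funext => z; rewrite /amp_weight expr1 (omega_submx (rsubmx z)) invfM; ring.
move=> h; apply: (est_bound _ h) => t z.
by rewrite normcM normc_osc_kernel mul1r.
Qed.

(** The class for [schwartz_fam_closure] consists of the integrals of amplitudes of weight omega^-2,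
    all bounded by omega(x)^M. The cut-off [psi] enters to identify two representations of one
    function as the same limit. *)
Lemma schwartz_fam_osc_integral (psi : 'rV[R]_(n + n) -> R[i]) b : cut_off psi -> psi 0 = 1 ->
  amp_class omegaV2 b ->
  schwartz_fam gauge neg (fun t => osc_integral (b t)).
Proof.
move=> hpsi psi0 hb.
apply: (@schwartz_fam_closure R T gauge gauge01 n neg M
  (fun F => exists2 b, amp_class omegaV2 b & F = fun t => osc_integral (b t))); last by exists b.
move=> _ [{hb}b hb ->].
have dE j t := is_cderive_osc_integral j t hb.
split.
- move=> t; have [C _ h1] := osc_integral_bounded (amp_class_bounded t (amp_class_omegaV hb)).
  apply: ccontinuous_fiber_integral h1.
  by apply: cont_mul; [exact: cst_continuous|apply: cont_exp; exact: continuous_omega].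
- exact: est_osc_integral.
(* Differentiation leads to weight omega^-1, outside the class. Regularising once more yields [b0]
   of weight omega^-2 with the same integral, by uniqueness of the limit. *)
- move=> j; have [b0 hb0 ob0] := oscillates_omegaV (amp_class_osc_dx j hb).
  exists (fun t => osc_integral (b0 t)); last by exists b0.
  move=> t; rewrite (osc_converges_unique hpsi psi0 (ob0 t)
    (osc_converges_omegaV (amp_class_bounded t (amp_class_osc_dx j hb)))).
  exact: dE.
- move=> j; exists (fun t => osc_coord j (b t)); first exact: amp_class_osc_coord.
  by apply/funext => t; apply/funext => x; exact: coordc_osc_integral.
Qed.

End oscillatory_convergence.

(** * Translation between the seminorms of the definitions and pointwise estimates *)

Section multi_indices.
Variables (R : realType) (p : nat).
Implicit Types f : 'rV[R]_p -> R[i].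

Lemma foldr_cpartial_mpartial f s : smooth f ->
  foldr (@cpartial R p) f s = mpartial (\row_i count_mem i s) f.
Proof.
by move=> [sR sI]; rewrite foldr_cpartialE !foldr_partialE.
Qed.

Lemma mpartialE alpha : exists s, forall f, mpartial alpha f = foldr (@cpartial R p) f s.
Proof.
have [s sE] := @mpartialRE R p alpha; exists s => f.
by rewrite foldr_cpartialE /mpartial; apply/funext => x; rewrite !sE.
Qed.

Lemma smooth_mpartial alpha f : smooth f -> smooth (mpartial alpha f).
Proof. by have [s ->] := mpartialE alpha => sf; exact: smooth_foldr. Qed.

End multi_indices.

Section essential_suprema.
Variables (R : realType) (p : nat).

Lemma continuous_normcM (m : 'rV[R]_p -> R) f : continuous m -> ccontinuous f ->
  continuous (fun x => normc ((m x)%:C * f x)).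
Proof.
move=> cm cf; apply: (@ccontinuous_normc _ _ (fun x => (m x)%:C * f x)).
apply: ccontinuousM cf; split=> //; exact: cst_continuous.
Qed.

Lemma Linfty_ge0 (f : 'rV[R]_p -> R[i]) : continuous (fun x => normc (f x)) ->
  (0 <= Linfty f)%E.
Proof. by move=> cf; apply: le_trans (le_Linfty 0 cf); rewrite lee_fin normc_ge0. Qed.

Lemma Linfty_lty_bound (f : 'rV[R]_p -> R[i]) : continuous (fun x => normc (f x)) ->
  (Linfty f < +oo)%E -> exists2 C, 0 <= C & forall x, normc (f x) <= C.
Proof.
move=> cf foo; have f0 := Linfty_ge0 cf.
have fE : Linfty f = (fine (Linfty f))%:E by rewrite fineK// ge0_fin_numE.
exists (fine (Linfty f)); first exact: fine_ge0.
by move=> x; rewrite -lee_fin -fE; exact: le_Linfty.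
Qed.

(** Continuity makes the essential supremum a pointwise bound, and the supremum over eps makes the
    constant uniform. *)
Lemma ereal_sup_Linfty_bound (g : R -> R) (V : R -> 'rV[R]_p -> R[i]) :
  (forall e, 0 < e <= 1 -> 0 <= g e) ->
  (forall e, 0 < e <= 1 -> continuous (fun x => normc (V e x))) ->
  (ereal_sup [set (g eps)%:E * Linfty (V eps) | eps in [set e : R | (0 < e <= 1)%R]] < +oo)%E ->
  exists2 C, 0 <= C & forall e x, 0 < e <= 1 -> g e * normc (V e x) <= C.
Proof.
move=> g0 cV; set S := ereal_sup _ => Soo.
have le e x : 0 < e <= 1 -> ((g e * normc (V e x))%:E <= S)%E.
  move=> e01; apply: (@le_trans _ _ ((g e)%:E * Linfty (V e))%E).
    by rewrite EFinM lee_wpmul2l ?lee_fin ?g0//; apply: le_Linfty; exact: cV.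
  by apply: ereal_sup_ubound; exists e.
have e1 : 0 < (1 : R) <= 1 by rewrite ltr01 lexx.
have S0 : (0 <= S)%E.
  by apply: le_trans (le 1 0 e1); rewrite lee_fin mulr_ge0 ?normc_ge0 ?g0.
have SE : S = (fine S)%:E by rewrite fineK// ge0_fin_numE.
exists (fine S); first exact: fine_ge0.
by move=> e x e01; rewrite -lee_fin -SE; exact: le.
Qed.

Lemma ereal_sup_Linfty_lty (g : R -> R) (V : R -> 'rV[R]_p -> R[i]) C : 0 <= C ->
  (forall e, 0 < e <= 1 -> 0 < g e) ->
  (forall e x, 0 < e <= 1 -> g e * normc (V e x) <= C) ->
  (ereal_sup [set (g eps)%:E * Linfty (V eps) | eps in [set e : R | (0 < e <= 1)%R]] < +oo)%E.
Proof.
move=> C0 g0 gV; apply: (@le_lt_trans _ _ C%:E); last exact: ltry.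
apply: ub_ereal_sup => _ [e /= e01 <-].
have ge0 := g0 e e01.
have := @Linfty_ub R p (V e) (C / g e) (divr_ge0 C0 (ltW ge0)) => h.
apply: (@le_trans _ _ ((g e)%:E * (C / g e)%:E)%E).
  rewrite lee_wpmul2l ?lee_fin ?(ltW ge0)//; apply: h => x.
  by rewrite ler_pdivlMr// mulrC gV.
by rewrite -EFinM lee_fin mulrC divfK// gt_eqF.
Qed.

End essential_suprema.

(** * Comparison of the Japanese bracket with [omega] *)

Section japanese_bracket.
Variables (R : realType) (p : nat).

Lemma dotv_ge0 (x : 'rV[R]_p) : 0 <= dotv x x.
Proof. by apply: sumr_ge0 => i _; rewrite -expr2 sqr_ge0. Qed.

Lemma jap_sqr (x : 'rV[R]_p) : jap x ^+ 2 = 1 + dotv x x.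
Proof. by rewrite /jap /enorm !sqr_sqrtr ?addr_ge0 ?dotv_ge0. Qed.

Lemma jap_ge1 (x : 'rV[R]_p) : 1 <= jap x.
Proof.
by rewrite /jap -[leLHS]sqrtr1; apply: ler_wsqrtr; rewrite lerDl sqr_ge0.
Qed.

Lemma jap_gt0 (x : 'rV[R]_p) : 0 < jap x.
Proof. exact: lt_le_trans ltr01 (jap_ge1 x). Qed.

Lemma jap_le_omega (x : 'rV[R]_p) : jap x <= omega x.
Proof.
apply: (@le_trans _ _ (jap x ^+ 2)); first by rewrite expr2 ler_peMr ?jap_ge1// ltW ?jap_gt0.
rewrite jap_sqr /dotv /omega.
elim: (index_enum _) => [|i s ih]; first by rewrite !big_nil addr0.
rewrite !big_cons; have : 1 <= \prod_(j <- s) (1 + x 0 j ^+ 2).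
  elim: s {ih} => [|j s ih]; first by rewrite big_nil.
  by rewrite big_cons; apply: mulr_ege1 => //; rewrite lerDl sqr_ge0.
move: (\prod_(j <- s) _) (\sum_(j <- s) _) ih => P S ih P1.
have -> : (1 + x 0 i ^+ 2) * P = P + x 0 i * x 0 i * P by ring.
rewrite [leLHS](_ : _ = (1 + S) + x 0 i * x 0 i * 1); last by ring.
apply: lerD; first exact: ih.
by apply: ler_wpM2l => //; rewrite -expr2 sqr_ge0.
Qed.

(** A Peetre-type inequality, one coordinate at a time: 2 (1 + a^2)(1 + b^2) exceeds 1 + (a - b)^2
    by 1 + (a + b)^2 + 2 a^2 b^2. It separates x from y in the weight <x - y>^m'. *)
Lemma omegaB_le (x y : 'rV[R]_p) : omega (x - y) <= 2 ^+ p * (omega x * omega y).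
Proof.
have -> : 2 ^+ p = \prod_(i < p) (2 : R) by rewrite prodr_const card_ord.
rewrite /omega -!big_split /=; apply: ler_prod => i _.
rewrite addr_ge0 ?sqr_ge0//= !mxE.
move: (x 0 i) (y 0 i) => a b.
rewrite -subr_ge0 [leRHS](_ : _ = 1 + (a + b) ^+ 2 + 2 * (a ^+ 2 * b ^+ 2)); last by ring.
by apply: addr_ge0; rewrite -?exprMn ?addr_ge0 ?sqr_ge0// mulr_ge0 ?sqr_ge0.
Qed.

End japanese_bracket.

(** * Schwartz functions as one-point families *)

Section schwartz_functions.
Variables (R : realType) (p : nat).

Lemma continuous_monom (alpha : 'rV[nat]_p) : continuous (@monom R p alpha).
Proof.
rewrite /monom; elim: (index_enum _) => [|i s ih].
  by under eq_fun do rewrite big_nil; exact: cst_continuous.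
under eq_fun do rewrite big_cons; apply: cont_mul ih.
by apply: cont_exp; exact: coord_continuous.
Qed.

Lemma schwartz_cut_off (f : 'rV[R]_p -> R[i]) : schwartz f -> cut_off f.
Proof.
move=> [sf hf]; split=> // s k; rewrite (foldr_cpartial_mpartial s sf).
set beta := \row_i _.
have e1 (t : unit) : 0 < (1 : R) <= 1 by rewrite ltr01 lexx.
have -> : (fun x : 'rV[R]_p => omega x ^- k) = (fun x => 1 / omega x ^+ k).
  by apply/funext => x; rewrite mul1r.
apply: (@est_monom R unit (fun=> 1) e1 p false (fun _ => mpartial beta f) (fun=> 1)) => // alpha.
have cv : continuous (fun x => normc ((monom alpha x)%:C * mpartial beta f x)).
  apply: continuous_normcM; last by apply: smooth_ccontinuous; exact: smooth_mpartial.
  exact: continuous_monom.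
have [C C0 hC] := Linfty_lty_bound cv (hf alpha beta).
by apply: (@est_const R unit (fun=> 1) p _ _ C) => // x; rewrite mulr1.
Qed.

Lemma cut_off_schwartz (f : 'rV[R]_p -> R[i]) : cut_off f -> schwartz f.
Proof.
move=> hf; split; first exact: (hered_smooth tt hf).
move=> alpha beta /=; have [s ->] := @mpartialE R p beta.
have [C C0 hC] : exists2 C, 0 <= C & forall x, normc (foldr (@cpartial R p) f s x) <=
    C / omega x ^+ mdeg alpha.
  have [_ /(_ s (mdeg alpha))/est_at h] := hf.
  by apply: (h _ tt) => _; rewrite ltr01 lexx.
apply: (@le_lt_trans _ _ C%:E); last exact: ltry.
apply: Linfty_ub => // x; rewrite normcM normc_real.
apply: le_trans (ler_pM (normr_ge0 _) (normc_ge0 _) (norm_monom_le _ _) (hC x)) _.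
by rewrite mulrCA mulfV ?mulr1// gt_eqF ?omegaX_gt0.
Qed.

End schwartz_functions.

(** * A normalised cut-off from the mollifier, and rescaled mollifiers *)

Section mollified_cut_offs.
Variables (R : realType) (n : nat).

Lemma fourier0 (f : 'rV[R]_n -> R[i]) : fourier f 0 = cintegral f.
Proof.
rewrite /fourier; congr cintegral; apply/funext => x.
rewrite /dotv big1 ?oppr0; last by move=> i _; rewrite mxE mulr0.
by rewrite /expi cos0 sin0 mul1r.
Qed.

Lemma cut_off_fourier (f : 'rV[R]_n -> R[i]) : cut_off f -> cut_off (fourier f).
Proof.
apply: (@schwartz_fam_fourier R unit (fun=> 1) _ n false (fun=> f)) => _.
by rewrite ltr01 lexx.
Qed.

(** Each factor decays in its own block of variables only; as [omega] is multiplicative over the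
    blocks, the product decays in both. *)
Lemma cut_off_product (f : 'rV[R]_n -> R[i]) : cut_off f ->
  cut_off (fun w : 'rV[R]_(n + n) => f (lsubmx w) * f (rsubmx w)).
Proof.
move=> hf; have e1 (t : unit) : 0 < (1 : R) <= 1 by rewrite ltr01 lexx.
have pull (s : 'I_n -> 'I_(n + n)) (pr : 'rV[R]_(n + n) -> 'rV[R]_n) : injective s ->
    (forall w, pr w = rowsel s w) ->
    hered (fun F => forall k, est (fun _ : unit => 1 : R) false F (fun w => omega (pr w) ^- k))
      (fun _ w => f (pr w)).
  move=> si prE; have -> : pr = rowsel s by apply/funext.
  apply: (@hered_rowsel R unit (n + n) n s (rapid (fun=> 1) false) _ (fun=> f)) => //.
  - move=> F hF k; have [q [C C0 h]] := hF k.
    by exists q, C => // t x; exact: h.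
  - by move=> k; exact: est0.
apply: (heredM _ _ (pull (@lshift n n) _ _ _) (pull (@rshift n n) _ _ _)).
- move=> F G hF hG k; have := estM e1 (hF k) (hG k); apply: (est_le e1 ler01) => w.
  by rewrite mul1r (omega_submx w) exprMn invfM.
- exact: rapidD.
- exact: lshift_inj.
- by move=> w; apply/rowP => i; rewrite !mxE.
- exact: rshift_inj.
- by move=> w; apply/rowP => i; rewrite !mxE.
Qed.

(** Without a Schwartz function equal to 1 at 0, every number would vacuously be an oscillatory
    integral. The mollifier provides one: its transform takes the value 1 at 0 because its integral
    is 1. *)
Lemma exists_cut_off (phi : 'rV[R]_n -> R[i]) : mollifier phi ->
  exists2 psi : 'rV[R]_(n + n) -> R[i], cut_off psi & psi 0 = 1.
Proof.
move=> [/schwartz_cut_off sphi phi1 _].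
exists (fun w => fourier phi (lsubmx w) * fourier phi (rsubmx w)).
  by apply: cut_off_product; exact: cut_off_fourier.
have -> : lsubmx (0 : 'rV[R]_(n + n)) = 0 by apply/rowP => i; rewrite !mxE.
have -> : rsubmx (0 : 'rV[R]_(n + n)) = 0 by apply/rowP => i; rewrite !mxE.
by rewrite fourier0 phi1 mulr1.
Qed.

Variables (T : Type) (gauge : T -> R).
Hypothesis gauge01 : forall t, 0 < gauge t <= 1.

Lemma omega_scale_ge (c : R) (x : 'rV[R]_n) : 1 <= c -> omega x <= omega (c *: x).
Proof.
move=> c1; apply: ler_prod => i _; rewrite addr_ge0 ?sqr_ge0//= !mxE lerD2l exprMn.
by rewrite ler_peMl ?sqr_ge0// expr_ge1// (le_trans ler01).
Qed.

Let continuous_scale (c : R) : continuous (fun x : 'rV[R]_n => c *: x).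
Proof.
apply: continuous_rV => i.
have -> : (fun x : 'rV[R]_n => (c *: x) 0 i) = (fun x => cst c x * x 0 i).
  by apply/funext => x; rewrite !mxE.
by apply: cont_mul; [exact: cst_continuous|exact: coord_continuous].
Qed.

(** Each derivative costs one more negative power of eps, recorded by [k], so the family is
    moderate. Decay is not lost, since dividing x by eps <= 1 only increases omega. *)
Lemma schwartz_fam_rescale (phi : 'rV[R]_n -> R[i]) : cut_off phi ->
  schwartz_fam gauge false (fun t => rescale phi (gauge t)).
Proof.
move=> hphi.
apply: (@hered_coind R T n _ (fun F => exists psi k, cut_off psi /\
   F = fun t x => (gauge t ^- k)%:C * psi ((gauge t)^-1 *: x))); last by exists phi, n.
move=> _ [psi [k [hpsi ->]]]; split.
- move=> t; apply: ccontinuousM; first exact: ccontinuous_cst.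
  by apply: ccontinuous_comp (cut_off_ccontinuous hpsi); exact: continuous_scale.
- move=> l; have [C C0 hC] := cut_off_le l hpsi.
  exists k, C => // t x; have /andP[g0 g1] := gauge01 t.
  have gk : 0 <= gauge t ^- k by rewrite invr_ge0 exprn_ge0// ltW.
  rewrite normcM normc_real ger0_norm// [C * _]mulrC -mulrA ler_wpM2l//.
  apply: le_trans (hC _) _; rewrite ler_wpM2l// lef_pV2 ?posrE ?omegaX_gt0//.
  rewrite lerXn2r ?nnegrE ?(ltW (omega_gt0 _))//.
  by apply: omega_scale_ge; rewrite invf_ge1.
- move=> i; exists (fun t x => (gauge t ^- k.+1)%:C * cpartial i psi ((gauge t)^-1 *: x)).
    move=> t.
    have d : is_cderive i (fun x => psi ((gauge t)^-1 *: x))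
        (fun x => ((gauge t)^-1)%:C * cpartial i psi ((gauge t)^-1 *: x)).
      apply: (@is_cderive_affine R n n (fun x => (gauge t)^-1 *: x) i i).
        by move=> h z; rewrite scalerDr !scalerA mulrC.
      by apply: smooth_is_cderive; exact: (hered_smooth tt hpsi).
    apply: (is_cderive_ext _ _ (is_cderiveM (@is_cderive_cst R n i (gauge t ^- k)%:C) d)) => // x.
    by rewrite mul0r add0r mulrA -rmorphM /= exprSr invfM.
  by exists (cpartial i psi), k.+1; split => //; exact: cut_off_partial.
Qed.

End mollified_cut_offs.

(** * The spaces E_tau and N_S in terms of families *)

Section nets.
Variables (R : realType) (p : nat).
Local Notation param := {e : R | 0 < e <= 1}.
Local Notation family u := (fun t : param => u (sval t)).
Implicit Types u : net R p.

Lemma continuous_jap : continuous (@jap R p).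
Proof.
have -> : @jap R p = (fun x => Num.sqrt (1 + \sum_i x 0 i * x 0 i)).
  by apply/funext => x; rewrite /jap /enorm sqr_sqrtr ?dotv_ge0.
apply: (@cont_comp _ _ _ (fun x : 'rV[R]_p => 1 + \sum_i x 0 i * x 0 i) Num.sqrt).
  apply: (@cont_add R _ (fun=> 1) (fun x : 'rV[R]_p => \sum_i x 0 i * x 0 i));
    first exact: cst_continuous.
  elim: (index_enum _) => [|i s ih].
    by under eq_fun do rewrite big_nil; exact: cst_continuous.
  by under eq_fun do rewrite big_cons; apply: cont_add ih; apply: cont_mul; exact: coord_continuous.
exact: sqrt_continuous.
Qed.

Lemma net_foldr u s : smooth_net u ->
  (fun t : param => foldr (@cpartial R p) (u (sval t)) s) =
  (fun t : param => mpartial (\row_i count_mem i s) (u (sval t))).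
Proof.
by move=> su; apply/funext => t; rewrite foldr_cpartial_mpartial//; apply: su; exact: (svalP t).
Qed.

Let gX_gt0 k (e : R) : 0 < e <= 1 -> 0 < e ^+ k.
Proof. by move=> /andP[e0 _]; rewrite exprn_gt0. Qed.

Let gXV_gt0 k (e : R) : 0 < e <= 1 -> 0 < e ^- k.
Proof. by move=> e0; rewrite invr_gt0 gX_gt0. Qed.

(** The exponent is quantified inside [hered], so the growth may depend on the derivative. One N
    serves both as order in eps and as power of the bracket. *)
Lemma E_tau_hered u : E_tau u ->
  hered (fun F => exists k, est (@sval R _) false F (fun x => omega x ^+ k)) (family u).
Proof.
move=> [su hu]; split=> [t|s]; first by apply: su; exact: (svalP t).
rewrite (net_foldr s su); set beta := \row_i _.
have [k hk] := hu beta.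
have [C C0 hC] : exists2 C, 0 <= C & forall e x, 0 < e <= 1 ->
    e ^+ k * normc ((jap x ^- k)%:C * mpartial beta (u e) x) <= C.
  apply: ereal_sup_Linfty_bound hk => e e01; first exact/ltW/gX_gt0.
  apply: continuous_normcM; last by apply: smooth_ccontinuous; apply: smooth_mpartial; exact: su.
  apply: cont_inv; first by apply: cont_exp; exact: continuous_jap.
  by move=> x; rewrite gt_eqF// exprn_gt0// jap_gt0.
exists k, k, C => // -[e e01] x /=.
have := hC e x e01; rewrite normcM normc_real ger0_norm ?invr_ge0 ?exprn_ge0 ?(ltW (jap_gt0 _))//.
rewrite mulrCA ler_pdivrMl ?exprn_gt0 ?jap_gt0// => h.
have e0 := gX_gt0 k e01.
rewrite mulrAC ler_pdivlMr// mulrC; apply: le_trans h _.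
rewrite mulrC ler_wpM2l// lerXn2r ?nnegrE ?(ltW (jap_gt0 _)) ?(ltW (omega_gt0 _))//.
exact: jap_le_omega.
Qed.

Lemma N_S_hered u : N_S u ->
  hered (fun F => exists k, est (@sval R _) true F (fun x => omega x ^+ k)) (family u).
Proof.
move=> [su hu]; split=> [t|s]; first by apply: su; exact: (svalP t).
(* The seminorms with alpha = 0 bound the derivatives without any growth, hence the exponent 0. *)
rewrite (net_foldr s su); set beta := \row_i _; exists 0%N => q.
have [C C0 hC] : exists2 C, 0 <= C & forall e x, 0 < e <= 1 ->
    e ^- q * normc ((monom 0 x)%:C * mpartial beta (u e) x) <= C.
  apply: ereal_sup_Linfty_bound (hu 0 beta q) => e e01; first exact/ltW/gXV_gt0.
  apply: continuous_normcM; first exact: continuous_monom.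
  by apply: smooth_ccontinuous; apply: smooth_mpartial; exact: su.
exists C => // -[e e01] x /=; rewrite expr0 mulr1.
have := hC e x e01; rewrite /monom big1 => [|i _]; last by rewrite mxE.
by rewrite mul1r ler_pdivrMl ?gX_gt0// mulrC.
Qed.

Lemma schwartz_fam_E_tau u : schwartz_fam (@sval R _) false (family u) -> E_tau u.
Proof.
move=> hu; split=> [e e01|alpha]; first exact: (hered_smooth (exist _ e e01) hu).
have [s sE] := @mpartialE R p alpha.
have [_ /(_ s 0%N)[k [C C0 hC]]] := hu; exists k => /=.
apply: (ereal_sup_Linfty_lty C0); first exact: gX_gt0.
move=> e x e01; rewrite sE normcM normc_real.
have := hC (exist _ e e01) x; rewrite expr0 invr1 mulr1 /= => h.
have je : `|jap x ^- k| <= 1.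
  rewrite ger0_norm ?invr_ge0 ?exprn_ge0 ?(ltW (jap_gt0 _))//.
  by rewrite invf_le1 ?exprn_gt0 ?jap_gt0// exprn_ege1// jap_ge1.
rewrite -ler_pdivlMl ?gX_gt0// [leRHS]mulrC; apply: le_trans h.
by rewrite ler_piMl// normc_ge0.
Qed.

Lemma schwartz_fam_N_S u : schwartz_fam (@sval R _) true (family u) -> N_S u.
Proof.
move=> hu; split=> [e e01|alpha beta q]; first exact: (hered_smooth (exist _ e e01) hu).
have [s sE] := @mpartialE R p beta.
have [_ /(_ s (mdeg alpha) q)[C C0 hC]] := hu => /=.
apply: (ereal_sup_Linfty_lty C0); first exact: gXV_gt0.
move=> e x e01; rewrite sE normcM normc_real.
have := hC (exist _ e e01) x; rewrite /= => h.
rewrite ler_pdivrMl ?gX_gt0// [leRHS]mulrC.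
apply: le_trans (ler_pM (normr_ge0 _) (normc_ge0 _) (norm_monom_le _ _) h) _.
by rewrite mulrCA mulfV ?mulr1// gt_eqF ?omegaX_gt0.
Qed.

End nets.

(** * Polynomial bounds for the amplitude weights *)

Section weight_bounds.
Variable R : realType.

(** Since [D] dominates both [L] and its inverse, real exponents of either sign are handled at
    once. *)
Lemma powR_le_expr (L D m : R) K : 0 < L -> L <= D -> L^-1 <= D -> 1 <= D ->
  `|m| <= K%:R -> L `^ m <= D ^+ K.
Proof.
move=> L0 LD LVD D1.
have aux (l r : R) : 0 <= l -> l <= D -> 0 <= r -> r <= K%:R -> l `^ r <= D ^+ K.
  move=> l0 lD r0 rK; have D0 : 0 <= D by exact: le_trans ler01 D1.
  apply: le_trans (ge0_ler_powR r0 _ _ lD) _; rewrite ?nnegrE//.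
  by rewrite -powR_mulrn// ler_powR.
have [m0|m0] := leP 0 m; first by rewrite ger0_norm//; apply: aux => //; exact: ltW.
rewrite ltr0_norm// => mK.
have -> : L `^ m = L^-1 `^ (- m).
  by rewrite -powR_inv1 ?ltW// -powRrM mulN1r opprK.
by apply: aux => //; [rewrite invr_ge0 ltW|rewrite oppr_ge0 ltW].
Qed.

Variables (n : nat) (Lambda : 'rV[R]_(n + n) -> R).

(** The upper bound by <z> controls Lambda; the lower bound by <z>^mu, which is at least 1, yields
    both positivity and the control of the inverse. *)
Lemma weight_le_omega : weight Lambda -> exists2 B, 1 <= B & forall z,
  [/\ 0 < Lambda z, Lambda z <= B * omega z & (Lambda z)^-1 <= B * omega z].
Proof.
move=> [_ [mu mu0 [[c c0 hc] [d d0 hd] _]] _].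
have [cB dB B1] : [/\ c <= 1 + c + d, d <= 1 + c + d & 1 <= 1 + c + d] by split; lra.
exists (1 + c + d) => // z.
have j1 : 1 <= jap z `^ mu.
  rewrite -[leLHS](congr1 (@^~ mu) (@powR1 R)); apply: ge0_ler_powR;
    rewrite ?nnegrE ?jap_ge1 ?ltW ?jap_gt0//.
have cL : 1 <= c * Lambda z by exact: le_trans j1 (hc z I).
have L0 : 0 < Lambda z by rewrite -(pmulr_rgt0 _ c0) (lt_le_trans ltr01).
split=> //.
  apply: le_trans (hd z I) _; apply: ler_pM => //; rewrite ?(ltW d0) ?(ltW (jap_gt0 _))//.
  exact: jap_le_omega.
apply: (@le_trans _ _ c); first by rewrite -ler_pdivrMr// div1r in cL *.
rewrite -[leLHS]mulr1; apply: ler_pM; rewrite ?(ltW c0)//; exact: omega_ge1.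
Qed.

(** The factor with exponent -rho |alpha + beta + gamma| is at most 1, its base being at least 1.
    Hence [M] and [C] do not depend on the derivative, which is what provides a single power of x
    for the whole proof. *)
Lemma lambda_le (m rho m' : R) : weight Lambda -> 0 < rho ->
  exists M C, 0 <= C /\ forall alpha beta gamma x y xi,
    lambda Lambda m rho m' alpha beta gamma x y xi <=
      C * (omega x ^+ M * omega xi ^+ M * omega y ^+ M).
Proof.
move=> /weight_le_omega [B B1 hB] rho0.
pose K := (Num.bound `|m|); pose K' := (Num.bound `|m'|).
have mK : `|m| <= K%:R by rewrite ltW// archi_boundP.
have mK' : `|m'| <= K'%:R by rewrite ltW// archi_boundP.
have B0 : 0 <= B by exact: le_trans ler01 B1.
exists (K + K')%N, (B ^+ K * (2 ^+ n) ^+ K'); split.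
  by rewrite mulr_ge0 ?exprn_ge0.
move=> alpha beta gamma x y xi; rewrite /lambda.
have [L0 LB LVB] := hB (row_mx x xi).
have o1 := omega_ge1 (row_mx x xi).
have D1 : 1 <= B * omega (row_mx x xi) by rewrite -[leLHS]mulr1 ler_pM.
have l1 := powR_le_expr L0 LB LVB D1 mK.
have j1 := jap_ge1 (x - y).
have jV : (jap (x - y))^-1 <= jap (x - y).
  by apply: (le_trans _ j1); rewrite invf_le1 ?jap_gt0.
have l2 := powR_le_expr (jap_gt0 (x - y)) (lexx _) jV j1 mK'.
set P := _ `^ (- rho * _); have P1 : P <= 1.
  rewrite /P mulNr [leLHS]powRN invf_le1; last first.
    by rewrite powR_gt0// ltr_pwDl// mulr_ge0 ?powR_ge0// ltW.
  rewrite -[leLHS](congr1 (@^~ (rho * (mdeg alpha + mdeg beta + mdeg gamma)%:R)) (@powR1 R)).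
  apply: ge0_ler_powR; rewrite ?nnegrE ?mulr_ge0 ?(ltW rho0)//.
    by rewrite addr_ge0// mulr_ge0 ?powR_ge0// ltW.
  by rewrite lerDl mulr_ge0 ?powR_ge0// ltW.
have L'0 : 0 <= Lambda (row_mx x xi) `^ m * jap (x - y) `^ m' by rewrite mulr_ge0 ?powR_ge0.
apply: le_trans (_ : Lambda (row_mx x xi) `^ m * jap (x - y) `^ m' <= _).
  by rewrite ler_piMr.
apply: le_trans (ler_pM (powR_ge0 _ _) (powR_ge0 _ _) l1 l2) _.
apply: (@le_trans _ _ ((B * omega (row_mx x xi)) ^+ K * (2 ^+ n * (omega x * omega y)) ^+ K')).
  apply: ler_wpM2l; first by rewrite exprn_ge0// mulr_ge0// ltW ?omega_gt0.
  rewrite lerXn2r ?nnegrE ?(ltW (jap_gt0 _))//.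
    by rewrite !mulr_ge0 ?exprn_ge0// ltW ?omega_gt0.
  exact: le_trans (jap_le_omega _) (omegaB_le _ _).
rewrite omega_row_mx !exprMn !exprD.
have oX k q (v : 'rV[R]_q) : 1 <= omega v ^+ k by apply: exprn_ege1; exact: omega_ge1.
move: (oX K n x) (oX K' n x) (oX K n xi) (oX K' n xi) (oX K n y) (oX K' n y).
set a := omega x ^+ K; set a' := omega x ^+ K'; set c := omega xi ^+ K.
set c' := omega xi ^+ K'; set b := omega y ^+ K; set b' := omega y ^+ K'.
move=> a1 a1' c1 c1' b1 b1'.
rewrite [leLHS](_ : _ = B ^+ K * (2 ^+ n) ^+ K' * ((a * a') * c * b')); last by ring.
rewrite [leRHS](_ : _ = B ^+ K * (2 ^+ n) ^+ K' * (((a * a') * c * b') * (c' * b))); last by ring.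
have ge0 (r : R) : 1 <= r -> 0 <= r by exact: le_trans ler01.
apply: ler_wpM2l; first by rewrite mulr_ge0 ?exprn_ge0// ge0.
rewrite ler_peMr ?mulr_ge0 ?ge0//.
exact: mulr_ege1.
Qed.

End weight_bounds.

(** * Application to the operators *)

Section pseudo_differential_operators.
Variables (R : realType) (n : nat).
Variables (phi : 'rV[R]_n -> R[i]).
Hypothesis hphi : mollifier phi.
Local Notation N := (n + (n + n))%N.
Local Notation param := {e : R | 0 < e <= 1}.
Local Notation gauge := (@sval R (fun e => 0 < e <= 1)).
Local Notation px z := (lsubmx z).
Local Notation py z := (lsubmx (rsubmx z)).
Local Notation pxi z := (rsubmx (rsubmx z)).
Local Notation ampw M := (fun z : 'rV[R]_N =>
  omega (px z) ^+ M * omega (pxi z) ^+ M * omega (py z) ^+ M).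

Let gauge01 (t : param) : 0 < gauge t <= 1. Proof. exact: (svalP t). Qed.

Section amplitude_estimates.
Variables (Lambda : 'rV[R]_(n + n) -> R) (hLambda : weight Lambda).
Variables (m rho : R) (rho_gt0 : 0 < rho) (a : net R N).

Let mpartial_amplitude beta eps (z : 'rV[R]_N) : mpartial beta (a eps) z =
  amplitude_deriv a eps (rsubmx (rsubmx beta)) (lsubmx beta) (lsubmx (rsubmx beta))
    (px z) (py z) (pxi z).
Proof. by rewrite /amplitude_deriv !hsubmxK. Qed.

Let est_step (c C s l W : R) : 0 <= c -> 0 <= s -> l <= C * W ->
  c * l * s <= c * C * s * W.
Proof.
move=> c0 s0 lW; have -> : c * C * s * W = c * (C * W) * s by ring.
by rewrite ler_wpM2r// ler_wpM2l.
Qed.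

Lemma amplitude_hered : amplitude Lambda m rho a ->
  exists M, hered (fun F => est gauge false F (ampw M)) (fun t : param => a (gauge t)).
Proof.
move=> [sa [m' ha]]; have [M [C [C0 hM]]] := lambda_le m m' hLambda rho_gt0.
exists M; split=> [t|s]; first by apply: sa; exact: gauge01.
rewrite (net_foldr s sa); set beta := \row_i _.
have [k [c [c0 hc]]] := ha (rsubmx (rsubmx beta)) (lsubmx beta) (lsubmx (rsubmx beta)).
exists k, (c * C) => [|t z]; first by rewrite mulr_ge0// ltW.
rewrite mpartial_amplitude; apply: le_trans (hc _ _ _ _ (gauge01 t)) _.
apply: est_step => //; first exact: ltW.
by rewrite invr_ge0 exprn_ge0// ltW//; have /andP[] := gauge01 t.
Qed.

Lemma negligible_amplitude_hered : negligible_amplitude Lambda m rho a ->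
  exists M, hered (fun F => est gauge true F (ampw M)) (fun t : param => a (gauge t)).
Proof.
move=> [[sa _] [m' ha]]; have [M [C [C0 hM]]] := lambda_le m m' hLambda rho_gt0.
exists M; split=> [t|s]; first by apply: sa; exact: gauge01.
rewrite (net_foldr s sa); set beta := \row_i _ => q.
have [c [c0 hc]] := ha (rsubmx (rsubmx beta)) (lsubmx beta) (lsubmx (rsubmx beta)) q.
exists (c * C) => [|t z]; first by rewrite mulr_ge0// ltW.
rewrite mpartial_amplitude; apply: le_trans (hc _ _ _ _ (gauge01 t)) _.
apply: est_step => //; first exact: ltW.
by rewrite exprn_ge0// ltW//; have /andP[] := gauge01 t.
Qed.

End amplitude_estimates.

Variables (a : net R N) (u : net R n) (nega negu : bool) (M : nat).
Hypothesis ha : hered (fun F => est gauge nega F (ampw M)) (fun t : param => a (gauge t)).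
Hypothesis hu : hered (fun F => exists k, est gauge negu F (fun x => omega x ^+ k))
  (fun t : param => u (gauge t)).

Let chi (t : param) := fourier (rescale phi (gauge t)).

Lemma schwartz_fam_chi : schwartz_fam gauge false chi.
Proof.
apply: schwartz_fam_fourier => //; apply: schwartz_fam_rescale => //.
by have [/schwartz_cut_off] := hphi.
Qed.

Definition op_amplitude (t : param) (z : 'rV[R]_N) : R[i] :=
  a (gauge t) z * u (gauge t) (py z) * chi t (py z).

(** The product of u and chi is rapidly decreasing whatever the growth of the derivatives of u; of
    its decay, order [M + k] is used, [M] of it to absorb the growth of the amplitude in y. *)
Lemma amp_class_op_amplitude :
  amp_class gauge (nega || negu) M (fun xi => omega xi ^+ M) op_amplitude.
Proof.
pose sy (k : 'I_n) := @rshift n (n + n) (@lshift n n k).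
have pyE z : py z = rowsel sy z by apply/rowP => i; rewrite !mxE.
have syI : injective sy by move=> k l /rshift_inj /lshift_inj.
have uchi : schwartz_fam gauge negu (fun t x => u (gauge t) x * chi t x).
  apply: heredM hu schwartz_fam_chi => [F G [k hF] hG l|]; last exact: rapidD.
  rewrite -[negu]orbF.
  have := estM gauge01 hF (hG (k + l)%N); apply: (est_le gauge01 ler01) => x.
  by rewrite mul1r exprD invfM mulrA mulfV ?mul1r// gt_eqF ?omegaX_gt0.
have uchi_y : hered (fun F => forall k, est gauge negu F (fun z : 'rV[R]_N => omega (py z) ^- k))
    (fun t z => u (gauge t) (py z) * chi t (py z)).
  have -> : (fun (t : param) (z : 'rV[R]_N) => u (gauge t) (py z) * chi t (py z)) =
      (fun t z => u (gauge t) (rowsel sy z) * chi t (rowsel sy z)).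
    by apply/funext => t; apply/funext => z; rewrite pyE.
  apply: (hered_rowsel syI _ _ uchi) => [F hF k|k]; last exact: est0.
  have := hF k; rewrite /est; case: negu => [h q|[q [C C0 h]]].
    by have [C C0 {}h] := h q; exists C => // t z; rewrite pyE; exact: h.
  by exists q, C => // t z; rewrite pyE; exact: h.
have -> : op_amplitude = (fun t z => a (gauge t) z * (u (gauge t) (py z) * chi t (py z))).
  by apply/funext => t; apply/funext => z; rewrite mulrA.
apply: heredM ha uchi_y => [F G hF hG k|F G hF hG k]; last first.
  by apply: estD => // z; apply: amp_weight_ge0 => xi; exact: omegaX_ge0.
have := estM gauge01 hF (hG (M + k)%N); apply: (est_le gauge01 ler01) => z.
rewrite mul1r /amp_weight exprD invfM mulrA mulfK// gt_eqF ?omegaX_gt0//.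
Qed.

Lemma schwartz_fam_pseudo_diff_op :
  schwartz_fam gauge (nega || negu) (fun t => pseudo_diff_op phi a u (gauge t)).
Proof.
have [b0 hb0 ob0] := oscillates_omega gauge01 amp_class_op_amplitude.
have [psi0 hpsi0 psi01] := exists_cut_off hphi.
have -> : (fun t => pseudo_diff_op phi a u (gauge t)) =
    (fun t x => ((2 * pi) ^- n)%:C * osc_integral (b0 t) x).
  apply/funext => t; apply/funext => x; rewrite /pseudo_diff_op; congr (_ * _).
  set c := (c in oscillatory_integral c).
  have cE psi h : regularized_integral c psi x h =
      fiber_integral (reg_integrand (op_amplitude t) psi h) x.
    congr cintegral; apply/funext => w.
    by rewrite /c /reg_integrand osc_kernelE /op_amplitude !row_mxKr hsubmxK.
  have osc_c : is_oscillatory_integral c x (osc_integral (b0 t) x).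
    move=> psi /schwartz_cut_off hpsi psi1.
    have := ob0 t psi hpsi x; rewrite psi1 mul1r.
    by apply: clim_ext => h _; exact: cE.
  (* The chosen value is the limit just found, and not the default 0, because the set of admissible
     limits is a singleton: two of them are compared on the normalised cut-off. *)
  apply: xget_unique => // l hl.
  have spsi := cut_off_schwartz hpsi0.
  exact: clim_unique (hl psi0 spsi psi01) (osc_c psi0 spsi psi01).
by apply: schwartz_famZ => //; exact: schwartz_fam_osc_integral hpsi0 psi01 hb0.
Qed.

End pseudo_differential_operators.

Theorem theorem5p1 (R : realType) (n : nat)
    (phi : 'rV[R]_n -> R[i]) (hphi : mollifier phi)
    (Lambda : 'rV[R]_(n + n) -> R) (hLambda : weight Lambda)
    (m rho : R) (hrho : 0 < rho <= 1)
    (a : net R (n + (n + n))) (ha : amplitude Lambda m rho a) :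
  [/\ forall u : net R n, E_tau u -> E_tau (pseudo_diff_op phi a u),
      forall u : net R n, N_S u -> N_S (pseudo_diff_op phi a u) &
      negligible_amplitude Lambda m rho a ->
        forall u : net R n, E_tau u -> N_S (pseudo_diff_op phi a u)].
Proof.
have /andP[rho0 _] := hrho.
have [M hM] := amplitude_hered hLambda rho0 ha.
(* The image is a Schwartz family in all three cases, and its flag is the disjunction of those of
   the amplitude and the argument: moderate in the first case, negligible in the other two. The
   third uses the power [M'] from the negligible estimates, whose m' may differ. *)
split=> [u /E_tau_hered hu|u /N_S_hered hu|hna u /E_tau_hered hu].
- exact/schwartz_fam_E_tau/(schwartz_fam_pseudo_diff_op hphi hM hu).
- exact/schwartz_fam_N_S/(schwartz_fam_pseudo_diff_op hphi hM hu).
- have [M' hM'] := negligible_amplitude_hered hLambda rho0 hna.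
  exact/schwartz_fam_N_S/(schwartz_fam_pseudo_diff_op hphi hM' hu).
Qed.
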